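(* Let $X$ be a semi-equivelar map on the $2$-sphere $\mathbb{S}^2$. Then, up to isomorphism, $X$ is the boundary of a Platonic solid, the boundary of an Archimedean solid, the boundary of a regular prism $P_n$ ($n\ge 3$), the boundary of an antiprism $Q_n$ ($n\ge 3$), or the boundary of the pseudorhombicuboctahedron.
   Context: A map is a polyhedral map on a surface: a decomposition of the surface into faces, each an $n$-gon for some $n\ge 3$, such that any two intersecting faces meet either in exactly one vertex or in exactly one edge. Isomorphism of maps means combinatorial isomorphism (a bijection of vertices inducing a bijection of faces). For a vertex $u$, the faces containing $u$ form a cycle (the face-cycle of $u$) of the form $(F_{1,1}\text{-}\cdots\text{-}F_{1,n_1})\text{-}\cdots\text{-}(F_{k,1}\text{-}\cdots\text{-}F_{k,n_k})\text{-}F_{1,1}$ where each $F_{i,l}$ is a $p_i$-gon, $p_r\ne p_{r+1}$ and $p_k\ne p_1$. A map is semi-equivelar of vertex-type $[p_1^{n_1},\dots,p_k^{n_k}]$ if the face-cycle of every vertex has this same form (cyclic tuples are identified up to cyclic rotation and reversal). The Platonic solids are the tetrahedron, cube, octahedron, dodecahedron and icosahedron; the Archimedean solids are the 13 classical ones (truncated tetrahedron, cuboctahedron, truncated cube, truncated octahedron, small rhombicuboctahedron, great rhombicuboctahedron, snub cube, icosidodecahedron, truncated dodecahedron, truncated icosahedron, small rhombicosidodecahedron, great rhombicosidodecahedron, snub dodecahedron). The regular prism $P_n$ is the $2n$-vertex polytope whose boundary consists of two $n$-gons joined by a band of $n$ squares (vertex-type $[4^2,n^1]$). The antiprism $Q_n$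 is the $2n$-vertex polytope whose boundary consists of two $n$-gons joined by a band of $2n$ triangles (vertex-type $[3^3,n^1]$). The pseudorhombicuboctahedron (elongated square gyrobicupola) is the 24-vertex polytope obtained from the small rhombicuboctahedron by rotating one of its square cupolae by $45^\circ$; its boundary has 8 triangles and 18 squares and vertex-type $[3^1,4^3]$. *)

(* Defs.v *)
From HB Require Import structures.
From mathcomp Require Import all_boot all_order all_algebra.
From mathcomp Require Import all_classical all_reals all_analysis.
Import Order.TTheory GRing.Theory Num.Theory.
Import numFieldNormedType.Exports.

Set Implicit Arguments.
Unset Strict Implicit.
Unset Printing Implicit Defensive.

(* A map is given by the list of its faces.  An n-gonal face is the list of   *)
(* its n vertices in cyclic order, so that the starting point and the         *)
(* direction of the list carry no information (see [same_polygon]).           *)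

Section Maps.
Variable T : eqType.
Implicit Types (X : seq (seq T)) (s t : seq T) (u v : T).

Definition vertices X : seq T := undup (flatten X).

Definition edge_of s u v : bool :=
  [&& u \in s, v \in s & (next s u == v) || (next s v == u)].

Definition meet_in_vertex s t : Prop :=
  exists u, forall x, ((x \in s) && (x \in t)) = (x == u).

Definition meet_in_edge s t : Prop :=
  exists u v, [/\ edge_of s u v, edge_of t u v &
    forall x, ((x \in s) && (x \in t)) = (x == u) || (x == v)].

Definition adjacent_at u s t : bool :=
  has (fun v => edge_of s u v && edge_of t u v) s.

Definition face_cycle X u (c : seq (seq T)) : Prop :=
  [/\ uniq c, c =i [seq s <- X | u \in s] & cycle (adjacent_at u) c].

(* Combinatorial polyhedral map on a closed surface, which is not required to *)
(* be connected. Since two faces meet in at most one edge, an edge is         *)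
(* determined by its end points.                                              *)
Record polyhedral_map X : Prop := PolyhedralMap {
  map_uniq : uniq X;
  map_polygon : forall s, s \in X -> uniq s /\ 3 <= size s;
  map_meet : forall s t, s \in X -> t \in X -> s != t ->
    [\/ forall x, ~~ ((x \in s) && (x \in t)),
        meet_in_vertex s t | meet_in_edge s t];
  map_edge : forall s u v, s \in X -> edge_of s u v ->
    count (fun t => edge_of t u v) X = 2;
  map_face_cycle : forall u, u \in vertices X -> exists c, face_cycle X u c
}.

(* The vertex-type [p_1^n_1, ..., p_k^n_k] is the list of pairs (p_i, n_i).   *)
Definition vertex_type_wf (ty : seq (nat * nat)) : Prop :=
  all (fun p => 0 < p.2) ty /\
  (1 < size ty -> cycle (fun p q => p.1 != q.1) ty).

(* [face_cycle] is closed under rotation and reversal of the list c, so that  *)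
(* ty only matters up to these operations.                                    *)
Definition vertex_has_type X (ty : seq (nat * nat)) u : Prop :=
  exists2 c, face_cycle X u c &
    [seq size s | s <- c] = flatten [seq nseq p.2 p.1 | p <- ty].

Definition semi_equivelar X : Prop :=
  exists2 ty, vertex_type_wf ty &
    forall u, u \in vertices X -> vertex_has_type X ty u.

Definition same_polygon s t : Prop :=
  exists k, t = rot k s \/ t = rev (rot k s).

End Maps.

Definition isomorphic (T T' : eqType) (X : seq (seq T)) (Y : seq (seq T')) :
    Prop :=
  exists h : T -> T',
    [/\ {in vertices X &, injective h},
        [seq h u | u <- vertices X] =i vertices Y,
        forall s, s \in X -> exists2 t, t \in Y & same_polygon (map h s) t &
        forall t, t \in Y -> exists2 s, s \in X & same_polygon (map h s) t].

Section Topology.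
Variable R : realType.
Local Open Scope classical_set_scope.
Local Open Scope ring_scope.

Definition sphere2 : set 'rV[R]_3 := [set x | \sum_i x 0 i ^+ 2 = 1].

Definition homeomorphic (m n : nat) (A : set 'rV[R]_m) (B : set 'rV[R]_n) :
    Prop :=
  exists (f : 'rV[R]_m -> 'rV[R]_n) (g : 'rV[R]_n -> 'rV[R]_m),
    [/\ {within A, continuous f} /\ {within B, continuous g},
        f @` A `<=` B, g @` B `<=` A,
        (forall x, A x -> g (f x) = x) & (forall y, B y -> f (g y) = y)].

Section Carrier.
Variables (T : eqType) (X : seq (seq T)).

(* One coordinate for each vertex, then one for each face.                    *)
Definition carrier_dim : nat := (size (vertices X) + size X)%N.

Definition vertex_point (u : T) : 'rV[R]_carrier_dim :=
  \row_i (nat_of_ord i == index u (vertices X))%:R.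

Definition face_point (s : seq T) : 'rV[R]_carrier_dim :=
  \row_i (nat_of_ord i == size (vertices X) + index s X)%N%:R.

(* Geometric carrier: every face is realized as a disc, namely the cone from  *)
(* its centre over its boundary cycle; the carrier is thus a union of         *)
(* triangles, one for each edge of each face.                                 *)
Definition carrier : set 'rV[R]_carrier_dim :=
  [set x | exists s u v, [/\ s \in X, edge_of s u v &
    exists a b c : R, [/\ [/\ 0 <= a, 0 <= b & 0 <= c], a + b + c = 1 &
      x = a *: vertex_point u + b *: vertex_point v + c *: face_point s]]].

End Carrier.
End Topology.

Arguments sphere2 R : clear implicits.
Arguments carrier R {T} X.

Definition map_on_sphere (R : realType) (T : eqType) (X : seq (seq T)) : Prop :=
  polyhedral_map X /\ homeomorphic (sphere2 R) (carrier R X).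

(* Prisms, antiprisms and Platonic solids.  All faces are listed              *)
(* counterclockwise as seen from outside: an edge shared by two faces is      *)
(* traversed in opposite directions.                                          *)

Definition prism (n : nat) : seq (seq nat) :=
  let a i := i %% n in let b i := n + i %% n in
  [:: mkseq a n; rev (mkseq b n)]
  ++ [seq [:: a i.+1; a i; b i; b i.+1] | i <- iota 0 n].

Definition antiprism (n : nat) : seq (seq nat) :=
  let a i := i %% n in let b i := n + i %% n in
  [:: mkseq a n; rev (mkseq b n)]
  ++ [seq [:: a i.+1; a i; b i] | i <- iota 0 n]
  ++ [seq [:: b i; b i.+1; a i.+1] | i <- iota 0 n].

Definition tetrahedron : seq (seq nat) :=
  [:: [:: 0; 1; 2]; [:: 0; 2; 3]; [:: 0; 3; 1]; [:: 1; 3; 2]].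

Definition cube : seq (seq nat) := prism 4.

Definition octahedron : seq (seq nat) := antiprism 3.

(* Apices 10 and 11 over the pentagons of an antiprism.                       *)
Definition icosahedron : seq (seq nat) :=
  let a i := i %% 5 in let b i := 5 + i %% 5 in
  [seq [:: a i; a i.+1; 10] | i <- iota 0 5]
  ++ [seq [:: a i.+1; a i; b i] | i <- iota 0 5]
  ++ [seq [:: b i; b i.+1; a i.+1] | i <- iota 0 5]
  ++ [seq [:: b i.+1; b i; 11] | i <- iota 0 5].

Definition dodecahedron : seq (seq nat) :=
  let a i := i %% 5 in let b i := 5 + i %% 5 in
  let c i := 10 + i %% 5 in let d i := 15 + i %% 5 in
  [:: mkseq a 5; rev (mkseq d 5)]
  ++ [seq [:: a i.+1; a i; b i; c i; b i.+1] | i <- iota 0 5]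
  ++ [seq [:: b i.+1; c i; d i; d i.+1; c i.+1] | i <- iota 0 5].

Definition platonic_solids : seq (seq (seq nat)) :=
  [:: tetrahedron; cube; octahedron; dodecahedron; icosahedron].

(* Operations on maps whose faces are coherently oriented as above.           *)

Section Operations.
Variable X : seq (seq nat).

(* The face traversing the directed edge from u to v.                         *)
Definition left_face (u v : nat) : seq nat :=
  nth [::] X (find (fun s => (u \in s) && (next s u == v)) X).

(* The neighbours of u in their cyclic order around u.                        *)
Definition neighbours (u : nat) : seq nat :=
  traject (fun v => prev (left_face u v) u)
    (next (nth [::] X (find (fun s => u \in s) X)) u)
    (count (fun s => u \in s) X).

(* The directed edges.                                                        *)
Definition darts : seq (nat * nat) :=
  flatten [seq [seq (u, next s u) | u <- s] | s <- X].

(* Vertices renamed to 0, 1, 2, ...                                           *)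
Definition relabel (T : eqType) (Y : seq (seq T)) : seq (seq nat) :=
  [seq [seq index u (vertices Y) | u <- s] | s <- Y].

(* Truncation: the new vertex (u, v) lies on the edge uv, near u.             *)
Definition truncate : seq (seq nat) :=
  relabel (
    [seq flatten [seq [:: (u, next s u); (next s u, u)] | u <- s] | s <- X]
    ++ [seq [seq (u, v) | v <- neighbours u] | u <- vertices X]).

(* Rectification: the new vertices are the midpoints of the edges.            *)
Definition midpoint (u v : nat) : nat * nat := (minn u v, maxn u v).

Definition rectify : seq (seq nat) :=
  relabel (
    [seq [seq midpoint u (next s u) | u <- s] | s <- X]
    ++ [seq [seq midpoint u v | v <- neighbours u] | u <- vertices X]).

(* Expansion: the faces are moved apart, so that every vertex is replaced by  *)
(* a face and every edge by a square.  The new vertex (u, v) is the corner at *)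
(* u of the face traversing the directed edge from u to v.                    *)
Definition corner_faces : seq (seq (nat * nat)) :=
  [seq [seq (u, next s u) | u <- s] | s <- X]
  ++ [seq [seq (u, v) | v <- neighbours u] | u <- vertices X].

Definition edge_square (e : nat * nat) : seq (nat * nat) :=
  let: (u, v) := e in
  [:: (v, next (left_face u v) v); (u, v);
      (u, next (left_face v u) u); (v, u)].

Definition expand : seq (seq nat) :=
  relabel (corner_faces ++ [seq edge_square e | e <- darts & e.1 < e.2]).

(* Snub: the expansion with each square cut, coherently, along its diagonal   *)
(* from (u, v) to (v, u).                                                     *)
Definition edge_triangle (e : nat * nat) : seq (nat * nat) :=
  let: (u, v) := e in [:: (v, next (left_face u v) v); (u, v); (v, u)].

Definition snub : seq (seq nat) :=
  relabel (corner_faces ++ [seq edge_triangle e | e <- darts]).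

End Operations.

Definition truncated_tetrahedron := truncate tetrahedron.
Definition cuboctahedron := rectify cube.
Definition truncated_cube := truncate cube.
Definition truncated_octahedron := truncate octahedron.
Definition small_rhombicuboctahedron := expand cube.
Definition great_rhombicuboctahedron := truncate cuboctahedron.
Definition snub_cube := snub cube.
Definition icosidodecahedron := rectify dodecahedron.
Definition truncated_dodecahedron := truncate dodecahedron.
Definition truncated_icosahedron := truncate icosahedron.
Definition small_rhombicosidodecahedron := expand dodecahedron.
Definition great_rhombicosidodecahedron := truncate icosidodecahedron.
Definition snub_dodecahedron := snub dodecahedron.

Definition archimedean_solids : seq (seq (seq nat)) :=
  [:: truncated_tetrahedron; cuboctahedron; truncated_cube;
      truncated_octahedron; small_rhombicuboctahedron;
      great_rhombicuboctahedron; snub_cube; icosidodecahedron;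
      truncated_dodecahedron; truncated_icosahedron;
      small_rhombicosidodecahedron; great_rhombicosidodecahedron;
      snub_dodecahedron].

(* Square cupola over the octagon a 0, ..., a 7, with top square              *)
(* c 0, ..., c 3; the octagon itself is not a face.                           *)
Definition square_cupola (a c : nat -> nat) : seq (seq nat) :=
  mkseq c 4
  :: [seq [:: c i; a i.*2; a i.*2.+1] | i <- iota 0 4]
  ++ [seq [:: c i.+1; c i; a i.*2.+1; a i.*2.+2] | i <- iota 0 4].

(* Octagonal band of squares closed by two square cupolae, the second one     *)
(* being turned by k times 45 degrees from the position of the first one.     *)
Definition elongated_square_bicupola (k : nat) : seq (seq nat) :=
  let a i := i %% 8 in let b i := 8 + i %% 8 in
  let c i := 16 + i %% 4 in let d i := 20 + i %% 4 in
  [seq [:: a i.+1; a i; b i; b i.+1] | i <- iota 0 8]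
  ++ square_cupola a c
  ++ [seq rev s | s <- square_cupola (fun i => b (i + k)) d].

(* The small rhombicuboctahedron is [elongated_square_bicupola 0].            *)
Definition pseudorhombicuboctahedron : seq (seq nat) :=
  elongated_square_bicupola 1.

(* Main.v *)
Require Import Defs.
From mathcomp Require Import all_boot all_order all_algebra.
From mathcomp Require Import all_classical all_reals all_analysis.
From mathcomp Require Import ring lra zify.
Import Order.TTheory GRing.Theory Num.Theory.
Import numFieldNormedType.Exports.
Set Implicit Arguments.
Unset Strict Implicit.
Unset Printing Implicit Defensive.

(* Every point of the carrier has a barycentric coordinate at least 1/3, at a  *)
(* vertex w x say. A Z/2-cocycle c on the edges thus yields a cocycle          *)
(* P x y = c (w x) (w y) on the pairs of points at distance less than 1/3. The *)
(* homeomorphism carries it to the sphere, where it is trivialized on two      *)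
(* overlapping caps by contracting them, and then globally because the caps    *)
(* meet in a connected band; subdividing the edges carries the trivialization  *)
(* back. Hence X is connected, H^1(X; Z/2) = 0, and comparing ranks over F_2   *)
(* gives Euler's formula. Counting incidences and a parity argument around     *)
(* faces with an odd number of sides leave sixteen vertex-types and the two    *)
(* families [n, 4, 4] and [n, 3, 3, 3].                                        *)
(*   For each of them X is explored from a flag: turning around vertices and   *)
(* faces reaches new vertices, and every face that closes up gives a relation. *)
(* For the sixteen types this is a finite backtracking search with few         *)
(* branches, for the families a short computation. It ends with a copy of a    *)
(* solid P mapped onto X, since X is connected, and the map is injective       *)
(* because Euler's formula gives X as many vertices as P.                      *)

(** * Z/2-cocycles on the sphere *)

(** The topology of the sphere enters, besides non-emptiness, through two facts. By [map_connected],
    a function on the vertices that is constant along edges is constant; by [map_cocycle], a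
    Z/2-valued function on the edges with even sum around every face is a coboundary. They are
    carried over from [sphere_connected] and [sphere_cocycle], the latter being a Mayer-Vietoris
    argument for two caps. Consequently the coboundary matrices over F_2 have ranks V - 1 and F - 1
    and form an exact sequence at the edges, which is [euler_formula].

    For a vertex-type L of degree d the formula reads V (1 - d/2 + sum of 1/p over L) = 2
    ([euler_vertex_type]), so d is 3, 4 or 5 and the sum of 1/p exceeds d/2 - 1. Together with the
    parity obstruction [unbalanced_false] this leaves the types of [has_listed_type].

    A listed type determines V, and it remains to see that the local data force the map. Flags of X
    with their two moves obey the axioms [corner_system]. For an exceptional type, [check_sound]
    shows that a replayed certificate describes an actual exploration of X; for the two families,
    the relations between the corners along a band of squares or triangles are derived by hand.
    Either way the vertices of a solid index flags of X compatibly with faces, and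
    [isomorphic_realization] concludes: the resulting map of vertices is onto by connectedness,
    hence bijective because both sides have V elements. *)

Section UniformContinuity.
Variable R : realType.
Local Open Scope classical_set_scope.
Local Open Scope ring_scope.

(** Heine-Cantor relative to a subset. Compactness is used in its near-covering form, the parameter
    being a radius [d] that tends to 0 from above. *)
Lemma compact_uniformly_continuous (m n : nat) (A : set 'rV[R]_m)
    (f : 'rV[R]_m -> 'rV[R]_n) :
  compact A -> {within A, continuous f} -> forall e : R, 0 < e ->
  exists2 d : R, 0 < d &
    forall x y, A x -> A y -> `|x - y| < d -> `|f x - f y| < e.
Proof.
move=> /compact_near_coveringP/near_covering_withinP cA /subspace_continuousP cf.
move=> e e0.
have := cA R (0 : R)^'+
  (fun d x => forall y, A y -> `|x - y| < d -> `|f x - f y| < e).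
case=> [x Ax|d /= d0 Hd].
  have /cvgrPdist_lt /(_ (e / 2)) := cf x Ax.
  rewrite divr_gt0// => /(_ isT); rewrite near_withinE => /nbhs_ballP[r /= r0].
  rewrite -ball_normE => Hr.
  (* Two halves of [r], so that both [x'] and any [y] closer than [d] to it stay within [r] of
     [x]. *)
  exists (ball x (r / 2), [set d | d < r / 2]) => /=.
    split; first by apply: nbhsx_ballx; rewrite divr_gt0.
    by apply: nbhs_right_lt; rewrite divr_gt0.
  rewrite -ball_normE => -[x' d] /= [xx' dr] Ax' y Ay x'y.
  have h1 : `|f x - f x'| < e / 2.
    by apply: Hr => //=; apply: (lt_trans xx'); rewrite ltr_pdivrMr// ltr_pMr// ltr1n.
  have h2 : `|f x - f y| < e / 2.
    apply: Hr => //=; rewrite -(subrKA x') (le_lt_trans (ler_normD _ _))//.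
    by rewrite [ltRHS]splitr ltrD// (lt_trans x'y).
  rewrite -(subrKA (f x)) (le_lt_trans (ler_normD _ _))//.
  by rewrite [ltRHS]splitr ltrD// distrC.
have d2 : 0 < d / 2 by rewrite divr_gt0.
exists (d / 2) => // x y Ax Ay xy.
apply: (Hd (d / 2)) => //=.
by rewrite /ball_ /= sub0r normrN gtr0_norm// ltr_pdivrMr// ltr_pMr// ltr1n.
Qed.

Lemma rV_norm_coord (n : nat) (x : 'rV[R]_n) i : `|x 0 i| <= `|x|.
Proof.
rewrite [leRHS]/Num.norm /= mx_normrE.
by apply/bigmax_geP; right => /=; exists (0, i).
Qed.

Lemma rV_norm_le (n : nat) (x : 'rV[R]_n) (e : R) :
  0 <= e -> (forall i, `|x 0 i| <= e) -> `|x| <= e.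
Proof.
move=> e0 H; rewrite [leLHS]/Num.norm /= mx_normrE.
by apply/bigmax_leP; split=> //= -[i j] _; rewrite ord1 /=.
Qed.

End UniformContinuity.

(** * Cocycles at small scale, and normalization onto the sphere *)

Section SphereCocycles.
Variable R : realType.
Local Open Scope classical_set_scope.
Local Open Scope ring_scope.

(** An Alexander-Spanier 1-cocycle mod 2, constrained only on triples of diameter less than [d]. *)
Definition cocycle_at_scale (n : nat) (S : set 'rV[R]_n) (d : R)
    (P : 'rV[R]_n -> 'rV[R]_n -> bool) :=
  forall x y z, S x -> S y -> S z ->
    `|x - y| < d -> `|y - z| < d -> `|x - z| < d -> P x y (+) P y z = P x z.

Lemma cocycle_at_scalexx n (S : set 'rV[R]_n) d P x :
  0 < d -> cocycle_at_scale S d P -> S x -> P x x = false.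
Proof.
move=> d0 /(_ x x x) + Sx; rewrite subrr normr0 => /(_ Sx Sx Sx d0 d0 d0).
by case: (P x x).
Qed.

(* [s x] sums [P] along the path of [x] under the contraction [h]; the squares
   between the paths of two close points cancel. *)
Lemma contractible_cocycle n (S A : set 'rV[R]_n) (d e : R)
    (P : 'rV[R]_n -> 'rV[R]_n -> bool) (h : nat -> 'rV[R]_n -> 'rV[R]_n) m :
  0 < d -> cocycle_at_scale S d P ->
  (forall x i, A x -> S (h i x)) ->
  (forall x, A x -> h 0 x = x) ->
  (forall x i, A x -> `|h i x - h i.+1 x| < d / 2) ->
  (forall x y i, A x -> A y -> `|x - y| < e -> `|h i x - h i y| < d / 2) ->
  (forall x y, A x -> A y -> h m x = h m y) ->
  exists s, forall x y, A x -> A y -> `|x - y| < e -> P x y = s x (+) s y.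
Proof.
move=> d0 cP hS h0 hstep hclose hm.
have d2 : d / 2 < d by rewrite ltr_pdivrMr// ltr_pMr// ltr1n.
pose s k x := \big[addb/false]_(i < k) P (h i x) (h i.+1 x).
suff H k x y : A x -> A y -> `|x - y| < e ->
    P x y = s k x (+) s k y (+) P (h k x) (h k y).
  exists (s m) => x y Ax Ay xy.
  by rewrite (H m)// (hm x y)// (cocycle_at_scalexx d0 cP) ?addbF//; exact: hS.
move=> Ax Ay xy; elim: k => [|k ->]; first by rewrite /s !big_ord0 !h0.
rewrite /s !big_ord_recr/=.
have dsum (u v w : 'rV[R]_n) : `|u - v| < d / 2 -> `|v - w| < d / 2 -> `|u - w| < d.
  move=> uv vw; rewrite -(subrKA v) (le_lt_trans (ler_normD _ _))//.
  by rewrite [ltRHS]splitr ltrD.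
have xyk := hclose _ _ k Ax Ay xy; have xyk1 := hclose _ _ k.+1 Ax Ay xy.
have xk := hstep _ k Ax; have yk := hstep _ k Ay.
(* The square between the two paths is cut into two triangles by the diagonal from [h k x] to
   [h k.+1 y]. *)
have := cP (h k x) (h k.+1 x) (h k.+1 y) (hS _ _ Ax) (hS _ _ Ax) (hS _ _ Ay)
  (lt_trans xk d2) (lt_trans xyk1 d2) (dsum _ _ _ xk xyk1).
rewrite -(cP (h k x) (h k y) (h k.+1 y) (hS _ _ Ax) (hS _ _ Ay) (hS _ _ Ay)
  (lt_trans xyk d2) (lt_trans yk d2) (dsum _ _ _ xyk yk)).
move: (P _ _) (P (h k.+1 x) _) (P (h k x) _) (P (h k y) _) => b1 b2 b3 b4.
by case: b1 b2 b3 b4 (\big[_/_]_(_ < _) _) (\big[_/_]_(_ < _) _) => -[] [] [] [] [].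
Qed.

Definition segment (n : nat) (a b : 'rV[R]_n) (t : R) : 'rV[R]_n :=
  (1 - t) *: a + t *: b.

Lemma segment0 n (a b : 'rV[R]_n) : segment a b 0 = a.
Proof. by rewrite /segment subr0 scale1r scale0r addr0. Qed.

Lemma segment1 n (a b : 'rV[R]_n) : segment a b 1 = b.
Proof. by rewrite /segment subrr scale1r scale0r add0r. Qed.

Lemma segment_dist n (a b : 'rV[R]_n) (t u : R) :
  `|segment a b t - segment a b u| = `|t - u| * `|a - b|.
Proof.
have -> : segment a b t - segment a b u = (u - t) *: (a - b).
  by apply/rowP => i; rewrite !mxE; ring.
by rewrite normrZ distrC.
Qed.

Lemma segment_distl n (a a' b : 'rV[R]_n) (t : R) :
  0 <= t <= 1 -> `|segment a b t - segment a' b t| <= `|a - a'|.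
Proof.
move=> /andP[t0 t1].
have -> : segment a b t - segment a' b t = (1 - t) *: (a - a').
  by apply/rowP => i; rewrite !mxE; ring.
by rewrite normrZ ger0_norm ?subr_ge0// ler_piMl// lerBlDr lerDl.
Qed.

Lemma segment_norm_le1 n (a b : 'rV[R]_n) (t : R) :
  0 <= t <= 1 -> `|a| <= 1 -> `|b| <= 1 -> `|segment a b t| <= 1.
Proof.
move=> /andP[t0 t1] a1 b1; rewrite (le_trans (ler_normD _ _))// !normrZ.
rewrite (ger0_norm t0) ger0_norm ?subr_ge0//.
have := ler_pM (normr_ge0 a) t0 a1 (lexx t).
nra.
Qed.

Lemma fine_subdivision (e M : R) : 0 < e -> exists n : nat,
  (0 < n)%N /\ n%:R^-1 * M < e.
Proof.
move=> e0; exists (Num.truncn (M / e)).+1; split=> //.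
by rewrite mulrC ltr_pdivrMr ?ltr0n// mulrC -ltr_pdivrMr// truncnS_gt.
Qed.

(** The parameters [minn i m / m] go from 0 to 1 in [m] equal steps and then stay at 1, so that a
    subdivided path is indexed by all natural numbers. *)
Lemma ratio_itv (i m : nat) : 0 <= ((minn i m)%:R / m%:R : R) <= 1.
Proof.
rewrite divr_ge0 ?ler0n//=; case: m => [|m]; first by rewrite invr0 mulr0.
by rewrite ler_pdivrMr ?ltr0n// mul1r ler_nat geq_minr.
Qed.

Lemma ratio_step (i m : nat) : (0 < m)%N ->
  `|(minn i m)%:R / m%:R - (minn i.+1 m)%:R / m%:R| <= (m%:R^-1 : R).
Proof.
move=> m0; rewrite -mulrBl normrM [`|_^-1|]ger0_norm ?invr_ge0 ?ler0n//.
rewrite ler_piMl ?invr_ge0 ?ler0n//.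
have [im|mi] := ltnP i m.
  have -> : minn i.+1 m = i.+1 by apply/minn_idPl.
  by rewrite -natr1 opprD addNKr normrN normr1.
have -> : minn i.+1 m = m by apply/minn_idPr/leqW.
by rewrite subrr normr0.
Qed.

Let i0 : 'I_3 := @Ordinal 3 0 isT.
Let i1 : 'I_3 := @Ordinal 3 1 isT.
Let i2 : 'I_3 := @Ordinal 3 2 isT.

(** The norm of row vectors is the maximum norm; the sphere needs the Euclidean one. *)
Definition sqnorm3 (x : 'rV[R]_3) : R := x 0 i0 ^+ 2 + x 0 i1 ^+ 2 + x 0 i2 ^+ 2.

Lemma sphere2E (x : 'rV[R]_3) : sphere2 R x = (sqnorm3 x = 1).
Proof.
rewrite /sphere2 /sqnorm3 /= !big_ord_recl big_ord0 addr0 addrA.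
by congr (_ ^+ 2 + _ ^+ 2 + _ ^+ 2 = _); congr (x 0 _); exact: val_inj.
Qed.

Lemma norm3_le (x : 'rV[R]_3) (e : R) :
  `|x 0 i0| <= e -> `|x 0 i1| <= e -> `|x 0 i2| <= e -> `|x| <= e.
Proof.
move=> h0 h1 h2; apply: rV_norm_le; first exact: le_trans h0.
by case=> -[|[|[|//]]] p; rewrite (bool_irrelevance p isT).
Qed.

Lemma sphere2_norm_le1 (x : 'rV[R]_3) : sphere2 R x -> `|x| <= 1.
Proof.
rewrite sphere2E /sqnorm3 => x1.
have H (i : 'I_3) : x 0 i ^+ 2 <= 1 -> `|x 0 i| <= 1.
  by move=> xi; rewrite ler_norml; apply/andP; split; nra.
have [q0 q1 q2] := And3 (sqr_ge0 (x 0 i0)) (sqr_ge0 (x 0 i1)) (sqr_ge0 (x 0 i2)).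
by apply: norm3_le; apply: H; lra.
Qed.

Lemma continuous_sqnorm3 : continuous sqnorm3.
Proof.
move=> x; rewrite /sqnorm3.
have H (i : 'I_3) : {for x, continuous (fun y : 'rV[R]_3 => y 0 i ^+ 2)}.
  apply: (@continuous_comp _ _ _ (fun y : 'rV[R]_3 => y 0 i) (fun r : R => r ^+ 2)).
    exact: coord_continuous.
  exact: exprn_continuous.
exact: (cvgD (cvgD (H _) (H _)) (H _)).
Qed.

Definition normalize (x : 'rV[R]_3) : 'rV[R]_3 := (Num.sqrt (sqnorm3 x))^-1 *: x.

Lemma sqnorm3Z a (x : 'rV[R]_3) : sqnorm3 (a *: x) = a ^+ 2 * sqnorm3 x.
Proof. by rewrite /sqnorm3 !mxE; ring. Qed.

Lemma normalize_sphere (x : 'rV[R]_3) : 0 < sqnorm3 x -> sphere2 R (normalize x).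
Proof.
move=> x0; rewrite sphere2E sqnorm3Z exprVn sqr_sqrtr ?ltW// mulVf//.
by rewrite gt_eqF.
Qed.

Lemma normalize_id (x : 'rV[R]_3) : sphere2 R x -> normalize x = x.
Proof. by rewrite sphere2E /normalize => ->; rewrite sqrtr1 invr1 scale1r. Qed.

(** A compact set away from the origin, on which [normalize] is therefore uniformly continuous. All
    chords used below lie in it; 1/4 is a lower bound for their squared lengths. *)
Definition shell : set 'rV[R]_3 := [set x | 4^-1 <= sqnorm3 x /\ `|x| <= 1].

Lemma normalize_uniformly_continuous (e : R) : 0 < e -> exists2 d : R, 0 < d &
  forall x y, shell x -> shell y -> `|x - y| < d -> `|normalize x - normalize y| < e.
Proof.
apply: compact_uniformly_continuous.
  apply: bounded_closed_compact.
    exists 1; split; first exact: num_real.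
    by move=> M M1 x [_ x1]; apply: (le_trans x1); exact: ltW.
  apply: closedI.
    apply: (@closed_comp _ _ sqnorm3 [set y : R | 4^-1 <= y]).
      by move=> x _; exact: continuous_sqnorm3.
    exact: closed_ge.
  apply: (@closed_comp _ _ (fun x : 'rV[R]_3 => `|x|) [set y : R | y <= 1]).
    by move=> x _; exact: norm_continuous.
  exact: closed_le.
apply: continuous_in_subspaceT => x; rewrite inE => -[x4 _].
have x0 : 0 < sqnorm3 x by apply: lt_le_trans x4; rewrite invr_gt0.
have cs : {for x, continuous (fun y => (Num.sqrt (sqnorm3 y))^-1)}.
  apply: (@continuousV _ _ (fun y => Num.sqrt (sqnorm3 y))); first by rewrite gt_eqF// sqrtr_gt0.
  apply: (@continuous_comp _ _ _ sqnorm3 Num.sqrt); first exact: continuous_sqnorm3.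
  exact: sqrt_continuous.
exact: (cvgZ cs (@cvg_id _ _)).
Qed.

End SphereCocycles.

(** * Connectedness and vanishing first cohomology of the sphere *)

Section SphereCohomology.
Variable R : realType.
Local Open Scope classical_set_scope.
Local Open Scope ring_scope.
Let i0 : 'I_3 := @Ordinal 3 0 isT.
Let i1 : 'I_3 := @Ordinal 3 1 isT.
Let i2 : 'I_3 := @Ordinal 3 2 isT.

Definition vec3 (a b c : R) : 'rV[R]_3 := \row_i [:: a; b; c]`_i.

Lemma sqnorm3_vec3 a b c : sqnorm3 (vec3 a b c) = a ^+ 2 + b ^+ 2 + c ^+ 2.
Proof. by rewrite /sqnorm3 !mxE. Qed.

Lemma vec3_norm_le1 a b c :
  `|a| <= 1 -> `|b| <= 1 -> `|c| <= 1 -> `|vec3 a b c| <= 1.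
Proof. by move=> *; apply: norm3_le; rewrite mxE. Qed.

(** For [c] equal to 1 or -1, the cap around the pole (0, 0, c). The two caps cover the sphere and
    overlap in the band where the last coordinate is at most 1/2 in absolute value. *)
Definition cap (c : R) : set 'rV[R]_3 :=
  [set x | sphere2 R x /\ - 2^-1 <= c * x 0 i2].

(** A point slides along the chord to the pole and is projected back to the sphere. Since c z >=
    -1/2 on the cap, the squared length on the chord is at least 1 - 3 t (1 - t) >= 1/4. *)
Lemma cap_contraction (c d : R) : c ^+ 2 = 1 -> 0 < d ->
  exists h : nat -> 'rV[R]_3 -> 'rV[R]_3, exists m, exists2 e : R, 0 < e &
    [/\ forall x i, cap c x -> sphere2 R (h i x),
        forall x, cap c x -> h 0 x = x,
        forall x i, cap c x -> `|h i x - h i.+1 x| < d,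
        forall x y i, cap c x -> cap c y -> `|x - y| < e ->
          `|h i x - h i y| < d &
        forall x, cap c x -> h m x = vec3 0 0 c].
Proof.
move=> c1 d0.
have [e e0 He] := normalize_uniformly_continuous d0.
pose p := vec3 0 0 c.
have cle : `|c| <= 1 by rewrite ler_norml; apply/andP; split; nra.
have p1 : `|p| <= 1 by apply: vec3_norm_le1; rewrite ?normr0 ?ler01.
have sp : sphere2 R p by rewrite sphere2E sqnorm3_vec3 c1; ring.
have shellP x t : cap c x -> 0 <= t <= 1 -> shell (segment x p t).
  move=> [Sx xc] /andP[t0 t1]; split; last first.
    by apply: segment_norm_le1 => //; [rewrite t0|exact: sphere2_norm_le1].
  move: Sx; rewrite sphere2E /sqnorm3 !mxE /= -/i0 -/i1 -/i2.
  move: (x 0 i0) (x 0 i1) (x 0 i2) xc => u v w xc uvw.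
  have -> : ((1 - t) * u + t * 0) ^+ 2 + ((1 - t) * v + t * 0) ^+ 2 +
    ((1 - t) * w + t * c) ^+ 2 = (1 - t) ^+ 2 * (u ^+ 2 + v ^+ 2 + w ^+ 2) +
    t ^+ 2 * c ^+ 2 + 2 * (t * (1 - t)) * (c * w) by ring.
  rewrite uvw c1 !mulr1.
  have tt : 0 <= t * (1 - t) by rewrite mulr_ge0// subr_ge0.
  have := ler_wpM2l tt xc.
  have := sqr_ge0 (t - 2^-1).
  lra.
have [m [m0 Hm]] := fine_subdivision 2 e0.
pose r i : R := (minn i m)%:R / m%:R.
exists (fun i x => normalize (segment x p (r i))), m, e => //; split.
- move=> x i Ax; apply: normalize_sphere.
  by have [+ _] := shellP x _ Ax (ratio_itv _ i m); apply: lt_le_trans; rewrite invr_gt0.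
- by move=> x [Sx _]; rewrite /r min0n mul0r segment0 normalize_id.
- move=> x i Ax.
  apply: He; [exact: shellP (ratio_itv _ _ _)|exact: shellP (ratio_itv _ _ _)|].
  rewrite segment_dist (le_lt_trans _ Hm)// ler_pM// ?ratio_step//.
  rewrite (le_trans (ler_normB _ _))//.
  by have := sphere2_norm_le1 Ax.1; lra.
- move=> x y i Ax Ay xy.
  apply: He; [exact: shellP (ratio_itv _ _ _)|exact: shellP (ratio_itv _ _ _)|].
  exact: le_lt_trans (segment_distl _ _ _ (ratio_itv _ _ _)) xy.
- move=> x _; rewrite /r minnn divff ?pnatr_eq0 -?lt0n//.
  by rewrite segment1 normalize_id.
Qed.

Lemma cap_cocycle (c d : R) (P : 'rV[R]_3 -> 'rV[R]_3 -> bool) :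
  c ^+ 2 = 1 -> 0 < d -> cocycle_at_scale (sphere2 R) d P ->
  exists s, exists2 e : R, 0 < e &
    forall x y, cap c x -> cap c y -> `|x - y| < e -> P x y = s x (+) s y.
Proof.
move=> c1 d0 cP; have d2 : 0 < d / 2 by rewrite divr_gt0.
have [h [m [e e0 [h1 h2 h3 h4 h5]]]] := cap_contraction c1 d2.
have [|s Hs] := contractible_cocycle d0 cP h1 h2 h3 h4 (m := m).
  by move=> x y Ax Ay; rewrite !h5.
by exists s, e.
Qed.

(** Every point of a cap is joined to the pole by steps shorter than [d], and both caps contain (1,
    0, 0). *)
Lemma sphere_connected (d : R) (q : 'rV[R]_3 -> bool) : 0 < d ->
  (forall x y, sphere2 R x -> sphere2 R y -> `|x - y| < d -> q x = q y) ->
  forall x y, sphere2 R x -> sphere2 R y -> q x = q y.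
Proof.
move=> d0 Hq.
have Hcap (c : R) x y : c ^+ 2 = 1 -> cap c x -> cap c y -> q x = q y.
  move=> c1 cx cy; have [h [m [e e0 [h1 h2 h3 h4 h5]]]] := cap_contraction c1 d0.
  have H z k : cap c z -> q z = q (h k z).
    move=> cz; elim: k => [|k ->]; first by rewrite h2.
    by apply: Hq; [exact: h1|exact: h1|exact: h3].
  by rewrite (H x m)// (H y m)// !h5.
pose e1 := vec3 1 0 0.
have ce (c : R) : cap c e1.
  by split; rewrite ?sphere2E ?sqnorm3_vec3 ?mxE/=; [ring|rewrite mulr0 oppr_le0 invr_ge0].
suff H x : sphere2 R x -> q x = q e1 by move=> x y Sx Sy; rewrite (H x) ?(H y).
move=> Sx; have [x0|x0] := leP 0 (x 0 i2).
  apply: (Hcap 1); rewrite ?expr1n//; split=> //; rewrite mul1r.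
  by rewrite (le_trans _ x0)// oppr_le0 invr_ge0.
apply: (Hcap (-1)); rewrite ?sqrrN ?expr1n//; split=> //; rewrite mulN1r.
by rewrite lerN2 (le_trans (ltW x0))// invr_ge0.
Qed.

(** A point of the band is flattened to the equatorial plane and then joined inside this plane to
    (1, 0, 0), or to (-1, 0, 0) if its first coordinate is negative; the latter is joined to (1, 0,
    0) through (0, 1, 0). *)
Lemma band_connected (d : R) (q : 'rV[R]_3 -> bool) : 0 < d ->
  (forall x y, sphere2 R x -> sphere2 R y -> `|x 0 i2| <= 2^-1 ->
    `|y 0 i2| <= 2^-1 -> `|x - y| < d -> q x = q y) ->
  exists b, forall x, sphere2 R x -> `|x 0 i2| <= 2^-1 -> q x = b.
Proof.
move=> d0 Hq.
have [e e0 He] := normalize_uniformly_continuous d0.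
(* The first inequality keeps the chord in [shell]; the second, being homogeneous, says that its
   normalization stays in the band. *)
have chain a b : `|a| <= 1 -> `|b| <= 1 ->
    (forall t, 0 <= t <= 1 -> 4^-1 <= sqnorm3 (segment a b t) /\
      4 * (segment a b t) 0 i2 ^+ 2 <= sqnorm3 (segment a b t)) ->
    q (normalize a) = q (normalize b).
  move=> a1 b1 Hab.
  have [m [m0 Hm]] := fine_subdivision 2 e0.
  pose r i : R := (minn i m)%:R / m%:R.
  have H k : q (normalize a) = q (normalize (segment a b (r k))).
    elim: k => [|k ->]; first by rewrite /r min0n mul0r segment0.
    have shellP i : shell (segment a b (r i)).
      split; first exact: (Hab _ (ratio_itv _ _ _)).1.
      exact: segment_norm_le1 (ratio_itv _ _ _) _ _.
    have pos i : 0 < sqnorm3 (segment a b (r i)).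
      by have [+ _] := shellP i; apply: lt_le_trans; rewrite invr_gt0.
    have band i : `|normalize (segment a b (r i)) 0 i2| <= 2^-1.
      have [_] := Hab _ (ratio_itv _ i m); rewrite -/(r i).
      move: (segment a b _) (pos i) => z z0 Hz.
      rewrite mxE normrM normfV [`|Num.sqrt _|]ger0_norm ?sqrtr_ge0//.
      rewrite ler_pdivrMl ?sqrtr_gt0// -[leLHS]sqrtr_sqr -[2^-1]ger0_norm ?invr_ge0//.
      rewrite -sqrtr_sqr -sqrtrM ?sqrtr_ge0 ?(ltW z0)// ler_wsqrtr// exprVn.
      by lra.
    apply: Hq; rewrite ?band//; try exact: normalize_sphere.
    apply: He => //.
    rewrite segment_dist (le_lt_trans _ Hm)// ler_pM// ?ratio_step//.
    by rewrite (le_trans (ler_normB _ _))//; lra.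
  rewrite (H m) /r minnn divff ?pnatr_eq0 -?lt0n//.
  by rewrite segment1.
have n1 : `|1 : R| <= 1 by rewrite normr1.
have n0 : `|0 : R| <= 1 by rewrite normr0.
have nN1 : `|-1 : R| <= 1 by rewrite normrN1.
exists (q (normalize (vec3 1 0 0))) => x Sx xb.
have x1 := sphere2_norm_le1 Sx.
have [u1 v1] : `|x 0 i0| <= 1 /\ `|x 0 i1| <= 1.
  by split; apply: le_trans x1; exact: rV_norm_coord.
rewrite -{1}(normalize_id Sx) (chain x (vec3 (x 0 i0) (x 0 i1) 0)) //; last 2 first.
- exact: vec3_norm_le1.
- move=> t /andP[t0 t1]; move: Sx xb; rewrite sphere2E /sqnorm3 !mxE /= -/i0 -/i1 -/i2.
  move: (x 0 i0) (x 0 i1) (x 0 i2) => u v w uvw.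
  rewrite ler_norml => /andP[w1 w2].
  have -> : (1 - t) * u + t * u = u by ring.
  have -> : (1 - t) * v + t * v = v by ring.
  rewrite mulr0 addr0.
  have w4 : w ^+ 2 <= 4^-1 by nra.
  have tw : ((1 - t) * w) ^+ 2 <= w ^+ 2 by rewrite exprMn ler_piMl ?sqr_ge0//; nra.
  have := sqr_ge0 ((1 - t) * w).
  by split; lra.
have eqt a b : vec3 a b 0 0 i2 = 0 by rewrite mxE.
have flat a b a' b' : `|a| <= 1 -> `|b| <= 1 -> `|a'| <= 1 -> `|b'| <= 1 ->
    (forall t, 0 <= t <= 1 -> 4^-1 <= ((1 - t) * a + t * a') ^+ 2 +
                                    ((1 - t) * b + t * b') ^+ 2) ->
    q (normalize (vec3 a b 0)) = q (normalize (vec3 a' b' 0)).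
  move=> *; apply: chain; rewrite ?vec3_norm_le1// => t t01.
  rewrite /sqnorm3 !mxE /= !mulr0 addr0 expr0n mulr0 addr0.
  by split; [auto|rewrite addr_ge0 ?sqr_ge0].
have uv : 3 / 4 <= (x 0 i0) ^+ 2 + (x 0 i1) ^+ 2.
  move: Sx xb; rewrite sphere2E /sqnorm3 -/i0 -/i1 -/i2 ler_norml => Sx /andP[w1 w2].
  have : (x 0 i2) ^+ 2 <= 4^-1 by nra.
  by lra.
move: (x 0 i0) (x 0 i1) u1 v1 uv => u v u1 v1 uv.
have toend (c : R) : c ^+ 2 = 1 -> 0 <= c * u -> q (normalize (vec3 u v 0)) = q (normalize (vec3 c 0 0)).
  move=> c1 cu; apply: flat => //.
    by rewrite ler_norml; apply/andP; split; nra.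
  move=> t /andP[t0 t1]; rewrite mulr0 addr0.
  have -> : ((1 - t) * u + t * c) ^+ 2 + ((1 - t) * v) ^+ 2 =
     (1 - t) ^+ 2 * (u ^+ 2 + v ^+ 2) + t ^+ 2 * c ^+ 2 + 2 * (t * (1 - t) * (c * u)) by ring.
  have tt : 0 <= t * (1 - t) * (c * u) by rewrite mulr_ge0// mulr_ge0// subr_ge0.
  rewrite c1 mulr1.
  have := ler_wpM2l (sqr_ge0 (1 - t)) uv.
  have := sqr_ge0 (t - 2^-1).
  nra.
have [u0|u0] := leP 0 u; first by apply: toend; [rewrite expr1n|rewrite mul1r].
rewrite (toend (-1)); [|by rewrite sqrrN expr1n|by rewrite mulN1r oppr_ge0 ltW].
have tt (t : R) : 0 <= t <= 1 -> 4^-1 <= (1 - t) ^+ 2 + t ^+ 2.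
  by move=> _; have := sqr_ge0 (t - 2^-1); lra.
rewrite (flat (-1) 0 0 1)//; last first.
  by move=> t /tt; rewrite !mulr0 addr0 add0r mulrN1 mulr1 sqrrN.
apply: flat => // t /tt.
by rewrite !mulr0 !mulr1 add0r addr0 addrC.
Qed.

(** Mayer-Vietoris: the trivializations on the two caps differ on the band by a locally constant
    function, hence by a constant [b], which corrects one of them before they are glued along the
    equator. *)
Lemma sphere_cocycle (d : R) (P : 'rV[R]_3 -> 'rV[R]_3 -> bool) :
  0 < d -> cocycle_at_scale (sphere2 R) d P ->
  exists s, exists2 e : R, 0 < e &
    forall x y, sphere2 R x -> sphere2 R y -> `|x - y| < e -> P x y = s x (+) s y.
Proof.
move=> d0 cP.
have [sA [eA eA0 HA]] := cap_cocycle (expr1n R 2) d0 cP.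
have [|sB [eB eB0 HB]] := @cap_cocycle (-1) _ _ _ d0 cP.
  by rewrite sqrrN expr1n.
have capA x : sphere2 R x -> - 2^-1 <= x 0 i2 -> cap 1 x by split=> //; rewrite mul1r.
have capB x : sphere2 R x -> x 0 i2 <= 2^-1 -> cap (-1) x.
  by split=> //; rewrite mulN1r lerN2.
(* The bound 1/2 puts two close points on opposite sides of the equator both into the band. *)
pose e := Num.min (Num.min eA eB) 2^-1.
have e0 : 0 < e by rewrite !lt_min eA0 eB0 invr_gt0 ltr0n.
have eE x : x < e -> [/\ x < eA, x < eB & x < 2^-1] by rewrite !lt_min => /andP[/andP[]].
have [|b Hb] := @band_connected e (fun x => sA x (+) sB x) e0.
  move=> x y Sx Sy; rewrite !ler_norml => /andP[x1 x2] /andP[y1 y2] /eE[xA xB _].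
  have := HA x y (capA _ Sx x1) (capA _ Sy y1) xA.
  rewrite (HB x y (capB _ Sx x2) (capB _ Sy y2) xB).
  by case: (sA x) (sA y) (sB x) (sB y) => -[] [] [].
exists (fun x : 'rV[R]_3 => if 0 <= x 0 i2 then sA x else sB x (+) b), e => // x y Sx Sy xye.
have [xA xB xy] := eE _ xye.
have xy2 : `|x 0 i2 - y 0 i2| < 2^-1.
  by apply: le_lt_trans xy; have := rV_norm_coord (x - y) i2; rewrite !mxE.
have h2 : 0 <= 2^-1 :> R by rewrite invr_ge0.
move: xy2; rewrite ltr_norml => /andP[xy1 xy2].
have [x0|x0] := leP 0 (x 0 i2); have [y0|y0] := leP 0 (y 0 i2).
- by apply: HA => //; apply: capA => //; lra.
- rewrite (HA x y) //; try by [apply: capA => //; lra].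
  have := Hb y Sy; rewrite ler_norml => <-; last by apply/andP; split; lra.
  by case: (sA x) (sA y) (sB y) => -[] [].
- rewrite (HA x y) //; try by [apply: capA => //; lra].
  have := Hb x Sx; rewrite ler_norml => <-; last by apply/andP; split; lra.
  by case: (sA x) (sA y) (sB x) => -[] [].
- rewrite (HB x y) //; try by [apply: capB => //; lra].
  by case: (sB x) (sB y) b {Hb} => -[] [].
Qed.

End SphereCohomology.

(** * Triangulated complexes homeomorphic to the sphere *)

Section SphericalComplexes.
Variables (R : realType) (N : nat) (tri : 'I_N -> 'I_N -> 'I_N -> Prop).
Local Open Scope classical_set_scope.
Local Open Scope ring_scope.

Definition unit_point (i : 'I_N) : 'rV[R]_N := \row_j (j == i)%:R.

Definition complex_carrier : set 'rV[R]_N := [set x | exists i j k, tri i j k /\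
  exists a b c : R, [/\ [/\ 0 <= a, 0 <= b & 0 <= c], a + b + c = 1 &
    x = a *: unit_point i + b *: unit_point j + c *: unit_point k]].

Lemma unit_pointE i j : unit_point i 0 j = (j == i)%:R.
Proof. by rewrite mxE. Qed.

Lemma carrier_support x : complex_carrier x -> exists i j k, tri i j k /\
  [/\ (forall l, 0 < x 0 l -> l \in [:: i; j; k]),
      (exists l, 3^-1 <= x 0 l) & `|x| <= 1].
Proof.
move=> [i [j [k [ijk [a [b [c [[a0 b0 c0] abc ->]]]]]]]].
exists i, j, k; split=> //.
have E l : (a *: unit_point i + b *: unit_point j + c *: unit_point k) 0 l =
    a * (l == i)%:R + b * (l == j)%:R + c * (l == k)%:R by rewrite !mxE.
have B01 (b' : bool) : 0 <= b'%:R :> R /\ b'%:R <= 1 :> R by case: b'; rewrite ?lexx ?ler01.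
have P (u : R) (b' : bool) : 0 <= u -> 0 <= u * b'%:R <= u.
  by move=> u0; case: b'; rewrite ?mulr1 ?mulr0 ?lexx ?u0.
split.
- move=> l; rewrite E !inE.
  by case: (l == i); case: (l == j); case: (l == k) => //; rewrite !mulr0 !addr0 ltxx.
- have [ha|ha] := leP 3^-1 a.
    exists i; rewrite E eqxx mulr1.
    by have := P b (i == j) b0; have := P c (i == k) c0; lra.
  have [hb|hb] := leP 3^-1 b.
    exists j; rewrite E eqxx mulr1.
    by have := P a (j == i) a0; have := P c (j == k) c0; lra.
  exists k; rewrite E eqxx mulr1.
  by have := P a (k == i) a0; have := P b (k == j) b0; lra.
- apply: rV_norm_le => // l; rewrite E.
  have /andP[? ?] := P a (l == i) a0; have /andP[? ?] := P b (l == j) b0.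
  have /andP[? ?] := P c (l == k) c0.
  by rewrite ger0_norm; lra.
Qed.

Lemma segment_carrier i j k t : tri i j k -> 0 <= t <= 1 ->
  [/\ complex_carrier (segment (unit_point i) (unit_point j) t),
      complex_carrier (segment (unit_point j) (unit_point k) t) &
      complex_carrier (segment (unit_point i) (unit_point k) t)].
Proof.
move=> ijk /andP[t0 t1]; split; exists i, j, k; split=> //.
- by exists (1 - t), t, 0; split; [split; lra|ring|rewrite scale0r addr0].
- by exists 0, (1 - t), t; split; [split; lra|ring|rewrite scale0r add0r].
- by exists (1 - t), 0, t; split; [split; lra|ring|rewrite scale0r addr0].
Qed.

Lemma sphere2_compact : compact (sphere2 R).
Proof.
apply: bounded_closed_compact.
  exists 1; split; first exact: num_real.
  by move=> M M1 x /sphere2_norm_le1 x1; apply: (le_trans x1); exact: ltW.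
have -> : sphere2 R = [set x | sqnorm3 x = 1].
  by apply/seteqP; split=> x; rewrite sphere2E.
apply: (@closed_comp _ _ (@sqnorm3 R) [set y : R | y = 1]).
  by move=> x _; exact: continuous_sqnorm3.
exact: closed_eq.
Qed.

Hypothesis sphere_carrier : homeomorphic (sphere2 R) complex_carrier.

Lemma complex_carrier_compact : compact complex_carrier.
Proof.
have [f [g [[cf cg] fK gK fgK gfK]]] := sphere_carrier.
have -> : complex_carrier = f @` sphere2 R.
  apply/seteqP; split=> [y Ky|y]; last by apply: fK.
  by exists (g y); [apply: gK; exists y|exact: gfK].
exact: continuous_compact sphere2_compact.
Qed.

Variable l0 : 'I_N.

(* A vertex whose open star contains the 1/3-neighbourhood of x. *)
Definition star_center (x : 'rV[R]_N) : 'I_N :=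
  odflt l0 [pick l | 3^-1 <= x 0 l].

Lemma star_centerP x : complex_carrier x -> 3^-1 <= x 0 (star_center x).
Proof.
rewrite /star_center => /carrier_support[i [j [k [_ [_ [l xl] _]]]]].
by case: pickP => //= /(_ l); rewrite xl.
Qed.

(** With [carrier_support] this places the star centres of all points near [y] among the vertices of
    one triangle containing [y]. *)
Lemma star_center_close x y : complex_carrier x -> `|x - y| < 3^-1 ->
  0 < y 0 (star_center x).
Proof.
move=> /star_centerP xl xy.
have := le_lt_trans (rV_norm_coord (x - y) (star_center x)) xy.
by rewrite !mxE ltr_norml => /andP[_]; lra.
Qed.

Lemma star_center_segment i j t : 0 <= t <= 1 ->
  complex_carrier (segment (unit_point i) (unit_point j) t) ->
  star_center (segment (unit_point i) (unit_point j) t) \in [:: i; j].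
Proof.
move=> t01 /star_centerP; rewrite !mxE !inE; case: eqP => // _; case: eqP => // _.
by rewrite !mulr0 addr0 leNgt invr_gt0 ltr0n.
Qed.

Lemma star_center_unit i : complex_carrier (unit_point i) ->
  star_center (unit_point i) = i.
Proof.
move=> /star_centerP; rewrite mxE; case: eqP => // _.
by rewrite leNgt invr_gt0 ltr0n.
Qed.

Lemma segment_chain i j (e : R) : 0 < e ->
  (forall t, 0 <= t <= 1 ->
    complex_carrier (segment (unit_point i) (unit_point j) t)) ->
  exists p : nat -> 'rV[R]_N, exists m,
    [/\ p 0 = unit_point i, p m = unit_point j,
        forall k, complex_carrier (p k),
        forall k, star_center (p k) \in [:: i; j] &
        forall k, `|p k - p k.+1| < e].
Proof.
move=> e0 Hij; have [m [m0 Hm]] := fine_subdivision 2 e0.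
pose r i : R := (minn i m)%:R / m%:R.
exists (fun k => segment (unit_point i) (unit_point j) (r k)), m; split.
- by rewrite /r min0n mul0r segment0.
- by rewrite /r minnn divff ?pnatr_eq0 -?lt0n// segment1.
- by move=> k; apply: Hij; exact: ratio_itv.
- by move=> k; apply: star_center_segment; [exact: ratio_itv|apply: Hij; exact: ratio_itv].
- move=> k; rewrite segment_dist (le_lt_trans _ Hm)// ler_pM// ?ratio_step//.
  have H l : `|unit_point l| <= 1.
    by apply: rV_norm_le => // l'; rewrite unit_pointE; case: eqP; rewrite ?normr1 ?normr0.
  by rewrite (le_trans (ler_normB _ _))//; have := H i; have := H j; lra.
Qed.

(** Pulled back to the sphere, the value of [C] at the star centre is locally constant: centres of
    nearby points belong to one triangle, on which [C] is constant. *)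
Lemma spherical_complex_connected (C : 'I_N -> bool) :
  (forall i j k, tri i j k -> C i = C j /\ C j = C k) ->
  forall i j k i' j' k', tri i j k -> tri i' j' k' -> C i = C i'.
Proof.
move=> HC; have [f [g [[cf cg] fK gK fgK gfK]]] := sphere_carrier.
have Kf x : sphere2 R x -> complex_carrier (f x) by move=> Sx; apply: fK; exists x.
have Kg y : complex_carrier y -> sphere2 R (g y) by move=> Sx; apply: gK; exists y.
have third0 : (0 : R) < 3^-1 by rewrite invr_gt0.
have [d d0 Hd] := compact_uniformly_continuous sphere2_compact cf third0.
suff Hloc x y : sphere2 R x -> sphere2 R y -> `|x - y| < d ->
    C (star_center (f x)) = C (star_center (f y)).
  have Hq := @sphere_connected R d (fun x => C (star_center (f x))) d0 Hloc.
  move=> i j k i' j' k' t t'.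
  have Ku a b c : tri a b c -> complex_carrier (unit_point a).
    move=> tabc; rewrite -(segment0 (unit_point a) (unit_point b)).
    by have [] := segment_carrier tabc (t := 0); rewrite ?lexx ?ler01.
  rewrite -(star_center_unit (Ku _ _ _ t)) -(star_center_unit (Ku _ _ _ t')).
  rewrite -(gfK _ (Ku _ _ _ t)) -(gfK _ (Ku _ _ _ t')).
  by apply: Hq; apply: Kg; apply: Ku; eassumption.
move=> Sx Sy xy; have [i [j [k [t [H _ _]]]]] := carrier_support (Kf _ Sy).
have [ij jk] := HC _ _ _ t.
have CE l : l \in [:: i; j; k] -> C l = C k.
  by rewrite !inE => /or3P[] /eqP -> //; rewrite ij.
rewrite !CE//; apply: H.
  by apply: star_center_close; rewrite ?subrr ?normr0//; exact: Kf.
by apply: star_center_close; [exact: Kf|exact: Hd].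
Qed.

(** Evaluating [c] on star centres gives a cocycle at small scale on the sphere, since the centres
    of three close points lie in one triangle. Its trivialization, read at the vertices, trivializes
    [c] along each edge by summing over a fine subdivision. *)
Lemma spherical_complex_cocycle (c : 'I_N -> 'I_N -> bool) :
  (forall i, c i i = false) -> (forall i j, c i j = c j i) ->
  (forall i j k, tri i j k -> c i j (+) c j k = c i k) ->
  exists s : 'I_N -> bool, forall i j k, tri i j k -> c i j = s i (+) s j.
Proof.
move=> c0 csym ctri; have [f [g [[cf cg] fK gK fgK gfK]]] := sphere_carrier.
have Kf x : sphere2 R x -> complex_carrier (f x) by move=> Sx; apply: fK; exists x.
have Kg y : complex_carrier y -> sphere2 R (g y) by move=> Sx; apply: gK; exists y.
have third0 : (0 : R) < 3^-1 by rewrite invr_gt0.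
have [d d0 Hd] := compact_uniformly_continuous sphere2_compact cf third0.
(* The cocycle identity for three vertices of a triangle in any order, repetitions allowed. *)
have cE i j k a b l : tri i j k -> a \in [:: i; j; k] -> b \in [:: i; j; k] ->
    l \in [:: i; j; k] -> c a b (+) c b l = c a l.
  move=> /ctri ijk; rewrite !inE => /or3P[] /eqP -> /or3P[] /eqP -> /or3P[] /eqP ->;
    rewrite ?c0 ?(csym j i) ?(csym k i) ?(csym k j) -?ijk;
    by move: (c i j) (c j k) => [] [].
have [|s [e e0 He]] := @sphere_cocycle R d
    (fun x y => c (star_center (f x)) (star_center (f y))) d0.
  move=> x y z Sx Sy Sz xy yz xz.
  have [i [j [k [t [H _ _]]]]] := carrier_support (Kf _ Sz).
  apply: (cE i j k) => //; apply: H.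
  - by apply: star_center_close; [exact: Kf|exact: Hd].
  - by apply: star_center_close; [exact: Kf|exact: Hd].
  - by apply: star_center_close; rewrite ?subrr ?normr0//; exact: Kf.
have [d' d'0 Hd'] := compact_uniformly_continuous complex_carrier_compact cg e0.
exists (fun i => s (g (unit_point i))); move=> i j k t.
have [|p [m [p0 pm Kp scp pstep]]] := @segment_chain i j d' d'0.
  by move=> u u01; have [] := segment_carrier t u01.
have step n : c (star_center (p n)) (star_center (p n.+1)) = s (g (p n)) (+) s (g (p n.+1)).
  rewrite -He; [|exact: Kg|exact: Kg|exact: Hd'].
  by rewrite !gfK.
have Ki : star_center (p 0) = i by rewrite p0; apply: star_center_unit; rewrite -p0.
have Kj : star_center (p m) = j by rewrite pm; apply: star_center_unit; rewrite -pm.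
rewrite -p0 -pm -{1}Ki -{1}Kj.
have mem n : star_center (p n) \in [:: i; j; k].
  by have := scp n; rewrite !inE => /orP[] ->; rewrite ?orbT.
(* The sum telescopes: all centres met on the edge are ends of it, so [cE] applies to them. *)
elim: m {pm Kj} => [|m IH]; first by rewrite c0 addbb.
by rewrite -(cE _ _ _ _ _ _ t (mem _) (mem m)) // IH step addbA addbK.
Qed.

End SphericalComplexes.

(** * Polygons, and maps on the sphere *)

Section Polygons.
Variable T : eqType.
Implicit Types (s : seq T) (u v : T).

Lemma edge_of_sym s u v : edge_of s u v = edge_of s v u.
Proof. by rewrite /edge_of andbCA orbC. Qed.

Lemma next_nth_wrap (x0 : T) s m : uniq s -> (m < size s)%N ->
  next s (nth x0 s m) = nth x0 s (if m.+1 == size s then 0%N else m.+1).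
Proof.
case: s => // y p us ms; rewrite next_nth mem_nth// index_uniq//=.
case: eqP => [[mE]|/eqP mN]; first by rewrite nth_default// mE.
by apply: set_nth_default; rewrite /= in ms mN; rewrite ltn_neqAle -eqSS mN.
Qed.

Lemma next_neq s u : uniq s -> (1 < size s)%N -> u \in s -> next s u != u.
Proof.
move=> us s1 us'; rewrite -{1 2}(nth_index u us') next_nth_wrap ?index_mem//.
have iu : (index u s < size s)%N by rewrite index_mem.
rewrite nth_uniq//; last by case: eqP => [_|/eqP]; lia.
by case: ifP => [/eqP E|_]; apply/eqP; lia.
Qed.

Lemma edge_of_next s u : u \in s -> edge_of s u (next s u).
Proof. by move=> us; rewrite /edge_of us mem_next us eqxx. Qed.

Lemma edge_of_neq s u v : uniq s -> (1 < size s)%N -> edge_of s u v -> u != v.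
Proof.
move=> us s1 /and3P[uu vv /orP[] /eqP]; last by move=> <-; exact: next_neq.
by move=> <-; rewrite eq_sym; exact: next_neq.
Qed.

End Polygons.

Section SphericalMaps.
Variables (R : realType) (T : eqType) (X : seq (seq T)).
Hypothesis X_sphere : map_on_sphere R X.
Local Open Scope classical_set_scope.
Local Open Scope ring_scope.

Let N := carrier_dim X.
Let V := size (vertices X).

Lemma mem_vertices s u : s \in X -> u \in s -> u \in vertices X.
Proof. by move=> sX us; rewrite /vertices mem_undup; apply/flattenP; exists s. Qed.

Lemma verticesP u : reflect (exists2 s, s \in X & u \in s) (u \in vertices X).
Proof. by rewrite /vertices mem_undup; exact: flattenP. Qed.

(** The cone subdivision: the two ends of an edge and the centre of a face containing it, numbered
    like the coordinates of [carrier]. *)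
Definition map_triangle (i j k : 'I_N) : Prop := exists s u v,
  [/\ s \in X, edge_of s u v, i = index u (vertices X) :> nat,
      j = index v (vertices X) :> nat & k = (V + index s X)%N :> nat].

Lemma vertex_index_lt s u : s \in X -> u \in s -> (index u (vertices X) < N)%N.
Proof.
move=> sX us; rewrite /N /carrier_dim ltn_addr// index_mem.
exact: mem_vertices us.
Qed.

Lemma face_index_lt s : s \in X -> (V + index s X < N)%N.
Proof. by move=> sX; rewrite /N /carrier_dim ltn_add2l index_mem. Qed.

Lemma carrierE : carrier R X = @complex_carrier R N map_triangle.
Proof.
have up (i : 'I_N) m : i = m :> nat -> (\row_j (nat_of_ord j == m)%:R : 'rV[R]_N) = @unit_point R N i.
  by move=> <-; apply/rowP => j; rewrite !mxE.
apply/seteqP; split=> x.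
  move=> [s [u [v [sX e [a [b [c [abc abc1 ->]]]]]]]].
  have /and3P[us vs _] := e.
  exists (Ordinal (vertex_index_lt sX us)), (Ordinal (vertex_index_lt sX vs)), (Ordinal (face_index_lt sX)).
  split; first by exists s, u, v.
  by exists a, b, c; split=> //; rewrite /vertex_point /face_point !(up (Ordinal _)).
move=> [i [j [k [[s [u [v [sX e iE jE kE]]]] [a [b [c [abc abc1 ->]]]]]]]].
exists s, u, v; split=> //; exists a, b, c; split=> //.
by rewrite /vertex_point /face_point (up i)// (up j)// (up k).
Qed.

Lemma sphere_complex : homeomorphic (sphere2 R) (@complex_carrier R N map_triangle).
Proof. by rewrite -carrierE; case: X_sphere. Qed.

Lemma map_nonempty : exists s u v, s \in X /\ edge_of s u v.
Proof.
have [f [g [_ fK _ _ _]]] := sphere_complex.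
have [|i [j [k [[s [u [v [sX e _ _ _]]]] _]]]] := fK (f (vec3 1 0 0)).
  by exists (vec3 1 0 0) => //; rewrite sphere2E sqnorm3_vec3; ring.
by exists s, u, v.
Qed.

Lemma some_index : inhabited 'I_N.
Proof.
have [s [u [v [sX /and3P[us _ _]]]]] := map_nonempty.
by split; exact: Ordinal (vertex_index_lt sX us).
Qed.

(** [C] is extended to the centre of a face by [has C s], the common value at the vertices of
    [s]. *)
Lemma map_connected (C : T -> bool) :
  (forall s u v, s \in X -> edge_of s u v -> C u = C v) ->
  {in vertices X &, forall u v, C u = C v}.
Proof.
move=> HC u u' uX u'X.
have [l0] := some_index.
pose nb s := has C s.
pose C' (i : 'I_N) := if (i < V)%N then C (nth u (vertices X) i)
  else nb (nth [::] X (i - V)).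
have C'v (i : 'I_N) w : w \in vertices X -> i = index w (vertices X) :> nat -> C' i = C w.
  by move=> wX iE; rewrite /C' iE index_mem wX nth_index.
suff HC' i j k : map_triangle i j k -> C' i = C' j /\ C' j = C' k.
  have [s sX us] := verticesP _ uX; have [s' sX' us'] := verticesP _ u'X.
  have nx := edge_of_next us; have nx' := edge_of_next us'.
  have := @spherical_complex_connected R N map_triangle sphere_complex l0 C' HC'
    (Ordinal (vertex_index_lt sX us)) (Ordinal (vertex_index_lt sX (proj1 (andP (proj2 (andP nx))))))
    (Ordinal (face_index_lt sX))
    (Ordinal (vertex_index_lt sX' us')) (Ordinal (vertex_index_lt sX' (proj1 (andP (proj2 (andP nx'))))))
    (Ordinal (face_index_lt sX')).
  rewrite (C'v _ u)// (C'v _ u')//; apply; first by exists s, u, (next s u).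
  by exists s', u', (next s' u').
move=> [s [x [y [sX e iE jE kE]]]].
have /and3P[xs ys _] := e.
have xX := mem_vertices sX xs; have yX := mem_vertices sX ys.
rewrite (C'v _ _ xX iE) (C'v _ _ yX jE) /C' kE ltnNge leq_addr/= addKn nth_index//.
split; first exact: HC e.
apply/idP/hasP => [Cy|[z zs Cz]]; first by exists y.
suff H m : (m < size s)%N -> C (nth y s m) = C (nth y s 0).
  by rewrite -(nth_index y ys) H ?index_mem// -(H (index z s)) ?index_mem// nth_index.
elim: m => // m IH ms; rewrite -IH ?(ltnW ms)//; apply/esym.
have [us s3] := map_polygon (proj1 X_sphere) sX.
apply: (HC _ _ _ sX); have := edge_of_next (mem_nth y (ltnW ms)).
by rewrite next_nth_wrap ?(ltnW ms)// ltn_eqF.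
Qed.

(** The cochain is extended to the cone subdivision: between the centre of [s] and a vertex [u] it
    takes the partial sum [pot s u] along the boundary from the first vertex of [s]. The extension
    is a cocycle on every triangle. *)
Lemma map_cocycle (c : T -> T -> bool) :
  (forall u v, c u v = c v u) ->
  (forall s, s \in X -> \big[addb/false]_(u <- s) c u (next s u) = false) ->
  exists g : T -> bool, forall s u v, s \in X -> edge_of s u v -> c u v = g u (+) g v.
Proof.
move=> csym cface; have [l0] := some_index.
have [s0 [x0 _]] := map_nonempty.
pose pot s u := \big[addb/false]_(w <- take (index u s) s) c w (next s w).
have potS s u : s \in X -> u \in s -> pot s (next s u) = pot s u (+) c u (next s u).
  move=> sX us; have [us' s3] := map_polygon (proj1 X_sphere) sX.
  have iu : (index u s < size s)%N by rewrite index_mem.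
  have := next_nth_wrap u us' iu; rewrite nth_index// => nE.
  have tE : pot s u (+) c u (next s u) =
      \big[addb/false]_(w <- take (index u s).+1 s) c w (next s w).
    by rewrite (take_nth u iu) -cats1 big_cat big_seq1 nth_index.
  (* After the last vertex the walk returns to the head of [s], whose partial sum is empty; the full
     sum vanishes by [cface]. *)
  rewrite tE {1}nE /pot; case: eqP => [E|/eqP NE].
    have s1 : (0 < size s)%N by exact: leq_trans s3.
    by rewrite index_uniq// take0 big_nil E take_size cface.
  by rewrite index_uniq// ltn_neqAle NE.
pose vx (i : 'I_N) := nth x0 (vertices X) i.
pose fc (i : 'I_N) := nth [::] X (i - V).
pose cc (i j : 'I_N) := if i == j then false else
  if (i < V)%N then (if (j < V)%N then c (vx i) (vx j) else pot (fc j) (vx i))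
  else if (j < V)%N then pot (fc i) (vx j) else false.
have vxE (i : 'I_N) w : w \in vertices X -> i = index w (vertices X) :> nat ->
    (i < V)%N = true /\ vx i = w.
  by move=> wX iE; rewrite /vx /V iE index_mem nth_index.
have fcE (i : 'I_N) s : s \in X -> i = (V + index s X)%N :> nat ->
    (i < V)%N = false /\ fc i = s.
  by move=> sX iE; rewrite /fc iE addKn nth_index// ltnNge leq_addr.
have [|||g Hg] := @spherical_complex_cocycle R N map_triangle sphere_complex l0 cc.
- by move=> i; rewrite /cc eqxx.
- by move=> i j; rewrite /cc eq_sym; case: eqP => // _; case: ifP; case: ifP.
- move=> i j k [s [u [v [sX e iE jE kE]]]].
  have /and3P[us vs nuv] := e.
  have [i1 i2] := vxE i u (mem_vertices sX us) iE.
  have [j1 j2] := vxE j v (mem_vertices sX vs) jE.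
  have [k1 k2] := fcE k s sX kE.
  have [us' s3] := map_polygon (proj1 X_sphere) sX.
  have uv := edge_of_neq us' (ltnW s3) e.
  have ij : i == j = false by apply/negP => /eqP ij; move: uv; rewrite -i2 -j2 ij eqxx.
  have ik : i == k = false by apply/negP => /eqP ik; move: i1; rewrite ik k1.
  have jk : j == k = false by apply/negP => /eqP jk; move: j1; rewrite jk k1.
  rewrite /cc ij ik jk i1 j1 k1 i2 j2 k2.
  case/orP: nuv => /eqP nuv; first by rewrite -nuv potS// addbCA addbb addbF.
  by rewrite -nuv potS// csym addbC.
exists (fun u => if insub (index u (vertices X)) is Some i then g i else false).
move=> s u v sX e; have /and3P[us vs nuv] := e.
rewrite (insubT (fun m => m < N)%N (vertex_index_lt sX us)).
rewrite (insubT (fun m => m < N)%N (vertex_index_lt sX vs)) /=.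
rewrite -(Hg _ _ (Ordinal (face_index_lt sX))); last by exists s, u, v.
have [us' s3] := map_polygon (proj1 X_sphere) sX.
have uv := edge_of_neq us' (ltnW s3) e.
rewrite /cc /= -val_eqE /= !index_mem !(mem_vertices sX) //.
rewrite /vx /= !nth_index ?(mem_vertices sX)//.
case: eqP => // E; move/eqP: uv; case.
by rewrite -[u](nth_index u (mem_vertices sX us)) E nth_index// (mem_vertices sX).
Qed.

End SphericalMaps.

(** * Flags *)

Section PolygonWalks.
Variable T : eqType.
Implicit Types (s t : seq T) (u v w : T).

Lemma iter_next_head u s i : uniq (u :: s) -> i < (size s).+1 ->
  iter i (next (u :: s)) u = nth u (u :: s) i.
Proof.
move=> us; elim: i => // i IH si; rewrite iterS IH; last exact: ltnW.
by rewrite next_nth_wrap//; [rewrite ltn_eqF|exact: ltnW].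
Qed.

Lemma iter_next s u i : uniq s -> u \in s -> i < size s ->
  iter i (next s) u = nth u (rot (index u s) s) i.
Proof.
move=> us su si; have E := rot_index su.
have us' : uniq (rot (index u s) s) by rewrite rot_uniq.
have -> : iter i (next s) u = iter i (next (rot (index u s) s)) u.
  by apply: eq_iter => v; rewrite next_rot.
have zs : size (rot (index u s) s) = size s by rewrite size_rot.
move: us' zs; rewrite E => us' /= zs.
by rewrite iter_next_head//; rewrite zs.
Qed.

Lemma iter_next_size s u : uniq s -> u \in s -> iter (size s) (next s) u = u.
Proof.
move=> us su; have s0 : 0 < size s by case: (s) su.
have lts : (size s).-1 < size s by rewrite prednK.
rewrite -[size s]prednK// iterS (iter_next us su lts).
rewrite -(next_rot (index u s))// next_nth_wrap ?rot_uniq ?size_rot//.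
by rewrite prednK// eqxx rot_index.
Qed.

Lemma mkseq_iter_next s u : uniq s -> u \in s ->
  mkseq (fun i => iter i (next s) u) (size s) = rot (index u s) s.
Proof.
move=> us su; apply: (@eq_from_nth _ u); first by rewrite size_mkseq size_rot.
by move=> i; rewrite size_mkseq => si; rewrite nth_mkseq// iter_next.
Qed.

Lemma edge_ofP s u v : uniq s -> u \in s ->
  edge_of s u v = (v == next s u) || (v == prev s u).
Proof.
move=> us su; rewrite /edge_of su /=.
have -> : (next s u == v) = (v == next s u) by rewrite eq_sym.
case: (boolP (v \in s)) => [sv|sv] /=.
  congr orb; apply/eqP/eqP => [<-|->]; first by rewrite (prev_next us).
  by rewrite (next_prev us).
apply/esym/negbTE; apply: contra sv => /orP[] /eqP ->.
  by rewrite mem_next.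
by rewrite mem_prev.
Qed.

Lemma prev_neq_next s u : uniq s -> 3 <= size s -> u \in s -> prev s u != next s u.
Proof.
move=> us s3 su; apply/eqP => E.
have : next s (next s u) = u by rewrite -E (next_prev us).
rewrite -{2}[u]/(iter 0 (next s) u) -[LHS]/(iter 2 (next s) u).
rewrite !iter_next//; last by exact: leq_trans s3.
by move/eqP; rewrite nth_uniq ?rot_uniq ?size_rot//; exact: leq_trans s3.
Qed.

Definition other s u v := if v == next s u then prev s u else next s u.

Variable s : seq T.
Hypotheses (us : uniq s) (s3 : 3 <= size s).

Lemma edge_of_other u v : edge_of s u v -> edge_of s u (other s u v).
Proof.
by move=> /and3P[su _ _]; rewrite edge_ofP// /other; case: ifP; rewrite eqxx ?orbT.
Qed.

Lemma otherK u v : edge_of s u v -> other s u (other s u v) = v.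
Proof.
move=> e; have /and3P[su _ _] := e; move: e; rewrite edge_ofP// /other.
have /negbTE np := prev_neq_next us s3 su.
case: (eqVneq v (next s u)) => [->|_] /=; first by rewrite np.
by move=> /eqP ->; rewrite eqxx.
Qed.

Lemma other_neq u v : edge_of s u v -> other s u v != v.
Proof.
move=> e; have /and3P[su _ _] := e; rewrite /other.
have np := prev_neq_next us s3 su.
by case: ifP => [/eqP ->|/negbT] //; rewrite eq_sym.
Qed.

Lemma edge_of_cases u v w : edge_of s u v -> edge_of s u w ->
  w = v \/ w = other s u v.
Proof.
move=> e; have /and3P[su _ _] := e; move: e; rewrite !edge_ofP// /other.
case: eqP => [->|_] /=; first by move=> _ /orP[] /eqP; auto.
by move=> /eqP -> /orP[] /eqP; auto.
Qed.

Lemma other_next u : u \in s -> other s (next s u) u = next s (next s u).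
Proof.
move=> su; rewrite /other; case: ifP => // /eqP E.
have := prev_neq_next us s3 su.
by rewrite -[prev s u](prev_next us) (next_prev us) {1}E !(prev_next us) eqxx.
Qed.

Lemma other_prev u : u \in s -> other s (prev s u) u = prev s (prev s u).
Proof. by move=> su; rewrite /other (next_prev us) eqxx. Qed.

End PolygonWalks.

Section Flags.
Variables (T : eqType) (X : seq (seq T)).
Hypothesis X_map : polyhedral_map X.
Implicit Types (s t : seq T) (u v w : T).

Definition opposite s u v :=
  nth [::] X (find (fun t => (t != s) && edge_of t u v) X).

Lemma face_uniq s : s \in X -> uniq s. Proof. by case/(map_polygon X_map). Qed.

Lemma face_size s : s \in X -> 3 <= size s. Proof. by case/(map_polygon X_map). Qed.

Lemma two_faces s u v : s \in X -> edge_of s u v ->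
  exists2 t, [/\ t \in X, t != s & edge_of t u v] &
    forall t', t' \in X -> edge_of t' u v -> t' = s \/ t' = t.
Proof.
move=> sX e; have := map_edge X_map sX e; rewrite -size_filter.
set F := seq.filter _ _ => F2.
have sF : s \in F by rewrite mem_filter e.
have uF : uniq F by rewrite filter_uniq// (Defs.map_uniq X_map).
have memF t : t \in F = edge_of t u v && (t \in X) by rewrite mem_filter.
case: F F2 sF uF memF => [|a [|b [|]]]//= _; rewrite !inE andbT => sab nab memF.
have [ha hb] : (edge_of a u v && (a \in X)) /\ (edge_of b u v && (b \in X)).
  by rewrite -!memF !inE !eqxx orbT.
have [/andP[ea aX] /andP[eb bX]] := conj ha hb.
case/orP: sab => /eqP ->; [exists b|exists a].
- by rewrite eq_sym.
- by move=> t' tX te; have := memF t'; rewrite te tX !inE => /orP[] /eqP ->; auto.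
- by [].
- by move=> t' tX te; have := memF t'; rewrite te tX !inE => /orP[] /eqP ->; auto.
Qed.

Lemma oppositeP s u v : s \in X -> edge_of s u v ->
  [/\ opposite s u v \in X, opposite s u v != s & edge_of (opposite s u v) u v].
Proof.
move=> sX e; have [t [tX ts te] _] := two_faces sX e.
have h : has (fun t => (t != s) && edge_of t u v) X by apply/hasP; exists t; rewrite ?ts.
by have /andP[? ?] := nth_find [::] h; split=> //; rewrite mem_nth// -has_find.
Qed.

Lemma opposite_uniq s u v t : s \in X -> edge_of s u v ->
  t \in X -> t != s -> edge_of t u v -> t = opposite s u v.
Proof.
move=> sX e tX ts te; have [t' _ Ht] := two_faces sX e.
have [oX os oe] := oppositeP sX e.
by case: (Ht _ tX te) (Ht _ oX oe) ts os => -> [] ->; rewrite ?eqxx.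
Qed.

Lemma opposite_sym s u v : opposite s u v = opposite s v u.
Proof. by congr nth; apply: eq_find => t; rewrite edge_of_sym. Qed.

Lemma oppositeK s u v : s \in X -> edge_of s u v ->
  opposite (opposite s u v) u v = s.
Proof.
move=> sX e; have [oX os oe] := oppositeP sX e.
by apply/esym/opposite_uniq => //; rewrite eq_sym.
Qed.

Lemma three_common s t u v w : s \in X -> t \in X ->
  u \in s -> v \in s -> w \in s -> u \in t -> v \in t -> w \in t ->
  u != v -> u != w -> v != w -> s = t.
Proof.
move=> sX tX us vs ws ut vt wt uv uw vw; apply/eqP/negPn/negP => st.
case: (map_meet X_map sX tX st) => [/(_ u)|[x H]|[x [y [_ _ H]]]].
- by rewrite us ut.
- have := H u; have := H v; rewrite us ut vs vt /= => /esym/eqP Ev /esym/eqP Eu.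
  by rewrite Eu Ev eqxx in uv.
- have := H u; have := H v; have := H w; rewrite us ut vs vt ws wt /=.
  move=> /esym/orP[] /eqP Ew /esym/orP[] /eqP Ev /esym/orP[] /eqP Eu;
  by move: uv uw vw; rewrite ?Eu ?Ev ?Ew ?eqxx ?andbF.
Qed.

(** A face across both edges of [s] at [u] would share three vertices with [s]. *)
Lemma opposite_other_neq s u v : s \in X -> edge_of s u v ->
  opposite s u (other s u v) != opposite s u v.
Proof.
move=> sX e; apply/eqP => E.
have us := face_uniq sX; have s3 := face_size sX.
have e' := edge_of_other us e.
have [oX os /and3P[uo vo _]] := oppositeP sX e.
have [_ _ /and3P[_ wo _]] := oppositeP sX e'.
have /and3P[su sv _] := e; have /and3P[_ sw _] := e'.
have n1 := edge_of_neq us (ltnW s3) e; have n2 := edge_of_neq us (ltnW s3) e'.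
have n3 := other_neq us s3 e.
rewrite E in wo; move/eqP: os; apply.
by apply: (three_common _ _ uo vo wo su sv sw n1 n2) => //; rewrite eq_sym.
Qed.

(** A flag carries a local orientation at its vertex, so that no global orientation of [X] has to be
    chosen. *)
Definition is_flag (x : seq T * T * T) := (x.1.1 \in X) && edge_of x.1.1 x.1.2 x.2.

Definition flag := {x | is_flag x}.

Implicit Types x y : flag.

Definition flag_face x := (val x).1.1.
Definition flag_vertex x := (val x).1.2.
Definition flag_target x := (val x).2.

Lemma flagP x : flag_face x \in X /\ edge_of (flag_face x) (flag_vertex x) (flag_target x).
Proof. by apply/andP; exact: (valP x). Qed.

Lemma rotate_subproof x :
  is_flag (opposite (flag_face x) (flag_vertex x) (flag_target x), flag_vertex x,
    other (opposite (flag_face x) (flag_vertex x) (flag_target x)) (flag_vertex x)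
      (flag_target x)).
Proof.
have [sX e] := flagP x; have [oX _ oe] := oppositeP sX e.
by rewrite /is_flag /= oX edge_of_other// face_uniq.
Qed.

(** Crosses the edge of the flag and points along the next edge at the same vertex. *)
Definition flag_rotate x : flag :=
  exist (fun z => is_true (is_flag z)) _ (rotate_subproof x).

Lemma reverse_subproof x :
  is_flag (opposite (flag_face x) (flag_vertex x) (flag_target x), flag_target x,
    flag_vertex x).
Proof.
have [sX e] := flagP x; have [oX _ oe] := oppositeP sX e.
by rewrite /is_flag /= oX edge_of_sym.
Qed.

(** Changes both the end and the side of the edge, which preserves the local orientation. Followed
    by [flag_rotate] it advances along the boundary of the original face, see [flag_stepE]. *)
Definition flag_reverse x : flag :=
  exist (fun z => is_true (is_flag z)) _ (reverse_subproof x).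

Definition flag_size x := size (flag_face x).

Lemma flag_eq x y : flag_face x = flag_face y -> flag_vertex x = flag_vertex y ->
  flag_target x = flag_target y -> x = y.
Proof.
move=> h1 h2 h3; apply: val_inj; move: h1 h2 h3.
rewrite /flag_face /flag_vertex /flag_target.
by case: (val x) (val y) => [[a b] c] [[a' b'] c'] /= -> -> ->.
Qed.

Lemma flag_reverseK : involutive flag_reverse.
Proof.
move=> x; have [sX e] := flagP x.
by apply: flag_eq => //; rewrite /flag_face/= opposite_sym oppositeK.
Qed.

Lemma flag_stepE x : let y := flag_rotate (flag_reverse x) in
  [/\ flag_face y = flag_face x, flag_vertex y = flag_target x &
      flag_target y = other (flag_face x) (flag_target x) (flag_vertex x)].
Proof.
have [sX e] := flagP x.
have E : opposite (opposite (flag_face x) (flag_vertex x) (flag_target x))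
   (flag_target x) (flag_vertex x) = flag_face x by rewrite opposite_sym oppositeK.
by split=> //; rewrite /flag_face /flag_target /= -/(flag_face x) -/(flag_target x) E.
Qed.

Definition flag_step x := flag_rotate (flag_reverse x).

Lemma flag_size_step x : flag_size (flag_step x) = flag_size x.
Proof. by rewrite /flag_size; have [-> _ _] := flag_stepE x. Qed.

Lemma iter_flag_step x : exists nx : T -> T,
  [/\ nx =1 next (flag_face x) \/ nx =1 prev (flag_face x),
      flag_target x = nx (flag_vertex x) &
      forall i, [/\ flag_face (iter i flag_step x) = flag_face x,
        flag_vertex (iter i flag_step x) = iter i nx (flag_vertex x) &
        flag_target (iter i flag_step x) = iter i.+1 nx (flag_vertex x)]].
Proof.
have [sX e] := flagP x; have us := face_uniq sX; have s3 := face_size sX.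
have /and3P[su sv _] := e; move: e; rewrite edge_ofP// => /orP[] /eqP ev;
  [exists (next (flag_face x))|exists (prev (flag_face x))]; split; auto;
  elim=> [|i [IH1 IH2 IH3]]//; rewrite iterS;
  have [-> -> ->] := flag_stepE (iter i flag_step x); rewrite IH1 IH2 IH3; split=> //.
- rewrite iterS other_next// -?iterS//.
  by elim: (i) => //= j; rewrite mem_next.
- rewrite iterS other_prev// -?iterS//.
  by elim: (i) => //= j; rewrite mem_prev.
Qed.

Lemma flag_step_size x : iter (flag_size x) flag_step x = x.
Proof.
have [nx [nxE tx H]] := iter_flag_step x.
have [sX /and3P[su _ _]] := flagP x; have us := face_uniq sX.
have [h1 h2 h3] := H (flag_size x).
have E u : u \in flag_face x -> iter (flag_size x) nx u = u.
  move=> fu; case: nxE => nxE; rewrite (eq_iter nxE); first exact: iter_next_size.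
  rewrite -(eq_iter (next_rev us)) /flag_size -size_rev.
  by apply: iter_next_size; rewrite ?rev_uniq ?mem_rev.
apply: flag_eq => //; first by rewrite h2 E.
by rewrite h3 iterS E.
Qed.

Lemma flag_walk x : same_polygon
  (mkseq (fun i => flag_vertex (iter i flag_step x)) (flag_size x)) (flag_face x) /\
  same_polygon (flag_face x)
  (mkseq (fun i => flag_vertex (iter i flag_step x)) (flag_size x)).
Proof.
have [nx [nxE tx H]] := iter_flag_step x.
have [sX /and3P[su _ _]] := flagP x; have us := face_uniq sX.
rewrite (_ : mkseq _ _ = mkseq (fun i => iter i nx (flag_vertex x)) (flag_size x)); last first.
  by apply: eq_mkseq => i; case: (H i).
set w := mkseq _ _; set s := flag_face x.
have [E|E] : w = rot (index (flag_vertex x) s) s \/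
    w = rot (index (flag_vertex x) (rev s)) (rev s).
  case: nxE => nxE; [left|right].
    by rewrite -mkseq_iter_next//; apply: eq_mkseq => i; rewrite (eq_iter nxE).
  rewrite -mkseq_iter_next ?rev_uniq ?mem_rev// size_rev.
  by apply: eq_mkseq => i; rewrite (eq_iter nxE) (eq_iter (next_rev us)).
  split; last by exists (index (flag_vertex x) s); left.
  by exists (size s - index (flag_vertex x) s); left; rewrite E -[LHS](rotK (index (flag_vertex x) s)) /rotr size_rot.
set k := index _ _ in E.
split; last by exists (size s - k); right; rewrite E -rev_rotr.
exists (size w - k); right; rewrite E size_rot size_rev.
by rewrite -[X in X - k](size_rev s) -(size_rot k (rev s)) -/(rotr k _) rotK revK.
Qed.

(** Both neighbours of the face in [c] share with it an edge at [u], so they are among the two faces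
    across its edges at [u]. The neighbours are distinct because [c] has at least three faces, hence
    they exhaust these two. *)
Lemma face_cycle_opposite u c x : face_cycle X u c -> flag_vertex x = u ->
  3 <= size c /\
  (opposite (flag_face x) (flag_vertex x) (flag_target x) = next c (flag_face x) \/
   opposite (flag_face x) (flag_vertex x) (flag_target x) = prev c (flag_face x)).
Proof.
move=> [uc mc cc] xu; have [sX e] := flagP x; rewrite xu in e *.
set s := flag_face x in sX e *; set v := flag_target x in e *.
have us := face_uniq sX; have s3 := face_size sX.
have e' := edge_of_other us e; set v' := other s u v in e'.
have [aX sa ea] := oppositeP sX e; have [bX sb eb] := oppositeP sX e'.
have ba := opposite_other_neq sX e; rewrite -/v' in ba.
set a := opposite s u v in aX sa ea ba *; set b := opposite s u v' in bX sb eb ba *.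
have memc t v'' : t \in X -> edge_of t u v'' -> t \in c.
  by move=> tX /and3P[ut _ _]; rewrite mc mem_filter ut.
have [sc ac bc] := And3 (memc _ _ sX e) (memc _ _ aX ea) (memc _ _ bX eb).
have c3 : 3 <= size c.
  have u3 : uniq [:: s; a; b].
    by rewrite /= !inE !negb_or ![s == _]eq_sym ![a == b]eq_sym sa sb ba.
  by apply: (uniq_leq_size u3) => t; rewrite !inE => /or3P[] /eqP ->.
split=> //.
have adj t : t \in c -> t != s -> adjacent_at u s t \/ adjacent_at u t s ->
    t = a \/ t = b.
  move=> tc ts H; have tX : t \in X by move: tc; rewrite mc mem_filter => /andP[].
  have [w ew etw] : exists2 w, edge_of s u w & edge_of t u w.
    by case: H => /hasP[w _ /andP[e1 e2]]; exists w.
  have -> := opposite_uniq sX ew tX ts etw.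
  by case: (edge_of_cases us e ew) => ->; auto.
have np := prev_neq_next uc c3 sc.
have nxs : next c s != s by apply: next_neq => //; exact: ltnW.
have pvs : prev c s != s.
  by rewrite -(next_rev uc); apply: next_neq; rewrite ?rev_uniq ?size_rev ?mem_rev//; exact: ltnW.
have nc : next c s \in c by rewrite mem_next.
have pc : prev c s \in c by rewrite mem_prev.
case: (adj _ nc nxs) => [|->|nb]; [by left; exact: next_cycle|by left|].
case: (adj _ pc pvs) => [|->|pb]; [by right; exact: prev_cycle|by right|].
by rewrite nb pb eqxx in np.
Qed.

Section AroundVertex.
Variable L : seq nat.
Hypothesis X_type : forall u, u \in vertices X ->
  exists2 c, face_cycle X u c & [seq size s | s <- c] = L.

(** The cycle of faces is oriented so that the first rotation follows it; the rotations then never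
    turn back. *)
Lemma flag_around x : exists c, [/\ uniq c,
    c =i [seq s <- X | flag_vertex x \in s],
    [seq size s | s <- c] = L \/ [seq size s | s <- c] = rev L,
    3 <= size c &
    forall i, flag_face (iter i flag_rotate x) = iter i (next c) (flag_face x)] /\
    iter (size c) flag_rotate x = x.
Proof.
have [sX e] := flagP x; have /and3P[su _ _] := e.
have [c0 fc0 Lc0] := X_type (mem_vertices sX su).
have [c03 H0] := face_cycle_opposite fc0 (erefl (flag_vertex x)).
have [uc0 mc0 _] := fc0.
have [c [uc mc Lc c3 [nc Hc]]] : exists c, [/\ uniq c,
    c =i [seq s <- X | flag_vertex x \in s],
    [seq size s | s <- c] = L \/ [seq size s | s <- c] = rev L, 3 <= size c &
    opposite (flag_face x) (flag_vertex x) (flag_target x) = next c (flag_face x) /\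
    forall y, flag_vertex y = flag_vertex x ->
      opposite (flag_face y) (flag_vertex y) (flag_target y) = next c (flag_face y) \/
      opposite (flag_face y) (flag_vertex y) (flag_target y) = prev c (flag_face y)].
  case: H0 => H0.
    exists c0; split=> //; [by left|split=> //].
    by move=> y yx; case: (face_cycle_opposite fc0 yx).
  exists (rev c0); split; rewrite ?rev_uniq ?size_rev//.
  - by move=> t; rewrite mem_rev mc0.
  - by right; rewrite map_rev Lc0.
  - split; first by rewrite next_rev.
    move=> y yx; rewrite next_rev// prev_rev//.
    by case: (face_cycle_opposite fc0 yx) => _ []; auto.
have memc y : flag_vertex y = flag_vertex x -> flag_face y \in c.
  by move=> yx; rewrite mc mem_filter -yx; have [-> /and3P[-> _ _]] := flagP y.
have H i : [/\ flag_vertex (iter i flag_rotate x) = flag_vertex x,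
    flag_face (iter i flag_rotate x) = iter i (next c) (flag_face x) &
    opposite (flag_face (iter i flag_rotate x)) (flag_vertex x)
      (flag_target (iter i flag_rotate x)) = iter i.+1 (next c) (flag_face x)].
  elim: i => [|i [IH1 IH2 IH3]] //.
  set y := iter i flag_rotate x in IH1 IH2 IH3 *.
  have v1 : flag_vertex (iter i.+1 flag_rotate x) = flag_vertex x by rewrite iterS -/y -IH1.
  have f1 : flag_face (iter i.+1 flag_rotate x) = iter i.+1 (next c) (flag_face x).
    by rewrite iterS -/y /flag_face /= -/(flag_face y) -/(flag_vertex y) -/(flag_target y) IH1.
  split=> //.
  have [yX ye] := flagP y; rewrite IH1 in ye.
  case: (Hc _ v1); rewrite v1; first by move=> ->; rewrite f1.
  have -> : prev c (flag_face (iter i.+1 flag_rotate x)) = flag_face y.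
    by rewrite f1 iterS prev_next// IH2.
  (* Going back would mean that the same face lies across both edges of the current face at the
     vertex. *)
  move=> h2; exfalso.
  have [oX oy oe] := oppositeP yX ye.
  have := opposite_other_neq oX oe; rewrite oppositeK// => /eqP h1; apply: h1.
  rewrite -[RHS]h2 iterS -/y.
  have -> : flag_face (flag_rotate y) = opposite (flag_face y) (flag_vertex x) (flag_target y).
    by rewrite -IH1.
  by rewrite -IH1.
exists c; split; first by split=> // i; case: (H i).
have [h1 h2 h3] := H (size c).
have sc := memc x erefl.
rewrite (iter_next_size uc sc) in h2.
rewrite iterS (iter_next_size uc sc) -nc h2 in h3.
apply: flag_eq => //.
set z := iter _ _ _ in h1 h2 h3 *.
have [zX ze] := flagP z; rewrite h1 h2 in ze.
(* The face is the initial one again; the other edge at the vertex is excluded since it leads to a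
   different face. *)
case: (edge_of_cases (face_uniq sX) e ze) => // E.
by move/eqP: (opposite_other_neq sX e); rewrite -E h3.
Qed.

Lemma flag_around_type x : exists k,
  let l := mkseq (fun i => flag_size (iter i flag_rotate x)) (size L) in
  l = rot k L \/ l = rot k (rev L).
Proof.
have [c [[uc mc Lc c3 H] _]] := flag_around x.
have [sX /and3P[su _ _]] := flagP x.
have sc : flag_face x \in c by rewrite mc mem_filter su.
have dE : size c = size L.
  by rewrite -(size_map size c); case: Lc => ->; rewrite ?size_rev.
exists (index (flag_face x) c) => l.
have -> : l = rot (index (flag_face x) c) [seq size s | s <- c].
  rewrite -map_rot -(mkseq_iter_next uc sc) /mkseq -map_comp dE.
  by apply: eq_map => i; rewrite /= /flag_size H.
by case: Lc => ->; auto.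
Qed.

Lemma flag_rotate_size x : iter (size L) flag_rotate x = x.
Proof.
have [c [[_ _ Lc _ _] E]] := flag_around x; rewrite -[RHS]E; congr iter.
by rewrite -(size_map size c); case: Lc => ->; rewrite ?size_rev.
Qed.

Lemma flag_degree x : 3 <= size L.
Proof.
have [c [[_ _ Lc c3 _] _]] := flag_around x.
by move: c3; rewrite -(size_map size c); case: Lc => ->; rewrite ?size_rev.
Qed.

Lemma flag_vertex_rotate x i : flag_vertex (iter i flag_rotate x) = flag_vertex x.
Proof. by elim: i. Qed.

Lemma flag_faces x t : t \in X -> flag_vertex x \in t ->
  exists2 i, i < size L & flag_face (iter i flag_rotate x) = t.
Proof.
move=> tX ut; have [c [[uc mc Lc c3 H] _]] := flag_around x.
have [sX /and3P[su _ _]] := flagP x.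
have sc : flag_face x \in c by rewrite mc mem_filter su.
have tc : t \in c by rewrite mc mem_filter ut.
have dE : size c = size L.
  by rewrite -(size_map size c); case: Lc => ->; rewrite ?size_rev.
have : t \in mkseq (fun i => iter i (next c) (flag_face x)) (size c).
  by rewrite mkseq_iter_next// mem_rot.
move=> /mapP[i]; rewrite mem_iota dE => /= ic ->.
by exists i; rewrite ?H.
Qed.

(** In [t] the edge to [v] is either the edge of the flag that lies in [t] or the edge just crossed,
    which belongs to the preceding flag, of index [j]. *)
Lemma flag_neighbours x t v : t \in X -> edge_of t (flag_vertex x) v ->
  exists2 i, i < size L & flag_vertex (flag_reverse (iter i flag_rotate x)) = v.
Proof.
move=> tX e; have /and3P[ut _ _] := e; have [i id fi] := flag_faces tX ut.
have [_ ei] := flagP (iter i flag_rotate x).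
rewrite fi flag_vertex_rotate in ei.
case: (edge_of_cases (face_uniq tX) e ei) => E; first by exists i.
have d3 := flag_degree x.
pose j := (i + (size L).-1) %% size L.
have j1 : iter i flag_rotate x = flag_rotate (iter j flag_rotate x).
  rewrite -iterS /j; have [i0|i0] := posnP i.
    rewrite i0 add0n modn_small ?prednK ?flag_rotate_size//; lia.
  have -> : i + (size L).-1 = i.-1 + size L by lia.
  by rewrite modnDr modn_small ?prednK//; lia.
exists j; first by rewrite /j ltn_mod; lia.
set y := iter j flag_rotate x in j1 *.
have yu : flag_vertex y = flag_vertex x by rewrite flag_vertex_rotate.
have [yX ye] := flagP y; have [oX oy oe] := oppositeP yX ye.
have fy : opposite (flag_face y) (flag_vertex y) (flag_target y) = t by rewrite -fi j1.
have ty : other t (flag_vertex x) (flag_target y) = flag_target (iter i flag_rotate x).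
  by rewrite j1 -fy -yu.
rewrite /flag_vertex /= -/(flag_target y).
rewrite fy yu in oe.
rewrite -(otherK (face_uniq tX) (face_size tX) oe) ty E.
by rewrite otherK// ?face_uniq ?face_size.
Qed.

End AroundVertex.
End Flags.

(** * Euler's formula *)

Section Euler.
Variables (T : eqType) (X : seq (seq T)) (X_map : polyhedral_map X) (L : seq nat).
Hypothesis X_type : forall u, u \in vertices X ->
  exists2 c, face_cycle X u c & [seq size s | s <- c] = L.
Hypothesis X_connected : forall C : T -> bool,
  (forall s u v, s \in X -> edge_of s u v -> C u = C v) ->
  {in vertices X &, forall u v, C u = C v}.
Hypothesis X_cocycle : forall c : T -> T -> bool,
  (forall u v, c u v = c v u) ->
  (forall s, s \in X -> \big[addb/false]_(u <- s) c u (next s u) = false) ->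
  exists g : T -> bool, forall s u v, s \in X -> edge_of s u v -> c u v = g u (+) g v.
Hypothesis X_nonempty : 0 < size X.

Let V := vertices X.

Definition oriented_edge (u v : T) : T * T :=
  if index u V < index v V then (u, v) else (v, u).

Definition edges : seq (T * T) :=
  [seq e <- [seq (u, v) | u <- V, v <- V] |
    (index e.1 V < index e.2 V) && has (fun s => edge_of s e.1 e.2) X].

Lemma edges_uniq : uniq edges.
Proof.
by rewrite filter_uniq// allpairs_uniq ?undup_uniq// => -[? ?] [? ?] _ _ /= [-> ->].
Qed.

Lemma mem_edges e : (e \in edges) =
  (index e.1 V < index e.2 V) && has (fun s => edge_of s e.1 e.2) X.
Proof.
rewrite mem_filter andb_idr// => /andP[_ /hasP[s sX /and3P[su sv _]]].
case: e su sv => u v /= su sv; apply/allpairsP; exists (u, v) => /=.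
by rewrite !(mem_vertices sX).
Qed.

Lemma oriented_edge_mem s u v : s \in X -> edge_of s u v -> oriented_edge u v \in edges.
Proof.
move=> sX e; have /and3P[su sv _] := e.
have [uV vV] := conj (mem_vertices sX su) (mem_vertices sX sv).
have uv := edge_of_neq (face_uniq X_map sX) (ltnW (face_size X_map sX)) e.
rewrite mem_edges /oriented_edge; case: (ltnP (index u V) (index v V)) => /= uvi.
  by rewrite uvi; apply/hasP; exists s.
apply/andP; split; last by apply/hasP; exists s; rewrite // edge_of_sym.
rewrite ltn_neqAle uvi andbT; apply: contra uv => /eqP E.
by rewrite -(nth_index u uV) -E nth_index.
Qed.

Lemma oriented_edge_sym u v : u \in V -> v \in V -> oriented_edge u v = oriented_edge v u.
Proof.
move=> uV vV; rewrite /oriented_edge; case: ltngtP => // E.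
by rewrite -(nth_index u uV) E nth_index.
Qed.

(** The sides of a polygon are distinct as undirected edges because there are at least three of
    them. *)
Lemma face_edges s : s \in X ->
  perm_eq [seq oriented_edge u (next s u) | u <- s] [seq e <- edges | edge_of s e.1 e.2].
Proof.
move=> sX; have us := face_uniq X_map sX; have s3 := face_size X_map sX.
apply: uniq_perm; [|exact/filter_uniq/edges_uniq|].
  rewrite map_inj_in_uniq// => u v su sv; rewrite /oriented_edge.
  have H : u = next s v -> next s u = v -> u = v.
    move=> uv; rewrite {1}uv => E; have := prev_neq_next us s3 sv.
    by rewrite -uv -E -{1}uv (prev_next us) eqxx.
  by case: ifP => _; case: ifP => _ [] //; auto => -> ->.
move=> e; rewrite mem_filter; apply/mapP/andP => [[u su ->]|[es eE]].
  have e' := edge_of_next su; split; last exact: oriented_edge_mem sX e'.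
  by rewrite /oriented_edge; case: ifP => //=; rewrite edge_of_sym.
have eord : oriented_edge e.1 e.2 = e.
  by move: eE; rewrite mem_edges /oriented_edge => /andP[-> _]; case: (e).
have /and3P[su sv /orP[] /eqP E] := es; [exists e.1 => //|exists e.2 => //].
  by rewrite E.
by rewrite E oriented_edge_sym ?(mem_vertices sX).
Qed.

Lemma face_edges_sum (R : nmodType) s (f : T * T -> R) : s \in X ->
  (\sum_(e <- edges | edge_of s e.1 e.2) f e = \sum_(u <- s) f (oriented_edge u (next s u)))%R.
Proof.
by move=> sX; rewrite -big_filter -(perm_big _ (face_edges sX)) /= big_map.
Qed.

Lemma double_count_edges : (\sum_(s <- X) size s = 2 * size edges)%N.
Proof.
have -> : (\sum_(s <- X) size s = \sum_(s <- X) \sum_(e <- edges | edge_of s e.1 e.2) 1)%N.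
  rewrite big_seq [RHS]big_seq; apply: eq_bigr => s sX.
  by rewrite (@face_edges_sum nat _ (fun=> 1%N))// sum1_size.
rewrite (exchange_big_dep xpredT) //=.
rewrite (eq_big_seq (fun=> 2)); last first.
  move=> e; rewrite mem_edges => /andP[_ /hasP[s sX es]].
  by rewrite sum1_count (map_edge X_map sX es).
by rewrite big_const_seq count_predT iter_addn addn0.
Qed.

(** Successive faces around a vertex share an edge, so [C] induces a function on the vertices; it is
    constant along edges because the ends of an edge lie in a common face. *)
Lemma faces_connected (C : seq T -> bool) :
  (forall s t u v, s \in X -> t \in X -> edge_of s u v -> edge_of t u v -> C s = C t) ->
  {in X &, forall s t, C s = C t}.
Proof.
move=> HC.
have around (x : flag X) t : t \in X -> flag_vertex x \in t -> C t = C (flag_face x).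
  move=> tX ut; have [i _ <-] := flag_faces X_map X_type tX ut.
  elim: i => // i <-; rewrite iterS; set y := iter i _ x.
  have [yX ye] := flagP y; have [oX _ oe] := oppositeP X_map yX ye.
  exact: HC oX yX oe ye.
pose D u := has (fun s => (u \in s) && C s) X.
have DE s u : s \in X -> u \in s -> D u = C s.
  move=> sX su; have e := edge_of_next su.
  have fl : is_flag X (s, u, next s u) by rewrite /is_flag /= sX.
  have around' t : t \in X -> u \in t -> C t = C s.
    exact: (around (exist (fun z => is_true (is_flag X z)) _ fl)).
  apply/hasP/idP => [[t tX /andP[ut Ct]]|Cs]; first by rewrite -(around' t).
  by exists s; rewrite ?su.
have Dc s u v : s \in X -> edge_of s u v -> D u = D v.
  by move=> sX /and3P[su sv _]; rewrite !(DE s).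
move=> s t sX tX.
have [s3 t3] := conj (face_size X_map sX) (face_size X_map tX).
case: s sX s3 => // u s sX _; case: t tX t3 => // v t tX _.
rewrite -(DE _ _ sX (mem_head u s)) -(DE _ _ tX (mem_head v t)).
by apply: (X_connected Dc); [apply: mem_vertices sX _|apply: mem_vertices tX _]; exact: mem_head.
Qed.

Local Open Scope ring_scope.

Lemma addb_natrF2 (a b : bool) : (a (+) b)%:R = a%:R + b%:R :> 'F_2.
Proof. by case: a b => -[]; apply/val_inj. Qed.

Lemma F2_bool (x : 'F_2) : x = (x != 0)%:R.
Proof. by case: x => -[|[|//]] p; apply/val_inj. Qed.

Lemma F2_addxx (x : 'F_2) : x + x = 0.
Proof. by rewrite [x]F2_bool; case: (x != 0); apply/val_inj. Qed.

Lemma sum_addb_natrF2 (I : Type) (r : seq I) (b : I -> bool) :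
  (\big[addb/false]_(i <- r) b i)%:R = \sum_(i <- r) (b i)%:R :> 'F_2.
Proof. exact: (big_morph (fun a : bool => a%:R : 'F_2) addb_natrF2). Qed.

Lemma mem_in_tuple (Y : eqType) (s : seq Y) y :
  y \in s -> exists j, y = tnth (in_tuple s) j.
Proof. by move=> ys; apply/tnthP. Qed.

(* A row vector seen as a function vanishing outside [s]. *)
Definition row_fun (Y : eqType) (s : seq Y) (r : 'rV['F_2]_(size s)) (y : Y) : 'F_2 :=
  \sum_i r 0 i * (tnth (in_tuple s) i == y)%:R.

Lemma row_funE (Y : eqType) (s : seq Y) (r : 'rV_(size s)) i : uniq s ->
  row_fun r (tnth (in_tuple s) i) = r 0 i.
Proof.
move=> us; rewrite /row_fun (bigD1 i)//= eqxx mulr1 big1 ?addr0// => j ji.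
pose y := tnth (in_tuple s) i.
by rewrite !(tnth_nth y) /= nth_uniq//; rewrite (_ : (j == i :> nat) = false) ?mulr0//; exact/negbTE.
Qed.

Let vertex i := tnth (in_tuple V) i.
Let edge j := tnth (in_tuple edges) j.
Let face f := tnth (in_tuple X) f.

(** The coboundary mod 2, acting on row vectors: [d0] leads from functions on vertices to functions
    on edges, and [d1] from there to functions on faces. *)
Let d0 : 'M['F_2]_(size V, size edges) :=
  \matrix_(i, j) (((edge j).1 == vertex i)%:R + ((edge j).2 == vertex i)%:R).
Let d1 : 'M['F_2]_(size edges, size X) :=
  \matrix_(j, f) (edge_of (face f) (edge j).1 (edge j).2)%:R.

Let uV : uniq V := undup_uniq _.

Lemma mulmx_d0 (r : 'rV_(size V)) j :
  (r *m d0) 0 j = row_fun r (edge j).1 + row_fun r (edge j).2.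
Proof.
rewrite mxE -big_split /=; apply: eq_bigr => i _.
by rewrite mxE mulrDr ![_ == vertex i]eq_sym.
Qed.

Lemma mulmx_d1 (r : 'rV_(size edges)) f : (r *m d1) 0 f =
  \sum_(u <- face f) row_fun r (oriented_edge u (next (face f) u)).
Proof.
have fX : face f \in X by exact: mem_tnth.
rewrite -(face_edges_sum _ fX) big_tnth mxE [RHS]big_mkcond /=; apply: eq_bigr => j _.
rewrite mxE row_funE ?edges_uniq//.
by case: ifP; rewrite ?mulr1 ?mulr0.
Qed.

(** Around a face every vertex is met once as the start and once as the end of a side. *)
Lemma d0_d1 : d0 *m d1 = 0.
Proof.
apply/row_matrixP => i; rewrite row_mul row0; apply/rowP => f.
rewrite mulmx_d1 mxE.
set s := face f; have sX : s \in X by exact: mem_tnth.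
have us := face_uniq X_map sX.
have H e : e \in edges -> row_fun (row i d0) e = (e.1 == vertex i)%:R + (e.2 == vertex i)%:R.
  move=> /mem_in_tuple[j ->]; rewrite (row_funE _ _ edges_uniq) !mxE.
  by [].
rewrite big_seq (eq_bigr (fun u => (u == vertex i)%:R + (next s u == vertex i)%:R)); last first.
  move=> u su; rewrite H; last exact: (oriented_edge_mem sX (edge_of_next su)).
  by rewrite /oriented_edge; case: ifP => //= _; rewrite addrC.
rewrite -big_seq big_split /= -[X in _ + X](big_map (next s) xpredT (fun v => (v == vertex i)%:R)).
rewrite [X in _ + X](perm_big s) ?F2_addxx//=.
apply: uniq_perm => //; first by rewrite map_inj_in_uniq// => ? ? _ _; exact: (can_inj (prev_next us)).
move=> u; apply/mapP/idP => [[w ws ->]|su]; first by rewrite mem_next.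
by exists (prev s u); rewrite ?mem_prev// next_prev.
Qed.

(** The vanishing of H^1(X; Z/2), deduced from [X_cocycle]. *)
Lemma ker_d1 : (kermx d1 <= d0)%MS.
Proof.
apply/row_subP => k; set c := row k _.
have cd1 : c *m d1 = 0 by rewrite -row_mul mulmx_ker row0.
pose c' u v := [&& u \in V, v \in V & row_fun c (oriented_edge u v) != 0].
have c'E s u v : s \in X -> edge_of s u v -> (c' u v)%:R = row_fun c (oriented_edge u v).
  by move=> sX /and3P[su sv _]; rewrite /c' !(mem_vertices sX)//= -F2_bool.
have [|s sX|g Hg] := X_cocycle (c := c').
- move=> u v; rewrite /c'; case: (boolP (u \in V)) => uV'; case: (boolP (v \in V)) => vV' //=.
  by rewrite oriented_edge_sym.
- have : (\big[addb/false]_(u <- s) c' u (next s u))%:R = 0 :> 'F_2.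
    rewrite sum_addb_natrF2 big_seq (eq_bigr (fun u => row_fun c (oriented_edge u (next s u)))).
      rewrite -big_seq; have [f sf] := mem_in_tuple sX.
      by rewrite sf -/(face f) -mulmx_d1 cd1 mxE.
    by move=> u su; rewrite (c'E s)//; exact: edge_of_next.
  by case: (\big[_/_]_(_ <- _) _).
apply/submxP; exists (\row_i (g (vertex i))%:R); apply/rowP => j; rewrite mulmx_d0.
have gE u : u \in V -> row_fun (\row_i (g (vertex i))%:R) u = (g u)%:R.
  by move=> /mem_in_tuple[i ->]; rewrite row_funE// mxE.
have /[dup] := mem_tnth j (in_tuple edges).
rewrite -[tnth _ _]/(edge j) {1}mem_edges => /andP[lt /hasP[s sX e]] _.
have /and3P[su sv _] := e.
rewrite !gE ?(mem_vertices sX)// -addb_natrF2 -(Hg s)// (c'E s)//.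
by rewrite /oriented_edge lt -surjective_pairing row_funE// edges_uniq.
Qed.

Lemma rank_const1 n : (0 < n)%N -> \rank (const_mx 1 : 'rV['F_2]_n) = 1%N.
Proof.
move=> n0; rewrite rank_rV; suff -> : (const_mx 1 : 'rV['F_2]_n) != 0 by [].
apply/eqP => /rowP /(_ (Ordinal n0)).
by rewrite !mxE => /eqP; rewrite oner_eq0.
Qed.

(** The kernel is the line spanned by the constant vector. *)
Lemma rank_kermx_const m n (A : 'M['F_2]_(m, n)) : (0 < m)%N ->
  (const_mx 1 : 'rV_m) *m A = 0 ->
  (forall r : 'rV_m, r *m A = 0 -> forall i j, r 0 i = r 0 j) ->
  \rank A = m.-1.
Proof.
move=> m0 h1 h2; have : \rank (kermx A) = 1%N.
  apply: etrans (rank_const1 m0); apply: eqmx_rank; apply/andP; split.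
    apply/row_subP => k; have := h2 (row k (kermx A)).
    rewrite -row_mul mulmx_ker row0 => /(_ erefl) H.
    apply/submxP; exists ((row k (kermx A) 0 (Ordinal m0))%:M).
    by apply/rowP => i; rewrite mul_scalar_mx !mxE mulr1; have := H i (Ordinal m0); rewrite !mxE.
  exact/sub_kermxP.
rewrite mxrank_ker => H; have := rank_leq_row A; lia.
Qed.

Lemma vertices_pos : (0 < size V)%N.
Proof.
have [s sX] : exists s, s \in X.
  by move: X_nonempty; rewrite /in_mem /=; case: (X) => // s X' _; exists s; exact: mem_head.
have := face_size X_map sX; case E : s => [//|u s'] _.
have : u \in V by apply: mem_vertices sX _; rewrite E mem_head.
by case: V.
Qed.

Lemma rank_d0 : \rank d0 = (size V).-1.
Proof.
apply: rank_kermx_const; first exact: vertices_pos.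
  apply/rowP => j; rewrite mulmx_d0 mxE.
  have := mem_tnth j (in_tuple edges); rewrite -[tnth _ _]/(edge j) mem_edges.
  move=> /andP[_ /hasP[s sX /and3P[su sv _]]].
  have H u : u \in V -> @row_fun _ V (const_mx 1) u = 1.
    by move=> /mem_in_tuple[i ->]; rewrite row_funE// mxE.
  by rewrite !H ?(mem_vertices sX)// F2_addxx.
move=> r rd i j; rewrite -!(row_funE r)//.
have C s u v : s \in X -> edge_of s u v -> (row_fun r u != 0) = (row_fun r v != 0).
  move=> sX e; have := oriented_edge_mem sX e => /mem_in_tuple[k kE].
  have := mulmx_d0 r k; rewrite rd mxE /edge -kE => /esym/eqP.
  rewrite addr_eq0 /oriented_edge => /eqP.
  have oppE (x : 'F_2) : - x = x by apply/eqP; rewrite eq_sym -addr_eq0 F2_addxx.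
  by rewrite oppE; case: ifP => _ /= ->.
rewrite [LHS]F2_bool [RHS]F2_bool; congr (nat_of_bool _)%:R.
by apply: (X_connected C); exact: mem_tnth.
Qed.

(** In the transpose every edge has exactly two faces, so a function in the kernel agrees on
    adjacent faces and is constant by [faces_connected]. *)
Lemma rank_d1 : \rank d1 = (size X).-1.
Proof.
rewrite -mxrank_tr; have uX : uniq X := Defs.map_uniq X_map.
have mulE (r : 'rV_(size X)) j : (r *m d1^T) 0 j =
    \sum_(s <- X | edge_of s (edge j).1 (edge j).2) row_fun r s.
  rewrite big_tnth mxE [RHS]big_mkcond /=; apply: eq_bigr => f _.
  by rewrite !mxE row_funE//; case: ifP; rewrite ?mulr1 ?mulr0.
have two (r : 'rV_(size X)) j s t : s \in X -> t \in X -> s != t ->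
    edge_of s (edge j).1 (edge j).2 -> edge_of t (edge j).1 (edge j).2 ->
    (r *m d1^T) 0 j = row_fun r s + row_fun r t.
  move=> sX tX st es et; rewrite mulE -big_filter (perm_big [:: s; t]) /=.
    by rewrite !big_cons big_nil addr0.
  apply: uniq_perm; rewrite ?filter_uniq//= ?inE ?st// => t'.
  rewrite mem_filter !inE; apply/andP/orP => [[et' t'X]|[] /eqP -> //].
  case: (eqVneq t' s) => [|t's]; [by left|right].
  by rewrite (opposite_uniq X_map sX es tX _ et) 1?eq_sym// (opposite_uniq X_map sX es t'X t's et').
apply: rank_kermx_const; first exact: X_nonempty.
  apply/rowP => j; have := mem_tnth j (in_tuple edges).
  rewrite -[tnth _ _]/(edge j) mem_edges => /andP[_ /hasP[s sX es]].
  have [tX ts et] := oppositeP X_map sX es.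
  rewrite (two _ _ _ _ sX tX _ es et) 1?eq_sym// mxE.
  have H t : t \in X -> @row_fun _ X (const_mx 1) t = 1.
    by move=> /mem_in_tuple[i ->]; rewrite row_funE// mxE.
  by rewrite !H// F2_addxx.
move=> r rd i j; rewrite -!(row_funE r)//.
have C s t u v : s \in X -> t \in X -> edge_of s u v -> edge_of t u v ->
    (row_fun r s != 0) = (row_fun r t != 0).
  move=> sX tX es et; case: (eqVneq s t) => [->//|st].
  have [k kE] := mem_in_tuple (oriented_edge_mem sX es).
  have E s' : edge_of s' u v -> edge_of s' (edge k).1 (edge k).2.
    by rewrite /edge -kE /oriented_edge; case: ifP => // _; rewrite edge_of_sym.
  have := two r k s t sX tX st (E _ es) (E _ et); rewrite rd mxE => /esym/eqP.
  have oppE (x : 'F_2) : - x = x by apply/eqP; rewrite eq_sym -addr_eq0 F2_addxx.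
  by rewrite addr_eq0 oppE => /eqP ->.
rewrite [LHS]F2_bool [RHS]F2_bool; congr (nat_of_bool _)%:R.
by apply: (faces_connected C); exact: mem_tnth.
Qed.

(** Exactness at the edges gives E - (F - 1) = V - 1, and the face sizes add up to 2 E. *)
Theorem euler_formula : (2 * (size V + size X) = \sum_(s <- X) size s + 4)%N.
Proof.
rewrite double_count_edges.
have rk : \rank (kermx d1) = \rank d0.
  by apply: eqmx_rank; rewrite ker_d1; apply/sub_kermxP; exact: d0_d1.
have := rank_leq_row d1; move: rk; rewrite mxrank_ker rank_d0 rank_d1.
have := vertices_pos; have := X_nonempty; lia.
Qed.

End Euler.

(** * Counting incidences of vertices and faces *)

Section Counting.
Variables (T : eqType) (X : seq (seq T)) (X_map : polyhedral_map X) (L : seq nat).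
Hypothesis X_type : forall u, u \in vertices X ->
  exists2 c, face_cycle X u c & [seq size s | s <- c] = L.

(** Both sides sum [f] of the face size over the incident pairs of a vertex and a face. *)
Lemma incidence_count (f : nat -> nat) :
  \sum_(s <- X) size s * f (size s) = size (vertices X) * \sum_(p <- L) f p.
Proof.
have uX := Defs.map_uniq X_map.
transitivity (\sum_(u <- vertices X) \sum_(s <- X | u \in s) f (size s)).
  rewrite (exchange_big_dep xpredT) //=; rewrite big_seq [RHS]big_seq.
  apply: eq_bigr => s sX; rewrite -big_filter big_const_seq count_predT iter_addn addn0 mulnC.
  congr (_ * _); apply/esym/perm_size/uniq_perm; rewrite ?filter_uniq ?undup_uniq//.
    by have [] := map_polygon X_map sX.
  by move=> u; rewrite mem_filter andb_idr// => /(mem_vertices sX).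
rewrite (eq_big_seq (fun=> \sum_(p <- L) f p)).
  by rewrite big_const_seq count_predT iter_addn addn0 mulnC.
move=> u uV; have [c [uc mc _] <-] := X_type uV.
rewrite big_map -big_filter; apply: perm_big.
by rewrite perm_sym; apply: uniq_perm; rewrite ?filter_uniq.
Qed.

Lemma size_mem_type s : s \in X -> size s \in L.
Proof.
move=> sX; have [us s3] := map_polygon X_map sX.
have [u su] : exists u, u \in s by case: (s) s3 => // u s' _; exists u; exact: mem_head.
have [c [_ mc _] <-] := X_type (mem_vertices sX su).
by apply: map_f; rewrite mc mem_filter su.
Qed.

Hypothesis X_euler : 2 * (size (vertices X) + size X) = \sum_(s <- X) size s + 4.

Let V := size (vertices X).
Let P := \prod_(p <- L) p.
Let S := \sum_(p <- L) P %/ p.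

(** The relation V (1 - d/2 + sum of 1/p) = 2, multiplied by 2 P to stay in the natural numbers. *)
Lemma euler_vertex_type : V * (2 * P + 2 * S) = V * (size L * P) + 4 * P.
Proof.
have h1 := incidence_count (fun=> 1).
(* The weight 1/p, scaled by [P], counts every face once. *)
have h2 := incidence_count (fun p => P %/ p).
rewrite -/V -/S in h1 h2.
have F : \sum_(s <- X) size s * (P %/ size s) = size X * P.
  rewrite (eq_big_seq (fun=> P)); last first.
    move=> s /size_mem_type sL; rewrite mulnC divnK// /P.
    by rewrite (big_rem _ sL) /= dvdn_mulr.
  by rewrite big_const_seq count_predT iter_addn addn0 mulnC.
have D : \sum_(s <- X) size s = V * size L.
  rewrite -[RHS](_ : V * \sum_(p <- L) 1 = _); last by rewrite sum1_size.
  by rewrite -h1; apply: eq_bigr => s _; rewrite muln1.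
by rewrite mulnDr !(mulnCA V) -h2 F; have := X_euler; rewrite D -/V; nia.
Qed.

End Counting.

(** * Exploring a map from a corner *)

(* [sz x] is the size of the face at the corner [x], [rotate] turns around    *)
(* a vertex and [rotate \o reverse] around a face.                            *)
Record corner_system (D : Type) (rotate reverse : D -> D) (sz : D -> nat)
    (L : seq nat) : Prop := CornerSystem {
  cs_rotate : forall x, iter (size L) rotate x = x;
  cs_reverse : forall x, reverse (reverse x) = x;
  cs_face : forall x, iter (sz x) (fun y => rotate (reverse y)) x = x;
  cs_size : forall x, sz (rotate (reverse x)) = sz x;
  cs_type : forall x, exists k,
    let l := mkseq (fun i => sz (iter i rotate x)) (size L) in
    l = rot k L \/ l = rot k (rev L);
  cs_degree : 0 < size L
}.

Definition arrangements (L : seq nat) : seq (seq nat) :=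
  undup ([seq rot k L | k <- iota 0 (size L)]
         ++ [seq rot k (rev L) | k <- iota 0 (size L)]).

Lemma mem_arrangements (L : seq nat) k : 0 < size L ->
  rot k L \in arrangements L /\ rot k (rev L) \in arrangements L.
Proof.
move=> L0; have H (M : seq nat) : size M = size L -> exists2 j, j \in iota 0 (size L) & rot k M = rot j M.
  move=> zM; case: (ltnP k (size L)) => kL; first by exists k; rewrite ?mem_iota.
  by exists 0; rewrite ?mem_iota// rot_oversize ?zM// rot0.
rewrite /arrangements !mem_undup !mem_cat; split; apply/orP; [left|right].
  by have [j jL ->] := H L erefl; apply: map_f.
by have [j jL ->] := H (rev L) (size_rev L); apply: (map_f (fun j => rot j (rev L))).
Qed.

(* Partially explored maps. Vertices are numbered and [(k, j)] is the j-th    *)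
(* dart at the vertex k. A state lists the known face sizes at the corners    *)
(* (0 when unknown) and the known reversed darts.                             *)
Definition dart := (nat * nat)%type.
Definition state := (seq (seq nat) * seq (seq (option dart)))%type.

(** [Branch] splits on the face sizes around a vertex, [NewVertex] gives a name to the far end of a
    dart, [CloseFace] links the two free ends of a face all of whose other edges are known, and
    [SpreadSize] compares two corners of one face. *)
Inductive certificate (A : Type) :=
| Leaf of A
| Branch of nat & seq (certificate A)
| NewVertex of dart & certificate A
| CloseFace of dart & nat & nat & certificate A
| SpreadSize of dart & certificate A.

(** The generated principle has no induction hypothesis for the certificates listed in a
    [Branch]. *)
Lemma certificate_nested_ind (A : Type) (P : certificate A -> Prop) :
  (forall a, P (Leaf a)) ->
  (forall k cs, foldr (fun c Q => P c /\ Q) True cs -> P (Branch k cs)) ->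
  (forall x c, P c -> P (NewVertex x c)) ->
  (forall x a b c, P c -> P (CloseFace x a b c)) ->
  (forall x c, P c -> P (SpreadSize x c)) ->
  forall c, P c.
Proof.
move=> h1 h2 h3 h4 h5; fix IH 1; case=> [a|k cs|x c|x a b c|x c].
- exact: h1.
- apply: h2; move: cs; fix IHcs 1; case=> [|c cs]; first exact: I.
  by split; [apply: IH|apply: IHcs].
- exact/h3/IH.
- exact/h4/IH.
- exact/h5/IH.
Qed.

Section Checker.
Variables (L : seq nat) (A : Type) (final : A -> state -> bool).
Let d := size L.

Definition get_size (s : state) (x : dart) := nth 0 (nth [::] s.1 x.1) x.2.
Definition get_link (s : state) (x : dart) := nth None (nth [::] s.2 x.1) x.2.
Definition vertex_count (s : state) := size s.2.

Definition set_size (s : state) (x : dart) p : state :=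
  (set_nth [::] s.1 x.1 (set_nth 0 (nth [::] s.1 x.1) x.2 p), s.2).
Definition set_link (s : state) (x y : dart) : state :=
  (s.1, set_nth [::] s.2 x.1 (set_nth None (nth [::] s.2 x.1) x.2 (Some y))).

Definition turn (x : dart) : dart := (x.1, if x.2.+1 == d then 0 else x.2.+1).
Definition turn_back (x : dart) : dart := (x.1, if x.2 == 0 then d.-1 else x.2.-1).

Fixpoint forward (s : state) n (x : dart) : option dart :=
  if n is n'.+1 then
    if get_link s x is Some y then forward s n' (turn y) else None
  else Some x.

Fixpoint backward (s : state) n (x : dart) : option dart :=
  if n is n'.+1 then
    if get_link s (turn_back x) is Some y then backward s n' y else None
  else Some x.

Definition candidates (s : state) k : seq (seq nat) :=
  [seq l <- arrangements L |
    all2 (fun p q => (p == 0) || (p == q)) (nth [::] s.1 k) l].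

Definition set_sizes (s : state) k (l : seq nat) : state :=
  (set_nth [::] s.1 k l, s.2).

Definition new_vertex (s : state) (x : dart) : state :=
  set_link (rcons s.1 (nseq d 0), rcons s.2 (Some x :: nseq d.-1 None))
    x (vertex_count s, 0).

(** A contradictory branch is closed on the spot: no arrangement fits the known sizes, or two
    corners of one face have different sizes. All others must reach a leaf accepted by [final]. *)
Fixpoint check (s : state) (c : certificate A) {struct c} : bool :=
  match c with
  | Leaf a => final a s
  | Branch k cs => (k < vertex_count s) && (size (nth [::] s.1 k) == d) &&
      (fix checks ls cs {struct cs} := match cs, ls with
        | c :: cs', l :: ls' => check (set_sizes s k l) c && checks ls' cs'
        | _, _ => nilp ls
        end) (candidates s k) cs
  | NewVertex x c => (x.1 < vertex_count s) && (x.2 < d) && check (new_vertex s x) c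
  | CloseFace x a b c =>
      (get_size s x == (a + b).+1) &&
      if (forward s a x, backward s b x) is (Some e, Some f) then
        let g := turn_back f in
        [&& e.1 < vertex_count s, f.1 < vertex_count s & check (set_link (set_link s e g) g e) c]
      else false
  | SpreadSize x c =>
      if get_link s x is Some y then
        let p := get_size s x in let q := get_size s (turn y) in
        if p == 0 then (x.1 < vertex_count s) && check (set_size s x q) c
        else if q == 0 then (y.1 < vertex_count s) && check (set_size s (turn y) p) c
        else (p != q) || check s c
      else false
  end.

Variables (D : Type) (rotate reverse : D -> D) (sz : D -> nat).
Hypothesis D_sys : corner_system rotate reverse sz L.

Let step x := rotate (reverse x).

Definition dart_at (rho : nat -> D) (x : dart) := iter x.2 rotate (rho x.1).

(** [rho k] stands for dart 0 at vertex [k]. It need not be injective, so [NewVertex] is sound even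
    when the vertex reached is already known under another number. *)
Definition realizes (s : state) (rho : nat -> D) :=
  [/\ size s.1 = vertex_count s,
      forall x, get_size s x != 0 -> sz (dart_at rho x) = get_size s x &
      forall x y, get_link s x = Some y ->
        y.1 < vertex_count s /\ reverse (dart_at rho x) = dart_at rho y].

Lemma dart_at_turn rho x : dart_at rho (turn x) = rotate (dart_at rho x).
Proof.
rewrite /dart_at /turn /= -iterS; case: eqP => // ->.
by rewrite (cs_rotate D_sys).
Qed.

Lemma dart_at_turn_back rho x : rotate (dart_at rho (turn_back x)) = dart_at rho x.
Proof.
rewrite /dart_at /turn_back /= -iterS; case: eqP => [->|/eqP]; last by case: (x.2).
by rewrite prednK ?(cs_degree D_sys)// (cs_rotate D_sys).
Qed.

Lemma rotate_inj : injective rotate.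
Proof.
move=> x y /(congr1 (iter (size L).-1 rotate)); rewrite -!iterSr prednK ?(cs_degree D_sys)//.
by rewrite !(cs_rotate D_sys).
Qed.

Lemma sz_step n x : sz (iter n step x) = sz x.
Proof. by elim: n => //= n <-; rewrite (cs_size D_sys). Qed.

Section Realized.
Variables (s : state) (rho : nat -> D).
Hypothesis s_rho : realizes s rho.

Lemma forwardP n x y : forward s n x = Some y ->
  iter n step (dart_at rho x) = dart_at rho y.
Proof.
elim: n x => [|n IH] x /=; first by case=> ->.
case xz : (get_link s x) => [z|//] /IH <-.
by have [_ _ /(_ _ _ xz)[_ H]] := s_rho; rewrite dart_at_turn -iterS iterSr /step H.
Qed.

Lemma backwardP n x y : backward s n x = Some y ->
  iter n step (dart_at rho y) = dart_at rho x.
Proof.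
elim: n x => [|n IH] x /=; first by case=> ->.
case xz : (get_link s _) => [z|//] /IH ->.
have [_ _ /(_ _ _ xz)[_ H]] := s_rho.
by rewrite /step -H (cs_reverse D_sys) dart_at_turn_back.
Qed.

Lemma realizes_set_size x p : x.1 < vertex_count s -> (p != 0 -> sz (dart_at rho x) = p) ->
  realizes (set_size s x p) rho.
Proof.
move=> xs xp; have [s1 s2 s3] := s_rho; split=> //.
  by rewrite /= size_set_nth s1 /vertex_count; apply/maxn_idPr.
move=> [k j]; rewrite /get_size /= nth_set_nth /=.
case: (eqVneq k x.1) => [->|_]; last exact: (s2 (k, j)).
rewrite nth_set_nth /=; case: (eqVneq j x.2) => [->|_]; last exact: (s2 (x.1, j)).
by rewrite -surjective_pairing.
Qed.

Lemma realizes_set_sizes k l : k < vertex_count s ->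
  l = mkseq (fun i => sz (iter i rotate (rho k))) d ->
  realizes (set_sizes s k l) rho.
Proof.
move=> ks lE; have [s1 s2 s3] := s_rho; split=> //.
  by rewrite /= size_set_nth s1 /vertex_count; apply/maxn_idPr.
move=> [k' j]; rewrite /get_size /= nth_set_nth /=.
case: (eqVneq k' k) => [->|_]; last exact: (s2 (k', j)).
rewrite lE; case: (ltnP j d) => jd; first by rewrite nth_mkseq.
by rewrite nth_default ?size_mkseq.
Qed.

Lemma realizes_set_link x y : x.1 < vertex_count s -> y.1 < vertex_count s ->
  reverse (dart_at rho x) = dart_at rho y -> realizes (set_link s x y) rho.
Proof.
move=> xs ys xy; have [s1 s2 s3] := s_rho.
have oE : vertex_count (set_link s x y) = vertex_count s.
  by rewrite /vertex_count size_set_nth; apply/maxn_idPr.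
split=> //; first by rewrite oE.
move=> [k j] z; rewrite oE /get_link /= nth_set_nth /=.
case: (eqVneq k x.1) => [->|_]; last exact: (s3 (k, j)).
rewrite nth_set_nth /=; case: (eqVneq j x.2) => [->|_]; last exact: (s3 (x.1, j)).
by case=> <-; rewrite -surjective_pairing.
Qed.

End Realized.

Lemma eq_realizes s rho rho' : (forall k, k < vertex_count s -> rho k = rho' k) ->
  realizes s rho -> realizes s rho'.
Proof.
move=> E [s1 s2 s3]; split=> // [x xs|x y xy].
  rewrite /dart_at -E; first exact: s2.
  rewrite -s1 ltnNge; apply: contra xs => xs.
  by rewrite /get_size (nth_default _ xs) nth_nil.
have [ys H] := s3 _ _ xy; split=> //; rewrite /dart_at -!E//.
rewrite ltnNge; apply/negP => xs; move: xy.
by rewrite /get_link (nth_default _ xs) nth_nil.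
Qed.

Lemma realizes_new_vertex s rho x : realizes s rho -> x.1 < vertex_count s ->
  exists rho', realizes (new_vertex s x) rho'.
Proof.
move=> s_rho xs; pose rho' k := if k == vertex_count s then reverse (dart_at rho x) else rho k.
exists rho'.
have E k : k < vertex_count s -> rho k = rho' k by rewrite /rho'; case: eqP => // ->; rewrite ltnn.
have [s1 s2 s3] := eq_realizes E s_rho.
have oE : size (rcons s.2 (Some x :: nseq d.-1 None)) = (vertex_count s).+1 by rewrite size_rcons.
apply: realizes_set_link; rewrite /= ?/vertex_count /= ?oE ?(leqW xs)//; last first.
  by rewrite /dart_at /= /rho' eqxx; case: eqP xs => [->|//]; rewrite ltnn.
split; first by rewrite /vertex_count /= !size_rcons s1.
- move=> [k j]; rewrite /get_size /= nth_rcons s1; case: ltngtP => kN; first exact: (s2 (k, j)).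
    by rewrite nth_nil.
  by rewrite nth_nseq if_same.
- move=> [k j] y; rewrite /get_link /vertex_count oE /= nth_rcons -/(vertex_count s).
  case: ltngtP => kN; first by move=> /(s3 (k, j))[yN ?]; split=> //; exact: leqW.
    by rewrite nth_nil.
  case: j => [|j] /=; last by rewrite nth_nseq if_same.
  case=> <-; split; first exact: leqW.
  rewrite /dart_at /= kN /rho' eqxx (cs_reverse D_sys).
  by case: eqP xs => [->|//]; rewrite ltnn.
Qed.

Lemma candidatesP s rho k : realizes s rho -> size (nth [::] s.1 k) = d ->
  mkseq (fun i => sz (iter i rotate (rho k))) d \in candidates s k.
Proof.
move=> [s1 s2 s3] zk; set l := mkseq _ _; rewrite mem_filter; apply/andP; split.
  rewrite all2E size_mkseq zk eqxx /=; apply/(all_nthP (0, 0)) => i.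
  rewrite size_zip size_mkseq zk minnn => id.
  rewrite nth_zip ?size_mkseq//= nth_mkseq//.
  have := s2 (k, i); rewrite /get_size /=; case: eqP => //= _ /(_ isT) <-.
  by rewrite /dart_at.
have [j] := cs_type D_sys (rho k); rewrite -/d -/l.
have [h1 h2] := mem_arrangements j (cs_degree D_sys).
by case=> ->.
Qed.

(** Every step keeps the state realized, the actual sizes around a vertex select the branch to
    follow, and contradictory branches cannot be realized. *)
Lemma check_sound s c rho : realizes s rho -> check s c ->
  exists a s' rho', realizes s' rho' /\ final a s'.
Proof.
elim/certificate_nested_ind: c s rho => [a|k cs IH|x c IH|x a b c IH|x c IH] s rho s_rho /=.
- by exists a, s, rho.
- move=> /andP[/andP[ks /eqP zk]]; have := candidatesP s_rho zk.
  set l := mkseq _ _; elim: cs (candidates s k) IH => [|c cs IHcs'] [|l' ls] //= [IHc IHcs].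
  rewrite inE => /orP[/eqP <-|ll] /andP[h1 h2]; last exact: IHcs' IHcs ll h2.
  exact: IHc (realizes_set_sizes s_rho ks erefl) h1.
- move=> /andP[/andP[xs _]]; have [rho' r1] := realizes_new_vertex s_rho xs.
  by apply: (IH _ rho').
- move=> /andP[/eqP xsz].
  case ex : (forward s a x) => [e|//]; case fx : (backward s b x) => [f|//].
  move=> /and3P[es fs]; apply: (IH _ rho).
  have eE := forwardP s_rho ex; have fE := backwardP s_rho fx.
  have szf : sz (dart_at rho f) = (a + b).+1.
    by rewrite -(sz_step b) fE; case: s_rho => _ -> //; rewrite xsz.
  have : iter (a + b).+1 step (dart_at rho f) = dart_at rho f.
    by rewrite -szf; exact: (cs_face D_sys).
  rewrite iterS iterD.
  rewrite fE eE => stepef.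
  (* One more step from [e] closes the face at [f], and [rotate] is injective. *)
  have xg : reverse (dart_at rho e) = dart_at rho (turn_back f).
    by apply: rotate_inj; rewrite dart_at_turn_back.
  have oE y z : y.1 < vertex_count s -> vertex_count (set_link s y z) = vertex_count s.
    by move=> ys; rewrite /vertex_count size_set_nth; apply/maxn_idPr.
  apply: realizes_set_link; rewrite ?oE//; last by rewrite -xg (cs_reverse D_sys).
  exact: realizes_set_link.
- case xy : (get_link s x) => [y|//].
  have [_ s2 /(_ _ _ xy)[ys yE]] := s_rho.
  have szE : sz (dart_at rho (turn y)) = sz (dart_at rho x).
    by rewrite dart_at_turn -yE (cs_size D_sys).
  case: eqP => [x0 /andP[xs]|/eqP x0].
    apply: (IH _ rho); apply: realizes_set_size => // y0.
    by rewrite -szE s2.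
  case: eqP => [y0 /andP[_]|/eqP y0].
    by apply: (IH _ rho); apply: realizes_set_size => // _; rewrite szE s2.
  by rewrite -(s2 _ x0) -(s2 _ y0) szE eqxx; exact: (IH _ rho).
Qed.

End Checker.

(** * Recognizing a solid in an explored map *)

Definition label := (nat * nat)%type.

Section FinalCheck.
Variables (L : seq nat) (N : nat) (Ps : seq (seq (seq label))).

Let d := size L.

Fixpoint walk (s : state) n (x : dart) : option (seq nat) :=
  if n is n'.+1 then
    if get_link s x is Some y then omap (cons x.1) (walk s n' (turn L y)) else None
  else Some [::].

(** The head of [t] fixes the rotation; for the reversed polygon it has to come last before [rev],
    whence [k.+1]. *)
Definition same_polygonb (w t : seq label) : bool :=
  if t is u :: _ then
    let k := index u w in (t == rot k w) || (t == rev (rot k.+1 w))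
  else false.

Definition check_face (s : state) (ms : seq label) (x : dart) (t : seq label) :=
  let p := get_size s x in
  (p != 0) &&
  if walk s p x is Some ks then
    all (fun k => k < N) ks && same_polygonb [seq nth (0, 0) ms k | k <- ks] t
  else false.

(** [a] gives the position of the solid in [Ps] and the labels of the explored vertices. The tests
    are those needed by [isomorphic_realization]: all darts are linked, every face of the solid
    occurs at some corner, and every corner lies in a face of the solid. *)
Definition check_solid (a : nat * seq label) (s : state) : bool :=
  let P := nth [::] Ps a.1 in let ms := a.2 in
  [&& a.1 < size Ps, size ms == N, vertex_count s == N, uniq ms, all (mem ms) (flatten P),
      all (fun k => all (fun j => get_link s (k, j) != None) (iota 0 d)) (iota 0 N),
      all (fun t => if t is u :: _ then
             let k := index u ms in
             has (fun j => check_face s ms (k, j) t) (iota 0 d) else false) P &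
      all (fun k =>
             let Pk := [seq t <- P | nth (0, 0) ms k \in t] in
             all (fun j => has (check_face s ms (k, j)) Pk) (iota 0 d)) (iota 0 N)].

End FinalCheck.

(* An untrusted producer of certificates: only their replay by [check] enters *)
(* the proof.                                                                 *)
Section Search.
Variables (L : seq nat) (N : nat) (Ps : seq (seq (seq label))).
Let d := size L.

Definition step_in (P : seq (seq label)) (x : label * label) :=
  let t := nth [::] P (find (fun t => (x.1 \in t) && (next t x.1 == x.2)) P) in
  (x.2, next t x.2).

(** A vertex created by [NewVertex] has its dart 0 linked back to an earlier one; labels are
    propagated along these links. *)
Definition base_labels (P : seq (seq label)) (s : state) x :=
  [seq y.1 | y <- foldl (fun bs k =>
      if get_link s (k, 0) is Some y then
        rcons bs (let z := iter y.2 (fun z => step_in P (z.2, z.1)) (nth x bs y.1) in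
                  (z.2, z.1))
      else bs)
    [:: x] (iota 1 (vertex_count s).-1)].

(** Each directed edge of each solid, and of its mirror image, is tried as the position of dart 0 at
    vertex 0. *)
Definition find_labels (s : state) : nat * seq label :=
  let labels (st : nat * seq (seq label) * (label * label)) :=
    (st.1.1, base_labels st.1.2 s st.2) in
  let starts := flatten [seq
    let P := nth [::] Ps i in
    flatten [seq flatten [seq [seq (i, Q, (u, next t u)) | t <- Q & u \in t]
                         | Q <- [:: P; map rev P]]
            | u <- undup (flatten P)]
    | i <- iota 0 (size Ps)] in
  labels (nth (0, [::], ((0, 0), (0, 0))) starts
    (find (fun st => check_solid L N Ps (labels st) s) starts)).

Fixpoint forward_end (s : state) n a (x : dart) : nat * dart :=
  if n is n'.+1 then
    if get_link s x is Some y then forward_end s n' a.+1 (turn L y) else (a, x)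
  else (a, x).

Fixpoint backward_end (s : state) n a (x : dart) : nat * dart :=
  if n is n'.+1 then
    if get_link s (turn_back L x) is Some y then backward_end s n' a.+1 y else (a, x)
  else (a, x).

Definition darts (s : state) : seq dart :=
  [seq (k, j) | k <- iota 0 (vertex_count s), j <- iota 0 d].

Definition find_spread (s : state) : option dart :=
  ohead [seq x <- darts s |
    if get_link s x is Some y then get_size s x != get_size s (turn L y) else false].

Definition find_vertex (s : state) : option (nat * nat) :=
  foldl (fun best k =>
    if 0 \in nth [::] s.1 k then
      let m := size (candidates L s k) in
      if best is Some b then if m < b.2 then Some (k, m) else best else Some (k, m)
    else best) None (iota 0 (vertex_count s)).

(* Closing the open face with the fewest missing edges first avoids creating  *)
(* two vertices that would have to be identified later.                       *)
Definition find_face (s : state) : option (nat * (dart * (nat * dart) * (nat * dart))) :=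
  foldl (fun best x =>
    let p := get_size s x in
    let: (a, e) := forward_end s p 0 x in
    if a == p then best else
    let: (b, f) := backward_end s p 0 x in
    let m := p - (a + b).+1 in
    if best is Some (m', _) then if m < m' then Some (m, (x, (a, e), (b, f))) else best
    else Some (m, (x, (a, e), (b, f)))) None (darts s).

Fixpoint search fuel (s : state) : certificate (nat * seq label) :=
  if fuel is fuel'.+1 then
    let branch k :=
      Branch k [seq search fuel' (set_sizes s k l) | l <- candidates L s k] in
    if find_spread s is Some x then
      if get_link s x is Some y then
        let p := get_size s x in let q := get_size s (turn L y) in
        SpreadSize x (if p == 0 then search fuel' (set_size s x q)
                      else if q == 0 then search fuel' (set_size s (turn L y) p)
                      else Leaf (0, [::]))
      else Leaf (0, [::])
    else if find_vertex s is Some (k, m) then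
      if m <= 1 then branch k else
      if find_face s is Some (m, (x, (a, e), (b, f))) then
        if m == 0 then
          let g := turn_back L f in
          CloseFace x a b (search fuel' (set_link (set_link s e g) g e))
        else NewVertex e (search fuel' (new_vertex L s e))
      else branch k
    else if find_face s is Some (m, (x, (a, e), (b, f))) then
      if m == 0 then
        let g := turn_back L f in
        CloseFace x a b (search fuel' (set_link (set_link s e g) g e))
      else NewVertex e (search fuel' (new_vertex L s e))
    else Leaf (find_labels s)
  else Leaf (0, [::]).

End Search.

(** * Starting states and the sixteen exceptional types *)

Definition start_state (L l : seq nat) : state := ([:: l], [:: nseq (size L) None]).

Definition start_types (L : seq nat) : seq (seq nat) :=
  if rev L \in [seq rot k L | k <- iota 0 (size L)] then [:: L] else [:: L; rev L].

Section StartTypes.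
Variables (D : Type) (rotate reverse : D -> D) (sz : D -> nat) (L : seq nat).
Hypothesis D_sys : corner_system rotate reverse sz L.

Lemma start_typesP (x : D) : exists y,
  mkseq (fun i => sz (iter i rotate y)) (size L) \in start_types L.
Proof.
have d0 := cs_degree D_sys.
pose l y := mkseq (fun i => sz (iter i rotate y)) (size L).
have sl y : size (l y) = size L by rewrite size_mkseq.
have lrot k y : k <= size L -> l (iter k rotate y) = rot k (l y).
  move=> kL; apply: (@eq_from_nth _ 0); first by rewrite size_rot !sl.
  move=> i; rewrite sl => iL; rewrite nth_mkseq// -iterD /rot nth_cat size_drop sl.
  case: ltnP => ik.
    rewrite nth_drop nth_mkseq; last lia.
    by rewrite addnC.
  rewrite nth_take; last lia.
  rewrite nth_mkseq; last lia.
  have -> : i + k = i - (size L - k) + size L by lia.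
  by rewrite iterD (cs_rotate D_sys).
have unrot M y k : size M = size L -> l y = rot k M -> exists y', l y' = M.
  move=> sM ly; have [kL|kL] := leqP k (size L); last first.
    by exists y; rewrite ly rot_oversize// sM ltnW.
  exists (iter (size L - k) rotate y); rewrite lrot ?leq_subr// ly.
  by rewrite -sM -(size_rot k) -/(rotr k _) rotK.
have [k [lx|lx]] := cs_type D_sys x; rewrite -/(l x) in lx.
  have [y ly] := unrot _ _ _ erefl lx; exists y.
  by rewrite -/(l y) ly /start_types; case: ifP; rewrite !inE eqxx.
have [y ly] := unrot _ _ _ (size_rev L) lx; rewrite /start_types.
case: ifP => [/mapP[j _ Lj]|_]; last first.
  by exists y; rewrite -/(l y) ly !inE eqxx orbT.
rewrite Lj in ly; have [y' ly'] := unrot _ _ _ erefl ly.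
by exists y'; rewrite -/(l y') ly' inE.
Qed.

End StartTypes.

Definition certificates L N Ps : seq (certificate (nat * seq label)) :=
  [seq search L N Ps 2000 (start_state L l) | l <- start_types L].

Definition check_all L N Ps cs :=
  all2 (fun l c => check L (check_solid L N Ps) (start_state L l) c) (start_types L) cs.

Definition plain (P : seq (seq nat)) : seq (seq label) := map (map (fun u => (u, 0))) P.

(** This and the next three are [truncate], [rectify], [expand] and [snub] before the final
    renaming, which [isomorphic_relabel_vertices] puts back. *)
Definition truncated_faces (X : seq (seq nat)) : seq (seq label) :=
  [seq flatten [seq [:: (u, next s u); (next s u, u)] | u <- s] | s <- X]
  ++ [seq [seq (u, v) | v <- neighbours X u] | u <- vertices X].

Definition rectified_faces (X : seq (seq nat)) : seq (seq label) :=
  [seq [seq midpoint u (next s u) | u <- s] | s <- X]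
  ++ [seq [seq midpoint u v | v <- neighbours X u] | u <- vertices X].

Definition expanded_faces (X : seq (seq nat)) : seq (seq label) :=
  corner_faces X ++ [seq edge_square X e | e <- Defs.darts X & e.1 < e.2].

Definition snub_faces (X : seq (seq nat)) : seq (seq label) :=
  corner_faces X ++ [seq edge_triangle X e | e <- Defs.darts X].

(** Vertex-type, number of vertices forced by Euler's formula, and the solids with this type. The
    cube and the octahedron are absent: they are [prism 4] and [antiprism 3]. *)
Definition exceptional_types : seq (seq nat * nat * seq (seq (seq label))) := [::
  ([:: 3;3;3], 4, [:: plain tetrahedron]);
  ([:: 5;5;5], 20, [:: plain dodecahedron]);
  ([:: 3;3;3;3;3], 12, [:: plain icosahedron]);
  ([:: 3;6;6], 12, [:: truncated_faces tetrahedron]);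
  ([:: 3;8;8], 24, [:: truncated_faces cube]);
  ([:: 3;10;10], 60, [:: truncated_faces dodecahedron]);
  ([:: 4;6;6], 24, [:: truncated_faces octahedron]);
  ([:: 5;6;6], 60, [:: truncated_faces icosahedron]);
  ([:: 4;6;8], 48, [:: truncated_faces cuboctahedron]);
  ([:: 4;6;10], 120, [:: truncated_faces icosidodecahedron]);
  ([:: 3;4;3;4], 12, [:: rectified_faces cube]);
  ([:: 3;5;3;5], 30, [:: rectified_faces dodecahedron]);
  ([:: 3;4;4;4], 24, [:: expanded_faces cube; plain pseudorhombicuboctahedron]);
  ([:: 3;4;5;4], 60, [:: expanded_faces dodecahedron]);
  ([:: 3;3;3;3;4], 24, [:: snub_faces cube]);
  ([:: 3;3;3;3;5], 60, [:: snub_faces dodecahedron])].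

(** The search is evaluated here once and for all; [certs_ok] only replays its result. *)
Definition certs := Eval vm_compute in
  [seq certificates z.1.1 z.1.2 z.2 | z <- exceptional_types].
Lemma certs_ok : all2 (fun z cs => check_all z.1.1 z.1.2 z.2 cs) exceptional_types certs.
Proof. by vm_compute. Qed.

(** * From explored states to isomorphisms *)

Section SamePolygon.
Implicit Types T U V : eqType.

Lemma same_polygon_mem T (s t : seq T) : same_polygon s t -> s =i t.
Proof. by move=> [k []] -> x; rewrite ?mem_rev mem_rot. Qed.

Lemma rot_rot_exists T (s : seq T) j k : exists l, rot j (rot k s) = rot l s.
Proof.
have [kl|kl] := leqP k (size s); last by exists j; rewrite (rot_oversize (ltnW kl)).
have [jl|jl] := leqP j (size s).
  by rewrite rot_add_mod//; case: ifP => _; eexists.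
by exists k; rewrite rot_oversize// size_rot ltnW.
Qed.

Lemma rot_rev_exists T (s : seq T) j : exists l, rot j (rev s) = rev (rot l s).
Proof. by exists (size s - j); rewrite -rev_rotr. Qed.

Lemma same_polygon_trans T (s t r : seq T) :
  same_polygon s t -> same_polygon t r -> same_polygon s r.
Proof.
move=> [k stk] [j trj].
case: stk trj => -> [] ->.
- by have [l ->] := rot_rot_exists s j k; exists l; left.
- by have [l ->] := rot_rot_exists s j k; exists l; right.
- have [l ->] := rot_rev_exists (rot k s) j; have [m ->] := rot_rot_exists s l k.
  by exists m; right.
- have [l ->] := rot_rev_exists (rot k s) j; have [m ->] := rot_rot_exists s l k.
  by exists m; left; rewrite revK.
Qed.

Lemma same_polygon_map T U (f : T -> U) (s t : seq T) :
  same_polygon s t -> same_polygon (map f s) (map f t).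
Proof.
by move=> [k []] ->; exists k; [left|right]; rewrite ?map_rev map_rot.
Qed.

Lemma isomorphic_relabel T U V (X : seq (seq T)) (Y : seq (seq U)) (f : U -> V) :
  isomorphic X Y -> {in vertices Y &, injective f} ->
  isomorphic X (map (map f) Y).
Proof.
move=> [h [hi hv hf hf']] fi; exists (f \o h).
have hY u : u \in vertices X -> h u \in vertices Y.
  by move=> uX; rewrite -hv; exact: map_f.
split.
- by move=> u v uX vX /= /fi; rewrite !hY// => /(_ isT isT) /hi; apply.
- move=> w; apply/mapP/idP => [[u uX ->]|].
    have /verticesP[t tY ht] := hY _ uX.
    by apply/verticesP; exists (map f t); exact: map_f.
  move=> /verticesP[_ /mapP[t tY ->] /mapP[x xt ->]].
  have : x \in vertices Y by apply/verticesP; exists t.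
  by rewrite -hv => /mapP[u uX ->]; exists u.
- move=> s /hf[t tY st]; exists (map f t); first exact: map_f.
  by rewrite map_comp; exact: same_polygon_map.
- move=> _ /mapP[t tY ->]; have [s sX st] := hf' _ tY; exists s => //.
  by rewrite map_comp; exact: same_polygon_map.
Qed.

End SamePolygon.

Section Realization.
Variables (T : eqType) (X : seq (seq T)) (X_map : polyhedral_map X) (L : seq nat).
Hypothesis X_type : forall u, u \in vertices X ->
  exists2 c, face_cycle X u c & [seq size s | s <- c] = L.
Hypothesis X_connected : forall C : T -> bool,
  (forall s u v, s \in X -> edge_of s u v -> C u = C v) ->
  {in vertices X &, forall u v, C u = C v}.

Local Notation rotate := (flag_rotate X_map).
Local Notation reverse := (flag_reverse X_map).

Definition flag_polygon (x : flag X) :=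
  mkseq (fun i => flag_vertex (iter i (flag_step X_map) x)) (flag_size x).

Variables (U : eqType) (P : seq (seq U)) (u0 : U) (ms : seq U) (rho : nat -> flag X).
Hypothesis ms_uniq : uniq ms.
Hypothesis ms_size : size ms = size (vertices X).
Hypothesis ms_pos : 0 < size ms.
Hypothesis P_ms : {subset flatten P <= ms}.
Hypothesis rho_closed : forall k i, k < size ms -> i < size L ->
  exists k' i', k' < size ms /\
    reverse (iter i rotate (rho k)) = iter i' rotate (rho k').

(* The polygon [t] of [P] is the face of [X] at the flag [x]. *)
Definition realized_face (x : flag X) (t : seq U) := exists ks : seq nat,
  [/\ all (fun k => k < size ms) ks,
      flag_polygon x = [seq flag_vertex (rho k) | k <- ks] &
      same_polygon [seq nth u0 ms k | k <- ks] t].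

Lemma realized_face_step x t : realized_face x t -> realized_face (flag_step X_map x) t.
Proof.
move=> [ks [ksN xks kst]]; exists (rot 1 ks); split.
- by apply/allP => k; rewrite mem_rot; exact: (allP ksN).
- rewrite map_rot -xks /flag_polygon flag_size_step.
  have := flag_step_size X_map x; have : 0 < flag_size x.
    by have [/(face_size X_map) sX _] := flagP x; exact: leq_trans sX.
  case: (flag_size x) => // m _ Hm.
  have -> : mkseq (fun i => flag_vertex (iter i (flag_step X_map) x)) m.+1 =
      flag_vertex x :: mkseq (fun i => flag_vertex (iter i.+1 (flag_step X_map) x)) m.
    rewrite /mkseq /= -[1]/(1 + 0) iotaDl -map_comp; congr cons.
  rewrite mkseqS rot1_cons -iterSr Hm; congr rcons.
  by apply: eq_mkseq => i; rewrite -iterSr.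
- rewrite map_rot; apply: same_polygon_trans kst.
  by exists (size [seq nth u0 ms k | k <- ks] - 1); left; rewrite -[LHS](rotK 1) /rotr size_rot.
Qed.

Lemma realized_face_iter x t i : realized_face x t ->
  realized_face (iter i (flag_step X_map) x) t.
Proof. by move=> xt; elim: i => //= i; exact: realized_face_step. Qed.

Hypothesis P_realized : forall t, t \in P -> exists x, realized_face x t.
Hypothesis X_realized : forall k i, k < size ms -> i < size L ->
  exists2 t, t \in P & realized_face (iter i rotate (rho k)) t.

Let g k := flag_vertex (rho k).

Lemma flag_vertexX (x : flag X) : flag_vertex x \in vertices X.
Proof. by have [sX /and3P[su _ _]] := flagP x; exact: mem_vertices su. Qed.

(** The vertices reached are closed under adjacency, as every edge at the vertex of [rho k] belongs
    to a rotation of [rho k]; connectedness does the rest. *)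
Lemma realization_surjective : {subset vertices X <= map g (iota 0 (size ms))}.
Proof.
pose C u := u \in map g (iota 0 (size ms)).
have imp s u v : s \in X -> edge_of s u v -> C u -> C v.
  move=> sX e /mapP[k]; rewrite mem_iota => /= kN uE.
  rewrite uE in e; have [i id <-] := flag_neighbours X_map X_type sX e.
  have [k' [i' [k'N ->]]] := rho_closed kN id.
  by rewrite flag_vertex_rotate; apply: map_f; rewrite mem_iota.
have Ceq s u v : s \in X -> edge_of s u v -> C u = C v.
  move=> sX e; apply/idP/idP; first exact: imp e.
  by apply: imp sX _; rewrite edge_of_sym.
move=> u uX; rewrite -/(C u) (X_connected Ceq uX (flag_vertexX (rho 0))).
by apply/mapP; exists 0; rewrite ?mem_iota.
Qed.

(** A surjection between finite sets of the same size is injective. *)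
Lemma realization_uniq : uniq (map g (iota 0 (size ms))).
Proof.
apply: (leq_size_uniq (undup_uniq _) realization_surjective).
by rewrite size_map size_iota ms_size.
Qed.

(** The isomorphism sends the vertex of [rho k] to the k-th label; a face of [X] is matched through
    any of its flags, since walking around it lists its vertices. *)
Lemma isomorphic_realization : isomorphic X P.
Proof.
pose G := map g (iota 0 (size ms)).
pose h u := nth u0 ms (index u G).
have sG : size G = size ms by rewrite size_map size_iota.
have nG k : k < size ms -> nth (g 0) G k = g k.
  by move=> kN; rewrite (nth_map 0) ?size_iota// nth_iota.
have hg k : k < size ms -> h (g k) = nth u0 ms k.
  by move=> kN; rewrite /h -(nG k)// index_uniq ?sG ?realization_uniq.
have gX u : u \in vertices X -> exists2 k, k < size ms & u = g k.
  by move/realization_surjective => /mapP[k]; rewrite mem_iota; exists k.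
have hpoly x t : realized_face x t -> same_polygon (map h (flag_face x)) t.
  move=> [ks [/allP ksN pE kst]].
  apply: same_polygon_trans kst.
  have -> : [seq nth u0 ms k | k <- ks] = map h (flag_polygon x).
    by rewrite pE -map_comp; apply/eq_in_map => k /ksN kN /=; rewrite hg.
  by apply: same_polygon_map; case: (flag_walk X_map x).
exists h; split.
- move=> u v /gX[k kN ->] /gX[k' k'N ->]; rewrite !hg// => /eqP.
  by rewrite nth_uniq// => /eqP ->.
- move=> w; apply/mapP/idP => [[u /gX[k kN ->] ->]|/verticesP[t tP wt]].
    have d0 : 0 < size L by exact: leq_trans (flag_degree X_map X_type (rho k)).
    have [t tP /hpoly /same_polygon_mem tE] := X_realized kN d0.
    apply/verticesP; exists t => //; rewrite -tE; apply: map_f.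
    by have [_ /and3P[]] := flagP (rho k).
  have : w \in ms by apply: P_ms; apply/flattenP; exists t.
  move=> /(nthP u0)[k kN <-]; exists (g k); rewrite ?hg//.
  exact: flag_vertexX.
- move=> s sX.
  have s0 : 0 < size s by exact: leq_trans (face_size X_map sX).
  case: s sX s0 => // u s sX _.
  have us : u \in u :: s by rewrite mem_head.
  have [k kN uE] := gX _ (mem_vertices sX us).
  have us' : g k \in u :: s by rewrite -uE.
  have [i id fE] := flag_faces X_map X_type sX us'.
  have [t tP /hpoly] := X_realized kN id; rewrite fE.
  by exists t.
- move=> t /P_realized[x /hpoly H]; exists (flag_face x) => //.
  by have [] := flagP x.
Qed.

End Realization.

Section SolidRealization.
Variables (T : eqType) (X : seq (seq T)) (X_map : polyhedral_map X) (L : seq nat).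
Hypothesis X_type : forall u, u \in vertices X ->
  exists2 c, face_cycle X u c & [seq size s | s <- c] = L.
Hypothesis X_connected : forall C : T -> bool,
  (forall s u v, s \in X -> edge_of s u v -> C u = C v) ->
  {in vertices X &, forall u v, C u = C v}.

Local Notation rotate := (flag_rotate X_map).
Local Notation reverse := (flag_reverse X_map).

Lemma flag_corner_system (x : flag X) :
  corner_system rotate reverse (@flag_size _ X) L.
Proof.
split.
- exact: flag_rotate_size.
- exact: flag_reverseK.
- exact: flag_step_size.
- exact: flag_size_step.
- exact: flag_around_type.
- exact: leq_trans (flag_degree X_map X_type x).
Qed.

Lemma walkP s (rho : nat -> flag X) n x ks : corner_system rotate reverse (@flag_size _ X) L ->
  realizes rotate reverse (@flag_size _ X) s rho -> walk L s n x = Some ks ->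
  mkseq (fun i => flag_vertex (iter i (flag_step X_map) (dart_at rotate rho x))) n =
  [seq flag_vertex (rho k) | k <- ks].
Proof.
move=> D_sys [_ _ s3]; elim: n x ks => [|n IH] x ks /=; first by case=> <-.
case xy : (get_link s x) => [y|//]; have [_ yE] := s3 _ _ xy.
case w : (walk _ _ _ _) => [ks'|//] [<-] /=.
rewrite -(IH _ _ w) /mkseq /= -[1]/(1 + 0) iotaDl -map_comp; congr cons.
  by rewrite /dart_at flag_vertex_rotate.
apply: eq_map => i /=.
rewrite -iterS iterSr; congr (flag_vertex (iter i _ _)).
by rewrite (dart_at_turn D_sys) -yE.
Qed.

Lemma same_polygonbP (w t : seq label) : same_polygonb w t -> same_polygon w t.
Proof.
case: t => // u t /orP[] /eqP ->; first by exists (index u w); left.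
by exists (index u w).+1; right.
Qed.

Lemma check_solid_sound N Ps a s (rho : nat -> flag X) :
  N = size (vertices X) ->
  realizes rotate reverse (@flag_size _ X) s rho -> check_solid L N Ps a s ->
  exists2 P, P \in Ps & isomorphic X P.
Proof.
move=> NE s_rho /and5P[aP /eqP msN /eqP sN ums /and4P[/allP Pms /allP linked /allP Pr /allP Xr]].
have D_sys := flag_corner_system (rho 0).
set P := nth [::] Ps a.1 in Pms Pr Xr; set ms := a.2 in msN ums Pms Pr Xr.
exists P; first exact: mem_nth.
have face x t : check_face L N s ms x t ->
    realized_face X_map (0, 0) ms rho (dart_at rotate rho x) t.
  move=> /andP[x0]; case w : (walk _ _ _ _) => [ks|//] /andP[ksN /same_polygonbP st].
  exists ks; split=> //; first by rewrite msN.
  by rewrite -(walkP D_sys s_rho w); case: s_rho => _ /(_ _ x0) <-.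
apply: (@isomorphic_realization _ _ X_map _ X_type X_connected _ _ (0, 0) ms rho) => //.
- by rewrite msN.
- rewrite msN NE; have [sX /and3P[su _ _]] := flagP (rho 0).
  by have := mem_vertices sX su; case: (vertices X).
- move=> k i kN iL.
  have := linked k; rewrite mem_iota add0n -msN kN => /(_ isT) /allP /(_ i).
  rewrite mem_iota add0n iL => /(_ isT); case ki : (get_link s (k, i)) => [y|//] _.
  have [_ _ /(_ _ _ ki)[ys yE]] := s_rho.
  by exists y.1, y.2; rewrite msN -sN.
- move=> [|u t] tP; have := Pr _ tP => // /hasP[j _ H].
  by exists (dart_at rotate rho (index u ms, j)); exact: face H.
- move=> k i kN iL.
  have := Xr k; rewrite mem_iota add0n -msN kN => /(_ isT) /allP /(_ i).
  rewrite mem_iota add0n iL => /(_ isT) /hasP[t]; rewrite mem_filter => /andP[_ tP] H.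
  by exists t => //; apply: (face (k, i)); rewrite -msN.
Qed.

Lemma check_all_sound N Ps cs (x : flag X) : N = size (vertices X) ->
  check_all L N Ps cs -> exists2 P, P \in Ps & isomorphic X P.
Proof.
move=> NE; have D_sys := flag_corner_system x; have [y yl] := start_typesP D_sys x.
rewrite /check_all; elim: (start_types L) cs yl => [|l ls IH] [|c cs] //=.
rewrite inE => /orP[/eqP yl|yl] /andP[h1 h2]; last exact: IH h2.
have d0 := cs_degree D_sys.
have l_rho : realizes rotate reverse (@flag_size _ X) (start_state L l) (fun _ => y).
  split=> //= [[[|k] j]|[[|k] j] z]; rewrite /get_size /get_link /=.
  - rewrite -yl => jl.
    have jL : j < size L by rewrite ltnNge; apply: contra jl => jl; rewrite nth_default ?size_mkseq.
    by rewrite nth_mkseq.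
  - by rewrite !nth_nil.
  - by rewrite nth_nseq if_same.
  - by rewrite !nth_nil.
have [a [s' [rho' [r' f']]]] := check_sound D_sys l_rho h1.
exact: check_solid_sound NE r' f'.
Qed.

Lemma exceptional_sound N Ps (x : flag X) : N = size (vertices X) ->
  (L, N, Ps) \in exceptional_types -> exists2 P, P \in Ps & isomorphic X P.
Proof.
move=> NE; have := certs_ok.
elim: exceptional_types certs => [|[[L' N'] Ps'] zs IH] [|cs css] //= /andP[h1 h2].
rewrite inE => /orP[/eqP[E1 E2 E3]|]; last exact: IH h2.
by move: h1; rewrite -E1 -E2 -E3; exact: check_all_sound.
Qed.

End SolidRealization.

(** * Vertex-types *)

(* Exactly one of the two corners next to a p-gonal corner is q-gonal, so     *)
(* that q-gonal and other faces alternate around the p-gon.                   *)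
Definition unbalanced (L : seq nat) (p q : nat) : bool :=
  odd p && all (fun l => (head 0 l == p) ==> ((nth 0 l 1 == q) != (last 0 l == q)))
    ([seq rot k L | k <- iota 0 (size L)] ++ [seq rot k (rev L) | k <- iota 0 (size L)]).

Section Parity.
Variables (D : Type) (rotate reverse : D -> D) (sz : D -> nat) (L : seq nat).
Hypothesis D_sys : corner_system rotate reverse sz L.
Hypothesis L_gt1 : 1 < size L.

Let l y := mkseq (fun i => sz (iter i rotate y)) (size L).

Lemma corner_type_mem y :
  l y \in [seq rot k L | k <- iota 0 (size L)] ++ [seq rot k (rev L) | k <- iota 0 (size L)].
Proof.
have [k] := cs_type D_sys y; rewrite -/(l y).
have [h1 h2] := mem_arrangements k (cs_degree D_sys).
by rewrite /arrangements !mem_undup in h1 h2 => -[] ->.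
Qed.

Lemma exists_corner (x : D) p : p \in L -> exists y, sz y = p.
Proof.
move=> pL; have : p \in l x.
  by have [k] := cs_type D_sys x; rewrite -/(l x) => -[] ->; rewrite mem_rot ?mem_rev.
by case/mapP => i _ ->; exists (iter i rotate x).
Qed.

(** Whether the face across a side of the p-gon is a q-gon alternates from one side to the next,
    which is impossible around an odd number of sides. *)
Lemma unbalanced_false (x : D) p q : p \in L -> unbalanced L p q -> False.
Proof.
move=> /(exists_corner x)[y yp] /andP[op /allP H].
pose step z := rotate (reverse z).
have szs i : sz (iter i step y) = p by elim: i => //= i <-; rewrite (cs_size D_sys).
have alt i : (sz (rotate (iter i.+1 step y)) == q) = ~~ (sz (rotate (iter i step y)) == q).
  have := H _ (corner_type_mem (iter i.+1 step y)).
  have d0 := ltnW L_gt1.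
  rewrite -nth0 -nth_last /l !nth_mkseq ?size_mkseq ?prednK//=.
  rewrite -/(iter i.+1 step y) szs eqxx /=.
  (* Turning back at a corner enters the face across the preceding side. *)
  have -> : sz (iter (size L).-1 rotate (iter i.+1 step y)) = sz (rotate (iter i step y)).
    rewrite iterS -iterSr prednK// (cs_rotate D_sys) -(cs_size D_sys) (cs_reverse D_sys).
    by [].
  by case: (_ == q) (_ == q) => -[].
have par i : (sz (rotate (iter i step y)) == q) = odd i (+) (sz (rotate y) == q).
  by elim: i => // i IH; rewrite alt IH /= addNb.
have := par p; have := cs_face D_sys y; rewrite yp => ->.
by rewrite op; case: (_ == q).
Qed.

End Parity.

Definition listed_type (l : seq nat) :=
  (l \in [seq z.1.1 | z <- exceptional_types]) \/
  (exists2 n, 3 <= n & l = [:: n; 4; 4] \/ l = [:: n; 3; 3; 3]).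

(* A literal, so that computing with it does not evaluate the solids. *)
Definition exceptional_list : seq (seq nat) := Eval vm_compute in
  [seq z.1.1 | z <- exceptional_types].

(** A test by computation: the type is listed up to rotation and reversal, or parity excludes it. *)
Definition admissible (L : seq nat) :=
  has (fun l => (l \in exceptional_list) ||
      ((3 <= head 0 l) && (behead l \in [:: [:: 4; 4]; [:: 3; 3; 3]])))
    (arrangements L) ||
  has (fun p => has (unbalanced L p) L) L.

Lemma admissible_listed L : admissible L ->
  (forall p q, p \in L -> ~~ unbalanced L p q) ->
  exists2 l, l \in arrangements L & listed_type l.
Proof.
move=> /orP[/hasP[l lL le]|/hasP[p pL /hasP[q _ u]]] H; last by have := H p q pL; rewrite u.
exists l => //; case/orP: le => [|/andP[]]; first by left.
case: (l) => // n l' n3; rewrite !inE /= => lE; right; exists n => //.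
by case/orP: lE => /eqP ->; [left|right].
Qed.

(** The inequality says that 1/a + 1/b + 1/c > 1/2, so a <= 5. If a = 3, parity around the triangle
    forces b = c, and then c < 12. If a = b = 4, the type is that of a prism. Otherwise b < 8 and c
    < 20 leave a finite check. *)
Lemma listed_type3 a b c : 3 <= a -> a <= b -> b <= c ->
  a * b * c < 2 * (a * b + b * c + c * a) ->
  (forall p q, p \in [:: a; b; c] -> ~~ unbalanced [:: a; b; c] p q) ->
  exists2 l, l \in arrangements [:: a; b; c] & listed_type l.
Proof.
move=> a3 ab bc cond H.
have a5 : a <= 5 by nia.
have [a3'|a4] := eqVneq a 3.
  have bE : b = c.
    apply/eqP/negPn/negP => nbc; rewrite a3' in H.
    have [b3|b3] := eqVneq b 3.
      have := H 3 3 (mem_head _ _); rewrite b3 in nbc *.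
      by rewrite /unbalanced /= -!(eq_sym 3) (negbTE nbc).
    have := H 3 b (mem_head _ _).
    have cb : (c == b) = false by rewrite eq_sym (negbTE nbc).
    have c3 : (c == 3) = false by apply/eqP; lia.
    by rewrite /unbalanced /= !eqxx (negbTE b3) c3 cb.
  have c12 : c < 12 by nia.
  have c3 : 3 <= c by lia.
  apply: admissible_listed H; rewrite a3' bE.
  have /allP : all (fun n => admissible [:: 3; n; n]) (iota 3 9) by vm_compute.
  by apply; rewrite mem_iota; lia.
have {}a4 : 4 <= a by rewrite ltn_neqAle eq_sym a4.
have [b4|b5] := leqP b 4.
  have -> : a = 4 by lia.
  have -> : b = 4 by lia.
  exists [:: c; 4; 4]; last by right; exists c; [lia|left].
  by have [+ _] := @mem_arrangements [:: 4; 4; c] 2 isT.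
have c20 : c < 20 by nia.
have b8 : b < 8 by nia.
apply: admissible_listed H.
have /allP : all (fun x => all (fun y => all (fun z =>
    (x * y * z < 2 * (x * y + y * z + z * x)) ==> admissible [:: x; y; z])
  (iota 5 15)) (iota 5 3)) (iota 4 2) by vm_compute.
move=> /(_ a); rewrite mem_iota => /(_ ltac:(lia)) /allP /(_ b).
rewrite mem_iota => /(_ ltac:(lia)) /allP /(_ c).
rewrite mem_iota cond => /(_ ltac:(lia)).
by [].
Qed.

(** The reciprocals add up to more than 1, so a = 3. If one of c, e is at least 12, the other two
    sizes have reciprocals adding up to more than 7/12 = 1/3 + 1/4 and are both 3, the antiprism
    type. The remaining sizes are below 12 and are checked by computation. *)
Lemma listed_type4 a b c e : 3 <= a -> a <= b -> a <= c -> a <= e -> b <= e ->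
  a * b * c * e < b * c * e + a * c * e + a * b * e + a * b * c ->
  (forall p q, p \in [:: a; b; c; e] -> ~~ unbalanced [:: a; b; c; e] p q) ->
  exists2 l, l \in arrangements [:: a; b; c; e] & listed_type l.
Proof.
move=> a3 ab ac ae be cond H.
have aE : a = 3.
  have [|a4] := leqP a 3; first lia.
  have := leq_mul a4 (leqnn (b * c * e)); have b4 := leq_trans a4 ab.
  have := leq_mul b4 (leqnn (a * c * e)); have c4 := leq_trans a4 ac.
  have := leq_mul c4 (leqnn (a * b * e)); have e4 := leq_trans a4 ae.
  have := leq_mul e4 (leqnn (a * b * c)); lia.
move: H cond ab ac ae; rewrite aE => H cond b3 c3 e3.
have bcb := leq_mul b3 (leqnn (c * e)).
have bcc := leq_mul c3 (leqnn (b * e)).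
have bce := leq_mul e3 (leqnn (b * c)).
have [c12|c12] := leqP 12 c.
  have := leq_mul c12 (leqnn (b * e)) => hc.
  have bE : b = 3.
    have [|b4] := leqP b 3; first lia.
    by have := leq_mul b4 (leqnn (c * e)); lia.
  have eE : e = 3.
    have [|e4] := leqP e 3; first lia.
    by have := leq_mul e4 (leqnn (b * c)); lia.
  rewrite bE eE; exists [:: c; 3; 3; 3]; last by right; exists c => //; right.
  by have [+ _] := @mem_arrangements [:: 3; 3; c; 3] 2 isT.
have [e12|e12] := leqP 12 e.
  have := leq_mul e12 (leqnn (b * c)) => he.
  have bE : b = 3.
    have [|b4] := leqP b 3; first lia.
    by have := leq_mul b4 (leqnn (c * e)); lia.
  have cE : c = 3.
    have [|c4] := leqP c 3; first lia.
    by have := leq_mul c4 (leqnn (b * e)); lia.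
  rewrite bE cE; exists [:: e; 3; 3; 3]; last by right; exists e => //; right.
  by have [+ _] := @mem_arrangements [:: 3; 3; 3; e] 3 isT.
have [/andP[/eqP bE /eqP cE]|nbc] := boolP ((b == 3) && (c == 3)).
  rewrite bE cE; exists [:: e; 3; 3; 3]; last by right; exists e => //; right.
  by have [+ _] := @mem_arrangements [:: 3; 3; 3; e] 3 isT.
have [/andP[/eqP bE /eqP eE]|nbe] := boolP ((b == 3) && (e == 3)).
  rewrite bE eE; exists [:: c; 3; 3; 3]; last by right; exists c => //; right.
  by have [+ _] := @mem_arrangements [:: 3; 3; c; 3] 2 isT.
have /allP : all (fun x => all (fun y => all (fun z =>
    [&& x <= z, ~~ ((x == 3) && (y == 3)), ~~ ((x == 3) && (z == 3)) &
      2 * (x * (y * z)) < 3 * (y * z + x * z + x * y)] ==> admissible [:: 3; x; y; z])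
  (iota 3 9)) (iota 3 9)) (iota 3 9) by vm_compute.
move=> /(_ b); rewrite mem_iota => /(_ ltac:(lia)) /allP /(_ c).
rewrite mem_iota => /(_ ltac:(lia)) /allP /(_ e).
rewrite mem_iota nbc nbe be => /(_ ltac:(lia)).
have -> : 2 * (b * (c * e)) < 3 * (c * e + b * e + b * c) by lia.
by rewrite /= => /admissible_listed; apply.
Qed.

(** The reciprocals add up to more than 3/2, while any four of them give at most 4/3; hence every
    size is below 6. *)
Lemma listed_type5 a b c e f : 3 <= a -> 3 <= b -> 3 <= c -> 3 <= e -> 3 <= f ->
  3 * (a * b * c * e * f) <
    2 * (b * c * e * f + a * c * e * f + a * b * e * f + a * b * c * f + a * b * c * e) ->
  (forall p q, p \in [:: a; b; c; e; f] -> ~~ unbalanced [:: a; b; c; e; f] p q) ->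
  exists2 l, l \in arrangements [:: a; b; c; e; f] & listed_type l.
Proof.
move=> a3 b3 c3 e3 f3 cond H.
have Ha n := @leq_mul n _ a _ ^~ (leqnn (b * c * e * f)).
have Hb n := @leq_mul n _ b _ ^~ (leqnn (a * c * e * f)).
have Hc n := @leq_mul n _ c _ ^~ (leqnn (a * b * e * f)).
have He n := @leq_mul n _ e _ ^~ (leqnn (a * b * c * f)).
have Hf n := @leq_mul n _ f _ ^~ (leqnn (a * b * c * e)).
have [h1 h2 h3 h4 h5] := And5 (Ha _ a3) (Hb _ b3) (Hc _ c3) (He _ e3) (Hf _ f3).
have a6 : a < 6 by rewrite ltnNge; apply/negP => /Ha; lia.
have b6 : b < 6 by rewrite ltnNge; apply/negP => /Hb; lia.
have c6 : c < 6 by rewrite ltnNge; apply/negP => /Hc; lia.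
have e6 : e < 6 by rewrite ltnNge; apply/negP => /He; lia.
have f6 : f < 6 by rewrite ltnNge; apply/negP => /Hf; lia.
have /allP : all (fun x => all (fun y => all (fun z => all (fun v => all (fun w =>
    (3 * (x * y * z * v * w) <
     2 * (y * z * v * w + x * z * v * w + x * y * v * w + x * y * z * w + x * y * z * v))
     ==> admissible [:: x; y; z; v; w])
  (iota 3 3)) (iota 3 3)) (iota 3 3)) (iota 3 3)) (iota 3 3) by vm_compute.
move=> /(_ a); rewrite mem_iota => /(_ ltac:(lia)) /allP /(_ b).
rewrite mem_iota => /(_ ltac:(lia)) /allP /(_ c).
rewrite mem_iota => /(_ ltac:(lia)) /allP /(_ e).
rewrite mem_iota => /(_ ltac:(lia)) /allP /(_ f).
rewrite mem_iota cond => /(_ ltac:(lia)).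
by rewrite /= => /admissible_listed; apply.
Qed.

(** * Prisms and antiprisms *)

(* Walking around an n-gon through the corners [x i], the corner [y i] lies at
   the far end of the edge that leaves the n-gon next to [x i]. *)
Section Bands.
Variables (D : Type) (rotate reverse : D -> D) (sz : D -> nat).
Let step x := rotate (reverse x).

Section Common.
Variable L : seq nat.
Hypothesis D_sys : corner_system rotate reverse sz L.

Lemma corner_sizes_perm x : perm_eq (mkseq (fun i => sz (iter i rotate x)) (size L)) L.
Proof.
have [k] := cs_type D_sys x; set l := mkseq _ _ => -[] ->; first by rewrite perm_rot.
by rewrite perm_rot perm_rev.
Qed.

Lemma reverse_inj : injective reverse.
Proof. exact: can_inj (cs_reverse D_sys). Qed.

Lemma step_inj : injective step.
Proof. by move=> x y /(rotate_inj D_sys)/reverse_inj. Qed.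

Lemma step_reverse x : step (reverse x) = rotate x.
Proof. by rewrite /step (cs_reverse D_sys). Qed.

Lemma iter_step_modn x i : 0 < sz x -> iter (i %% sz x) step x = iter i step x.
Proof.
move=> x0; rewrite {2}(divn_eq i (sz x)) addnC iterD; congr (iter _ _ _).
by elim: (i %/ sz x) => //= m IH; rewrite iterD -IH (cs_face D_sys).
Qed.

End Common.

Section Prism.
Variables (n : nat) (x0 : D).
Hypothesis D_sys : corner_system rotate reverse sz [:: n; 4; 4].
Hypothesis x0_n : sz x0 = n.

Let x i := iter i step x0.
Let y i := step (rotate (x i)).

Let rotate3 z : rotate (rotate (rotate z)) = z := cs_rotate D_sys z.

Let szs z : sz (step z) = sz z := cs_size D_sys z.

Lemma prism_sz_x i :
  [/\ sz (x i) = n, sz (rotate (x i)) = 4 & sz (rotate (rotate (x i))) = 4].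
Proof.
have xn : sz (x i) = n by rewrite /x (sz_step D_sys).
have := corner_sizes_perm D_sys (x i); rewrite /= /mkseq /= xn perm_cons => /perm_mem H.
split=> //.
  by have := H (sz (rotate (x i))); rewrite !inE eqxx orbb => /esym/eqP.
by have := H (sz (rotate (rotate (x i)))); rewrite !inE eqxx orbT orbb => /esym/eqP.
Qed.

Lemma prism_reverse_x i : reverse (x i) = rotate (rotate (x i.+1)).
Proof. by rewrite /x iterS /step rotate3. Qed.

Lemma prism_reverse_rx i : reverse (rotate (x i)) = rotate (rotate (y i)).
Proof. by rewrite /y /step rotate3. Qed.

(** The square at [rotate (x i)] closes after four steps, the last of which returns from
    [reverse (x i)]. *)
Lemma prism_step_y i : step (y i) = rotate (rotate (y i.+1)).
Proof.
have H : step (step (y i)) = rotate (rotate (x i.+1)).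
  rewrite -prism_reverse_x; apply: (step_inj D_sys); rewrite (step_reverse D_sys).
  have [_ s4 _] := prism_sz_x i.
  by have := cs_face D_sys (rotate (x i)); rewrite s4.
have : reverse (step (y i)) = rotate (x i.+1).
  by apply: (rotate_inj D_sys); rewrite -H.
by move=> /(congr1 reverse); rewrite (cs_reverse D_sys) prism_reverse_rx.
Qed.

Lemma prism_reverse_y i : reverse (y i) = rotate (y i.+1).
Proof. by apply: (rotate_inj D_sys); exact: prism_step_y. Qed.

Lemma prism_period i : x (i + n) = x i /\ y (i + n) = y i.
Proof.
have xE : x (i + n) = x i by rewrite /x iterD -x0_n (cs_face D_sys).
by rewrite /y xE.
Qed.

(** Two of the three corners at [y i] lie in squares of the band, and the sum of the sizes leaves
    [n] for the third. *)
Lemma prism_sz_y i : 0 < n ->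
  [/\ sz (y i) = 4, sz (rotate (y i)) = n & sz (rotate (rotate (y i))) = 4].
Proof.
move=> n0; have s1 j : sz (y j) = 4 by rewrite /y szs; case: (prism_sz_x j).
have s3 j : sz (rotate (rotate (y j))) = 4.
  (* By periodicity every index is a successor. *)
  have [_ <-] := prism_period j; rewrite -(prednK n0) addnS -prism_step_y szs.
  exact: s1.
split=> //; have := perm_sumn (corner_sizes_perm D_sys (y i)).
rewrite /= s1 s3; lia.
Qed.

End Prism.

Section Antiprism.
Variables (n : nat) (x0 : D).
Hypothesis D_sys : corner_system rotate reverse sz [:: n; 3; 3; 3].
Hypothesis x0_n : sz x0 = n.

Let x i := iter i step x0.
Let y i := step (rotate (x i)).

Let rotate4 z : rotate (rotate (rotate (rotate z))) = z := cs_rotate D_sys z.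

Let szs z : sz (step z) = sz z := cs_size D_sys z.

Lemma antiprism_sz_x i :
  [/\ sz (x i) = n, sz (rotate (x i)) = 3, sz (rotate (rotate (x i))) = 3 &
      sz (rotate (rotate (rotate (x i)))) = 3].
Proof.
have xn : sz (x i) = n by rewrite /x (sz_step D_sys).
have := corner_sizes_perm D_sys (x i); rewrite /= /mkseq /= xn perm_cons => /perm_mem H.
split=> //.
- by have := H (sz (rotate (x i))); rewrite !inE eqxx !orbb => /esym/eqP.
- by have := H (sz (rotate (rotate (x i)))); rewrite !inE eqxx orbT !orbb => /esym/eqP.
- by have := H (sz (rotate (rotate (rotate (x i))))); rewrite !inE eqxx !orbT !orbb => /esym/eqP.
Qed.

Lemma antiprism_reverse_x i : reverse (x i) = rotate (rotate (rotate (x i.+1))).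
Proof. by rewrite /x iterS /step rotate4. Qed.

Lemma antiprism_reverse_rx i : reverse (rotate (x i)) = rotate (rotate (rotate (y i))).
Proof. by rewrite /y /step rotate4. Qed.

(** The triangle at [rotate (x i)] closes after three steps. *)
Lemma antiprism_step_y i : step (y i) = reverse (x i).
Proof.
apply: (step_inj D_sys); rewrite (step_reverse D_sys).
have [_ s3 _ _] := antiprism_sz_x i.
by have := cs_face D_sys (rotate (x i)); rewrite s3.
Qed.

Lemma antiprism_reverse_y i : reverse (y i) = rotate (rotate (x i.+1)).
Proof.
by apply: (rotate_inj D_sys); rewrite -antiprism_reverse_x -antiprism_step_y.
Qed.

Lemma antiprism_step_rrx i : step (rotate (rotate (x i.+1))) = rotate (y i).
Proof. by rewrite -antiprism_reverse_y (step_reverse D_sys). Qed.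

Lemma antiprism_step_rrry i :
  step (rotate (rotate (rotate (y i)))) = rotate (rotate (x i)).
Proof. by rewrite -antiprism_reverse_rx (step_reverse D_sys). Qed.

(** The triangle at [rotate (rotate (x i.+1))] closes after three steps. *)
Lemma antiprism_step_ry i : step (rotate (y i)) = rotate (rotate (rotate (y i.+1))).
Proof.
apply: (step_inj D_sys); rewrite antiprism_step_rrry -antiprism_step_rrx.
have [_ _ s3 _] := antiprism_sz_x i.+1.
by have := cs_face D_sys (rotate (rotate (x i.+1))); rewrite s3.
Qed.

Lemma antiprism_reverse_ry i : reverse (rotate (y i)) = rotate (rotate (y i.+1)).
Proof. by apply: (rotate_inj D_sys); exact: antiprism_step_ry. Qed.

Lemma antiprism_period i : x (i + n) = x i /\ y (i + n) = y i.
Proof.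
have xE : x (i + n) = x i by rewrite /x iterD -x0_n (cs_face D_sys).
by rewrite /y xE.
Qed.

Lemma antiprism_sz_y i : 0 < n ->
  [/\ sz (y i) = 3, sz (rotate (y i)) = 3, sz (rotate (rotate (y i))) = n &
      sz (rotate (rotate (rotate (y i)))) = 3].
Proof.
move=> n0; have s1 j : sz (y j) = 3 by rewrite /y szs; case: (antiprism_sz_x j).
have s2 j : sz (rotate (y j)) = 3.
  by rewrite -antiprism_step_rrx szs; case: (antiprism_sz_x j.+1).
have s4 j : sz (rotate (rotate (rotate (y j)))) = 3.
  have [_ <-] := antiprism_period j; rewrite -(prednK n0) addnS -antiprism_step_ry szs.
  exact: s2.
split=> //; have := perm_sumn (corner_sizes_perm D_sys (y i)).
rewrite /= s1 s2 s4; lia.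
Qed.

End Antiprism.
End Bands.

Section BandRealization.
Variables (T : eqType) (X : seq (seq T)) (X_map : polyhedral_map X) (n : nat).
Hypothesis n3 : 3 <= n.
Hypothesis X_connected : forall C : T -> bool,
  (forall s u v, s \in X -> edge_of s u v -> C u = C v) ->
  {in vertices X &, forall u v, C u = C v}.
Hypothesis X_size : size (vertices X) = 2 * n.

Local Notation rotate := (flag_rotate X_map).
Local Notation reverse := (flag_reverse X_map).
Local Notation step := (flag_step X_map).

Let a i := i %% n.
Let b i := n + i %% n.

Let n0 : 0 < n. Proof. by case: (n) n3. Qed.

Let a_lt i : a i < 2 * n. Proof. by have := ltn_pmod i n0; rewrite /a; lia. Qed.
Let b_lt i : b i < 2 * n. Proof. by have := ltn_pmod i n0; rewrite /b; lia. Qed.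

Variables (x y : nat -> flag X).
Hypothesis x_mod : forall i, x (i %% n) = x i.
Hypothesis y_mod : forall i, y (i %% n) = y i.
Hypothesis x_step : forall i, x i = iter i step (x 0).

(** The numbering of [prism] and [antiprism]: first the n vertices of one n-gon, then those of the
    other. *)
Definition band_vertex k := if k < n then x k else y (k - n).

Let rho_a i : band_vertex (a i) = x i.
Proof. by rewrite /band_vertex /a ltn_mod n0. Qed.

Let rho_b i : band_vertex (b i) = y i.
Proof. by rewrite /band_vertex /b ltnNge leq_addr /= addKn. Qed.

Let vertexP k : k < 2 * n -> k = a k /\ k < n \/ k = b (k - n) /\ n <= k.
Proof.
move=> k2; case: (ltnP k n) => kn; [left|right]; split=> //.
  by rewrite /a modn_small.
by rewrite /b modn_small; lia.
Qed.

Lemma band_face z t : all (fun k => k < 2 * n) t ->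
  flag_polygon X_map z = [seq flag_vertex (band_vertex k) | k <- t] ->
  realized_face X_map 0 (iota 0 (2 * n)) band_vertex z t.
Proof.
move=> tn zt; exists t; split=> //; first by rewrite size_iota.
have -> : [seq nth 0 (iota 0 (2 * n)) k | k <- t] = t.
  rewrite -[RHS]map_id; apply/eq_in_map => k /(allP tn) kn.
  by rewrite nth_iota.
by exists 0; left; rewrite rot0.
Qed.

Lemma band_top : flag_size (x 0) = n ->
  realized_face X_map 0 (iota 0 (2 * n)) band_vertex (x 0) (mkseq a n).
Proof.
move=> xn; apply: band_face; first by apply/allP => k /mapP[i _ ->]; exact: a_lt.
rewrite /flag_polygon xn /mkseq -map_comp; apply: eq_map => i /=.
by rewrite -x_step rho_a.
Qed.

Lemma band_bottom z : flag_size z = n ->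
  (forall i, i < n -> flag_vertex (iter i step z) = flag_vertex (y (n.-1 - i))) ->
  realized_face X_map 0 (iota 0 (2 * n)) band_vertex z (rev (mkseq b n)).
Proof.
move=> zn H; apply: band_face.
  by apply/allP => k; rewrite mem_rev => /mapP[i _ ->]; exact: b_lt.
apply: (@eq_from_nth _ (flag_vertex z)).
  by rewrite size_map size_rev !size_mkseq.
move=> i; rewrite size_mkseq zn => iN.
rewrite nth_mkseq ?zn// (nth_map 0) ?size_rev ?size_mkseq// nth_rev ?size_mkseq//.
by rewrite nth_mkseq ?rho_b ?H//; [congr (flag_vertex (y _)); lia|lia].
Qed.

Let closed_x i j : exists k' i', k' < 2 * n /\
  iter j rotate (x i) = iter i' rotate (band_vertex k').
Proof. by exists (a i), j; rewrite rho_a. Qed.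

Let closed_y i j : exists k' i', k' < 2 * n /\
  iter j rotate (y i) = iter i' rotate (band_vertex k').
Proof. by exists (b i), j; rewrite rho_b. Qed.

Let pred_mod (z : nat -> flag X) (z_mod : forall i, z (i %% n) = z i) i :
  z i = z (i + n.-1).+1.
Proof. by rewrite -(z_mod i) -(z_mod (_.+1)) -addnS prednK// modnDr. Qed.

Let iter_step_down (w : nat -> flag X) (w_step : forall i, step (w i.+1) = w i) m i :
  i <= m -> iter i step (w m) = w (m - i).
Proof.
elim: i => [|i IH] im; first by rewrite subn0.
by rewrite iterS IH ?(ltnW im)// -(w_step (m - i.+1)); congr (step (w _)); lia.
Qed.

Let band_flatten t : t \in mkseq a n :: [:: rev (mkseq b n)] -> {subset t <= iota 0 (2 * n)}.
Proof.
rewrite !inE => /orP[] /eqP -> k; rewrite ?mem_rev => /mapP[i _ ->].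
  by rewrite mem_iota a_lt.
by rewrite mem_iota b_lt.
Qed.

Section PrismRealization.
Hypothesis X_type : forall u, u \in vertices X ->
  exists2 c, face_cycle X u c & [seq size s | s <- c] = [:: n; 4; 4].
Hypothesis x0_size : flag_size (x 0) = n.
Hypothesis yE : forall i, y i = step (rotate (x i)).

Let D_sys := flag_corner_system X_map X_type (x 0).

Let xiE i : iter i (fun z => rotate (reverse z)) (x 0) = x i.
Proof. by rewrite x_step. Qed.

Let yiE i : rotate (reverse (rotate (x i))) = y i.
Proof. by rewrite yE. Qed.

Let reverse_x i : reverse (x i) = rotate (rotate (x i.+1)).
Proof. by have := prism_reverse_x (x 0) D_sys i; rewrite !xiE. Qed.

Let reverse_rx i : reverse (rotate (x i)) = rotate (rotate (y i)).
Proof. by have := prism_reverse_rx (x 0) D_sys i; rewrite !xiE !yiE. Qed.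

Let reverse_y i : reverse (y i) = rotate (y i.+1).
Proof. by have := prism_reverse_y D_sys x0_size i; rewrite !xiE !yiE. Qed.

Let step_y i : step (y i) = rotate (rotate (y i.+1)).
Proof. by rewrite /flag_step reverse_y. Qed.

Let sz_rx i : flag_size (rotate (x i)) = 4.
Proof. by have [_ + _] := prism_sz_x D_sys x0_size i; rewrite !xiE. Qed.

Let sz_ry i : flag_size (rotate (y i)) = n.
Proof. by have [_ + _] := prism_sz_y D_sys x0_size i n0; rewrite !xiE !yiE. Qed.

Let reverseK : involutive reverse := flag_reverseK X_map.

Let side i : realized_face X_map 0 (iota 0 (2 * n)) band_vertex (reverse (x i))
  [:: a i.+1; a i; b i; b i.+1].
Proof.
apply: band_face; first by rewrite /= !a_lt !b_lt.
have s1 : step (reverse (x i)) = rotate (x i) by rewrite /flag_step reverseK.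
have zn : flag_size (reverse (x i)) = 4 by rewrite -(flag_size_step X_map) s1 sz_rx.
rewrite /flag_polygon zn /mkseq /= s1 -yE step_y reverse_x !rho_a !rho_b.
by [].
Qed.

Let step_ry i : step (rotate (y i.+1)) = rotate (y i).
Proof. by rewrite /flag_step -reverse_y reverseK. Qed.

Let bottom : realized_face X_map 0 (iota 0 (2 * n)) band_vertex (rotate (y n.-1))
  (rev (mkseq b n)).
Proof.
apply: band_bottom => [|i iN]; first exact: sz_ry.
by rewrite (iter_step_down step_ry)//; lia.
Qed.

(** Every corner at a vertex of the band is reached by steps from [x 0], from [rotate (y n.-1)] or
    from some [reverse (x i)], that is, from a corner of one of the n-gons or of a square already
    matched with a face of the prism. *)
Lemma isomorphic_prism : isomorphic X (prism n).
Proof.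
have inP i : i < n -> [:: a i.+1; a i; b i; b i.+1] \in prism n.
  move=> iN; rewrite mem_cat; apply/orP; right.
  apply: (map_f (fun i => [:: a i.+1; a i; b i; b i.+1])).
  by rewrite mem_iota.
have PE t : t \in prism n -> [\/ t = mkseq a n, t = rev (mkseq b n) |
    exists2 i, i < n & t = [:: a i.+1; a i; b i; b i.+1]].
  rewrite mem_cat !inE => /orP[/orP[] /eqP ->|/mapP[i]]; [by constructor 1|by constructor 2|].
  by rewrite mem_iota => iN ->; constructor 3; exists i.
apply: (@isomorphic_realization _ _ X_map _ X_type X_connected _ _ 0 (iota 0 (2 * n)) band_vertex).
- exact: iota_uniq.
- by rewrite size_iota.
- by rewrite size_iota muln_gt0.
- move=> k /flattenP[t /PE[tE|tE|[i _ ->]]].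
  + by apply: band_flatten; rewrite tE mem_head.
  + by apply: band_flatten; rewrite tE !inE eqxx orbT.
  + by rewrite !inE mem_iota => /or4P[] /eqP ->; rewrite ?a_lt ?b_lt.
- move=> k i; rewrite size_iota => /vertexP[[-> _]|[-> _]]; rewrite ?rho_a ?rho_b;
    case: i => [|[|[|//]]] _.
  + by rewrite reverse_x; exact: (closed_x _ 2).
  + by rewrite reverse_rx; exact: (closed_y _ 2).
  + rewrite [x _](pred_mod x_mod) /= -reverse_x reverseK; exact: (closed_x _ 0).
  + by rewrite reverse_y; exact: (closed_y _ 1).
  + rewrite [y _](pred_mod y_mod) /= -reverse_y reverseK; exact: (closed_y _ 0).
  + by rewrite /= -reverse_rx reverseK; exact: (closed_x _ 1).
- move=> t /PE[->|->|[i iN ->]]; first by exists (x 0); exact: band_top.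
    by exists (rotate (y n.-1)); exact: bottom.
  by exists (reverse (x i)); exact: side.
- have side' i : exists2 t, t \in prism n & realized_face X_map 0 (iota 0 (2 * n)) band_vertex (reverse (x i)) t.
    by rewrite -x_mod; exists [:: a (i %% n).+1; a (i %% n); b (i %% n); b (i %% n).+1];
      [apply: inP; rewrite ltn_mod|exact: side].
  have stepped z i : (exists2 t, t \in prism n & realized_face X_map 0 (iota 0 (2 * n)) band_vertex z t) ->
      exists2 t, t \in prism n & realized_face X_map 0 (iota 0 (2 * n)) band_vertex (iter i step z) t.
    by move=> [t tP zt]; exists t => //; exact: realized_face_iter.
  have s1 i : step (reverse (x i)) = rotate (x i) by rewrite /flag_step reverseK.
  have s2 i : iter 2 step (reverse (x i)) = y i by rewrite /= s1 yE.
  move=> k i; rewrite size_iota => /vertexP[[-> kn]|[-> kn]]; rewrite ?rho_a ?rho_b;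
    case: i => [|[|[|//]]] _.
  + rewrite x_step; apply: stepped; exists (mkseq a n); first exact: mem_head.
    exact: band_top.
  + by rewrite /= -s1; exact: (stepped _ 1).
  + by rewrite [x _](pred_mod x_mod) /= -reverse_x.
  + by rewrite /= -s2; exact: stepped.
  + rewrite /= -y_mod.
    have jn := ltn_pmod (k - n) n0.
    have -> : rotate (y ((k - n) %% n)) =
        iter (n.-1 - (k - n) %% n) step (rotate (y n.-1)).
      by rewrite (iter_step_down step_ry) ?leq_subr//; congr (rotate (y _)); lia.
    apply: stepped; exists (rev (mkseq b n)); last exact: bottom.
    by rewrite !inE eqxx orbT.
  + rewrite [y _](pred_mod y_mod) /= -step_y -s2.
    exact: (stepped _ 3).
Qed.

End PrismRealization.
Section AntiprismRealization.
Hypothesis X_type : forall u, u \in vertices X ->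
  exists2 c, face_cycle X u c & [seq size s | s <- c] = [:: n; 3; 3; 3].
Hypothesis x0_size : flag_size (x 0) = n.
Hypothesis yE : forall i, y i = step (rotate (x i)).

Let D_sys := flag_corner_system X_map X_type (x 0).

Let xiE i : iter i (fun z => rotate (reverse z)) (x 0) = x i.
Proof. by rewrite x_step. Qed.

Let yiE i : rotate (reverse (rotate (x i))) = y i.
Proof. by rewrite yE. Qed.

Let reverse_x i : reverse (x i) = rotate (rotate (rotate (x i.+1))).
Proof. by have := antiprism_reverse_x (x 0) D_sys i; rewrite !xiE. Qed.

Let reverse_rx i : reverse (rotate (x i)) = rotate (rotate (rotate (y i))).
Proof. by have := antiprism_reverse_rx (x 0) D_sys i; rewrite !xiE !yiE. Qed.

Let reverse_y i : reverse (y i) = rotate (rotate (x i.+1)).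
Proof. by have := antiprism_reverse_y D_sys x0_size i; rewrite !xiE !yiE. Qed.

Let reverse_ry i : reverse (rotate (y i)) = rotate (rotate (y i.+1)).
Proof. by have := antiprism_reverse_ry D_sys x0_size i; rewrite !xiE !yiE. Qed.

Let sz_rx i : flag_size (rotate (x i)) = 3.
Proof. by have [_ + _ _] := antiprism_sz_x D_sys x0_size i; rewrite !xiE. Qed.

Let sz_y i : [/\ flag_size (y i) = 3, flag_size (rotate (y i)) = 3,
  flag_size (rotate (rotate (y i))) = n & flag_size (rotate (rotate (rotate (y i)))) = 3].
Proof. by have := antiprism_sz_y D_sys x0_size i n0; rewrite !xiE !yiE. Qed.

Let reverseK : involutive reverse := flag_reverseK X_map.

Let step_reverse z : step (reverse z) = rotate z.
Proof. by rewrite /flag_step reverseK. Qed.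

Let step_ry i : step (rotate (y i)) = rotate (rotate (rotate (y i.+1))).
Proof. by rewrite /flag_step reverse_ry. Qed.

Let step_rry i : step (rotate (rotate (y i.+1))) = rotate (rotate (y i)).
Proof. by rewrite -reverse_ry step_reverse. Qed.

Let step_rrry i : step (rotate (rotate (rotate (y i)))) = rotate (rotate (x i)).
Proof. by rewrite -reverse_rx step_reverse. Qed.

Let realized := realized_face X_map 0 (iota 0 (2 * n)) band_vertex.

Let side_up i : realized (reverse (x i)) [:: a i.+1; a i; b i].
Proof.
apply: band_face; first by rewrite /= !a_lt b_lt.
have zn : flag_size (reverse (x i)) = 3.
  by rewrite -(flag_size_step X_map) step_reverse sz_rx.
by rewrite /flag_polygon zn /mkseq /= step_reverse -yE reverse_x !rho_a !rho_b.
Qed.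

Let side_down i : realized (rotate (y i)) [:: b i; b i.+1; a i.+1].
Proof.
apply: band_face; first by rewrite /= !b_lt a_lt.
have [_ zn _ _] := sz_y i.
by rewrite /flag_polygon zn /mkseq /= step_ry step_rrry !rho_a !rho_b.
Qed.

Let bottom : realized (rotate (rotate (y n.-1))) (rev (mkseq b n)).
Proof.
apply: band_bottom => [|i iN]; first by case: (sz_y n.-1).
by rewrite (iter_step_down (w := fun i => rotate (rotate (y i))) step_rry)//; lia.
Qed.

(** As for prisms, with the two kinds of triangles entered at [reverse (x i)] and [rotate (y i)]. *)
Lemma isomorphic_antiprism : isomorphic X (antiprism n).
Proof.
have upP i : [:: a (i %% n).+1; a (i %% n); b (i %% n)] \in antiprism n.
  rewrite !mem_cat; apply/orP; right; apply/orP; left.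
  apply: (map_f (fun i => [:: a i.+1; a i; b i])).
  by rewrite mem_iota ltn_mod.
have downP i : [:: b (i %% n); b (i %% n).+1; a (i %% n).+1] \in antiprism n.
  rewrite !mem_cat; apply/orP; right; apply/orP; right.
  apply: (map_f (fun i => [:: b i; b i.+1; a i.+1])).
  by rewrite mem_iota ltn_mod.
have PE t : t \in antiprism n -> [\/ t = mkseq a n, t = rev (mkseq b n),
    exists i, t = [:: a i.+1; a i; b i] | exists i, t = [:: b i; b i.+1; a i.+1]].
  rewrite !mem_cat !inE => /or3P[/orP[] /eqP ->|/mapP[i _ ->]|/mapP[i _ ->]].
  - by constructor 1.
  - by constructor 2.
  - by constructor 3; exists i.
  - by constructor 4; exists i.
apply: (@isomorphic_realization _ _ X_map _ X_type X_connected _ _ 0 (iota 0 (2 * n)) band_vertex).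
- exact: iota_uniq.
- by rewrite size_iota.
- by rewrite size_iota muln_gt0.
- move=> k /flattenP[t /PE[tE|tE|[i ->]|[i ->]]].
  + by apply: band_flatten; rewrite tE mem_head.
  + by apply: band_flatten; rewrite tE !inE eqxx orbT.
  + by rewrite !inE mem_iota => /or3P[] /eqP ->; rewrite ?a_lt ?b_lt.
  + by rewrite !inE mem_iota => /or3P[] /eqP ->; rewrite ?a_lt ?b_lt.
- move=> k i; rewrite size_iota => /vertexP[[-> _]|[-> _]]; rewrite ?rho_a ?rho_b;
    case: i => [|[|[|[|//]]]] _.
  + by rewrite reverse_x; exact: (closed_x _ 3).
  + by rewrite reverse_rx; exact: (closed_y _ 3).
  + rewrite [x _](pred_mod x_mod) /= -reverse_y reverseK; exact: (closed_y _ 0).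
  + rewrite [x _](pred_mod x_mod) /= -reverse_x reverseK; exact: (closed_x _ 0).
  + by rewrite reverse_y; exact: (closed_x _ 2).
  + by rewrite reverse_ry; exact: (closed_y _ 2).
  + rewrite [y _](pred_mod y_mod) /= -reverse_ry reverseK; exact: (closed_y _ 1).
  + by rewrite /= -reverse_rx reverseK; exact: (closed_x _ 1).
- move=> t /PE[->|->|[i ->]|[i ->]].
  + by exists (x 0); exact: band_top.
  + by exists (rotate (rotate (y n.-1))); exact: bottom.
  + by exists (reverse (x i)); exact: side_up.
  + by exists (rotate (y i)); exact: side_down.
- have up i m : exists2 t, t \in antiprism n & realized (iter m step (reverse (x i))) t.
    rewrite -x_mod; exists [:: a (i %% n).+1; a (i %% n); b (i %% n)]; first exact: upP.
    exact/realized_face_iter/side_up.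
  have down i m : exists2 t, t \in antiprism n & realized (iter m step (rotate (y i))) t.
    rewrite -y_mod; exists [:: b (i %% n); b (i %% n).+1; a (i %% n).+1]; first exact: downP.
    exact/realized_face_iter/side_down.
  move=> k i; rewrite size_iota => /vertexP[[-> kn]|[-> kn]]; rewrite ?rho_a ?rho_b;
    case: i => [|[|[|[|//]]]] _.
  + rewrite x_step; exists (mkseq a n); first exact: mem_head.
    exact/realized_face_iter/band_top.
  + by rewrite /= -step_reverse; exact: (up _ 1).
  + rewrite [x _](pred_mod x_mod) /= -step_rrry -step_ry; exact: (down _ 2).
  + by rewrite [x _](pred_mod x_mod) /= -reverse_x; exact: (up _ 0).
  + by rewrite /= yE -step_reverse; exact: (up _ 2).
  + exact: (down _ 0).
  + rewrite /= -y_mod; have jn := ltn_pmod (k - n) n0.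
    have -> : rotate (rotate (y ((k - n) %% n))) =
        iter (n.-1 - (k - n) %% n) step (rotate (rotate (y n.-1))).
      rewrite (iter_step_down (w := fun i => rotate (rotate (y i))) step_rry) ?leq_subr//.
      by congr (rotate (rotate (y _))); lia.
    exists (rev (mkseq b n)); last exact/realized_face_iter/bottom.
    by rewrite !inE eqxx orbT.
  + rewrite [y _](pred_mod y_mod) /= -step_ry; exact: (down _ 1).
Qed.

End AntiprismRealization.
End BandRealization.

(** * Classification *)

Section VertexTypes.
Variables (T : eqType) (X : seq (seq T)).

Definition has_type (L : seq nat) := forall u, u \in vertices X ->
  exists2 c, face_cycle X u c & [seq size s | s <- c] = L.

Lemma adjacent_at_sym (u : T) s t : adjacent_at u s t = adjacent_at u t s.
Proof.
by apply/hasP/hasP => -[v _ /andP[e1 e2]]; exists v; rewrite ?e1 ?e2//;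
  have /and3P[_ ? _] := e1; have /and3P[_ ? _] := e2.
Qed.

Lemma has_type_arrangement L l : has_type L -> l \in arrangements L -> has_type l.
Proof.
move=> XL lL u /XL[c [uc mc cc] cL].
have fcr k : face_cycle X u (rot k c).
  by split; rewrite ?rot_uniq ?rot_cycle// => s; rewrite mem_rot.
have fcv : face_cycle X u (rev c).
  split; rewrite ?rev_uniq//; first by move=> s; rewrite mem_rev.
  by rewrite rev_cycle (eq_cycle (e' := adjacent_at u))// => s t; exact: adjacent_at_sym.
move: lL; rewrite mem_undup mem_cat => /orP[] /mapP[k _ ->].
  by exists (rot k c); rewrite ?map_rot ?cL.
exists (rot k (rev c)); last by rewrite map_rot map_rev cL.
have [u1 m1 c1] := fcv.
by split; rewrite ?rot_uniq ?rot_cycle// => s; rewrite mem_rot.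
Qed.

Hypothesis X_map : polyhedral_map X.
Hypothesis X_nonempty : 0 < size X.
Hypothesis X_connected : forall C : T -> bool,
  (forall s u v, s \in X -> edge_of s u v -> C u = C v) ->
  {in vertices X &, forall u v, C u = C v}.
Hypothesis X_cocycle : forall c : T -> T -> bool,
  (forall u v, c u v = c v u) ->
  (forall s, s \in X -> \big[addb/false]_(u <- s) c u (next s u) = false) ->
  exists g : T -> bool, forall s u v, s \in X -> edge_of s u v -> c u v = g u (+) g v.

Lemma exists_flag : inhabited (flag X).
Proof.
have [s sX] : exists s, s \in X.
  by move: X_nonempty; case: (X) => // s X' _; exists s; exact: mem_head.
have [u us] : exists u, u \in s.
  by have := face_size X_map sX; case: (s) => // u s' _; exists u; exact: mem_head.
have xP : is_flag X (s, u, next s u) by rewrite /is_flag /= sX edge_of_next.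
by split; exact: exist (fun z => is_true (is_flag X z)) _ xP.
Qed.

Lemma type_equation L : has_type L ->
  let P := \prod_(p <- L) p in let S := \sum_(p <- L) P %/ p in
  size (vertices X) * (2 * P + 2 * S) = size (vertices X) * (size L * P) + 4 * P.
Proof.
move=> XL; apply: (euler_vertex_type X_map XL).
exact: (euler_formula X_map XL X_connected X_cocycle X_nonempty).
Qed.

Lemma type_ge3 L p : has_type L -> p \in L -> 3 <= p.
Proof.
move=> XL; have [x] := exists_flag; have [c [_ mc _] <-] := XL _ (flag_vertexX x).
by move=> /mapP[s]; rewrite mc mem_filter => /andP[_ /(face_size X_map) s3] ->.
Qed.

Lemma type_balanced L p q : has_type L -> p \in L -> ~~ unbalanced L p q.
Proof.
move=> XL pL; have [x] := exists_flag; apply/negP.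
apply: (unbalanced_false (flag_corner_system X_map XL x) _ x pL).
exact: ltnW (flag_degree X_map XL x).
Qed.

(** The term 4 P in Euler's relation is positive: the sum of 1/p exceeds d/2 - 1. *)
Lemma type_bound L : has_type L ->
  size L * \prod_(p <- L) p <
    2 * \prod_(p <- L) p + 2 * \sum_(p <- L) (\prod_(q <- L) q) %/ p.
Proof.
move=> XL; have := type_equation XL.
set P := \prod_(p <- L) p; set S := \sum_(p <- L) _.
have P0 : 0 < P.
  by rewrite /P big_seq; apply: prodn_cond_gt0 => p /(type_ge3 XL); exact: leq_trans.
by rewrite ltnNge => E; apply/negP => /(leq_mul (leqnn (size (vertices X)))); lia.
Qed.

(** Since every p is at least 3, d/2 - 1 < d/3. *)
Lemma type_length L : has_type L -> 3 <= size L < 6.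
Proof.
move=> XL; have [x] := exists_flag; rewrite (flag_degree X_map XL x) /=.
have := type_bound XL; set P := \prod_(p <- L) p; set S := \sum_(p <- L) _.
have P0 : 0 < P.
  by rewrite /P big_seq; apply: prodn_cond_gt0 => p /(type_ge3 XL); exact: leq_trans.
have : 3 * S <= size L * P.
  have -> : size L * P = \sum_(p <- L) P by rewrite big_const_seq count_predT iter_addn addn0 mulnC.
  rewrite /S big_distrr /= big_seq [leqRHS]big_seq; apply: leq_sum => p pL.
  have pP : p %| P by rewrite /P (big_rem _ pL) dvdn_mulr.
  by rewrite -[leqRHS](divnK pP) mulnC leq_mul2l (type_ge3 XL pL) orbT.
by move=> h1 h2; rewrite -(ltn_pmul2r P0); lia.
Qed.

(** Rotations and reversal generate all permutations of three positions. *)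
Lemma sorted_type3 a b c : has_type [:: a; b; c] ->
  exists a' b' c', [/\ has_type [:: a'; b'; c'], a' <= b' & b' <= c'].
Proof.
move=> XL; have H l := @has_type_arrangement _ l XL.
have arr k := @mem_arrangements [:: a; b; c] k isT.
have [ra0 rv0] := arr 0; have [ra1 rv1] := arr 1; have [ra2 rv2] := arr 2.
case: (leqP a b) => ab; case: (leqP b c) => bc; case: (leqP a c) => ac;
  first [by exists a, b, c; split=> //; lia
       | by exists a, c, b; split; [exact: H _ rv2|lia|lia]
       | by exists b, a, c; split; [exact: H _ rv1|lia|lia]
       | by exists b, c, a; split; [exact: H _ ra1|lia|lia]
       | by exists c, a, b; split; [exact: H _ ra2|lia|lia]
       | by exists c, b, a; split; [exact: H _ rv0|lia|lia]].
Qed.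

(** A smallest entry is rotated to the front, and the reflection fixing it orders its two
    neighbours. *)
Lemma sorted_type4 a b c e : has_type [:: a; b; c; e] -> exists a' b' c' e',
  [/\ has_type [:: a'; b'; c'; e'], a' <= b', a' <= c', a' <= e' & b' <= e'].
Proof.
have rotP x y z w : has_type [:: x; y; z; w] -> x <= y -> x <= z -> x <= w ->
    exists a' b' c' e',
      [/\ has_type [:: a'; b'; c'; e'], a' <= b', a' <= c', a' <= e' & b' <= e'].
  move=> XL xy xz xw; case: (leqP y w) => yw; first by exists x, y, z, w.
  exists x, w, z, y; split=> //; last exact: ltnW.
  apply: (has_type_arrangement XL).
  by have [_ +] := @mem_arrangements [:: x; y; z; w] 3 isT.
move=> XL; have H k := has_type_arrangement XL (proj1 (@mem_arrangements [:: a; b; c; e] k isT)).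
have [h1 h2 h3] := And3 (H 1) (H 2) (H 3).
case: (leqP a b) => ab; case: (leqP c e) => ce.
- case: (leqP a c) => ac; first by apply: (rotP a b c e) => //; lia.
  by apply: (rotP c e a b) => //; lia.
- case: (leqP a e) => ae; first by apply: (rotP a b c e) => //; lia.
  by apply: (rotP e a b c) => //; lia.
- case: (leqP b c) => bc; first by apply: (rotP b c e a) => //; lia.
  by apply: (rotP c e a b) => //; lia.
- case: (leqP b e) => be; first by apply: (rotP b c e a) => //; lia.
  by apply: (rotP e a b c) => //; lia.
Qed.

Lemma has_listed_type L : has_type L -> exists2 l, has_type l & listed_type l.
Proof.
move=> XL; suff [L' XL' [l lL' ll]] : exists2 L', has_type L' &
    exists2 l, l \in arrangements L' & listed_type l.
  by exists l => //; exact: has_type_arrangement lL'.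
have /andP[] := type_length XL.
case: L XL => [|a [|b [|c [|e [|f [|]]]]]] // XL _ _.
- have [{XL}a' [b' [c' [XL ab bc]]]] := sorted_type3 XL; exists [:: a'; b'; c'] => //.
  have g p := type_ge3 XL (p := p).
  have [a3 b3 c3] : [/\ 3 <= a', 3 <= b' & 3 <= c'] by split; apply: g; rewrite !inE eqxx ?orbT.
  apply: listed_type3 => //; last by move=> p q; exact: type_balanced.
  have := type_bound XL; rewrite !big_cons !big_nil /= !muln1 !addn0.
  have -> : a' * (b' * c') %/ a' = b' * c' by rewrite mulKn//; lia.
  have -> : a' * (b' * c') %/ b' = a' * c' by rewrite mulnCA mulKn//; lia.
  have -> : a' * (b' * c') %/ c' = a' * b' by rewrite mulnA mulnK//; lia.
  lia.
- have [{XL}a' [b' [c' [e' [XL ab ac ae be]]]]] := sorted_type4 XL; exists [:: a'; b'; c'; e'] => //.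
  have g p := type_ge3 XL (p := p).
  have [a3 b3 c3 e3] : [/\ 3 <= a', 3 <= b', 3 <= c' & 3 <= e'].
    by split; apply: g; rewrite !inE eqxx ?orbT.
  apply: listed_type4 => //; last by move=> p q; exact: type_balanced.
  have := type_bound XL; rewrite !big_cons !big_nil /= !muln1 !addn0.
  have -> : a' * (b' * (c' * e')) %/ a' = b' * c' * e' by rewrite mulKn ?mulnA//; lia.
  have -> : a' * (b' * (c' * e')) %/ b' = a' * c' * e' by rewrite mulnCA mulKn ?mulnA//; lia.
  have -> : a' * (b' * (c' * e')) %/ c' = a' * b' * e'.
    by rewrite (mulnCA b') mulnCA mulKn ?mulnA//; lia.
  have -> : a' * (b' * (c' * e')) %/ e' = a' * b' * c' by rewrite !mulnA mulnK//; lia.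
  lia.
- exists [:: a; b; c; e; f] => //.
  have g p := type_ge3 XL (p := p).
  have [a3 b3 c3 e3 f3] : [/\ 3 <= a, 3 <= b, 3 <= c, 3 <= e & 3 <= f].
    by split; apply: g; rewrite !inE eqxx ?orbT.
  apply: listed_type5 => //; last by move=> p q; exact: type_balanced.
  have := type_bound XL; rewrite !big_cons !big_nil /= !muln1 !addn0.
  have -> : a * (b * (c * (e * f))) %/ a = b * c * e * f by rewrite mulKn ?mulnA//; lia.
  have -> : a * (b * (c * (e * f))) %/ b = a * c * e * f by rewrite mulnCA mulKn ?mulnA//; lia.
  have -> : a * (b * (c * (e * f))) %/ c = a * b * e * f.
    by rewrite (mulnCA b) mulnCA mulKn ?mulnA//; lia.
  have -> : a * (b * (c * (e * f))) %/ e = a * b * c * f.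
    by rewrite (mulnCA c) (mulnCA b) mulnCA mulKn ?mulnA//; lia.
  have -> : a * (b * (c * (e * f))) %/ f = a * b * c * e by rewrite !mulnA mulnK//; lia.
  lia.
Qed.

End VertexTypes.

Lemma isomorphic_plain (T : eqType) (X : seq (seq T)) (P : seq (seq nat)) :
  isomorphic X (plain P) -> isomorphic X P.
Proof.
move=> /(@isomorphic_relabel _ _ _ _ _ fst).
have -> : map (map fst) (plain P) = P.
  by rewrite -map_comp map_id_in// => s _ /=; rewrite -map_comp map_id.
apply=> u v /verticesP[_ /mapP[s _ ->] /mapP[u' _ ->]].
by move=> /verticesP[_ /mapP[t _ ->] /mapP[v' _ ->]] /= ->.
Qed.

Lemma isomorphic_relabel_vertices (T U : eqType) (X : seq (seq T)) (Y : seq (seq U)) :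
  isomorphic X Y -> isomorphic X (relabel Y).
Proof.
move=> /isomorphic_relabel; apply=> u v uY vY E.
by rewrite -(nth_index u uY) E nth_index.
Qed.

Lemma exceptional_vertex_count : all (fun z =>
    let P := foldr muln 1 z.1.1 in let S := sumn [seq P %/ p | p <- z.1.1] in
    (0 < P) && (z.1.2 * (2 * P + 2 * S - size z.1.1 * P) == 4 * P)) exceptional_types.
Proof. by vm_compute. Qed.

Definition classified (T : eqType) (X : seq (seq T)) : Prop :=
  (exists2 P, P \in platonic_solids & isomorphic X P) \/
  (exists2 P, P \in archimedean_solids & isomorphic X P) \/
  (exists2 n : nat, 3 <= n & isomorphic X (prism n)) \/
  (exists2 n : nat, 3 <= n & isomorphic X (antiprism n)) \/
  isomorphic X pseudorhombicuboctahedron.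

Lemma platonic_classified (T : eqType) (X : seq (seq T)) P :
  P \in platonic_solids -> isomorphic X (plain P) -> classified X.
Proof. by move=> PP /isomorphic_plain XP; left; exists P. Qed.

Lemma archimedean_classified (T : eqType) (X : seq (seq T)) (Y : seq (seq label)) :
  relabel Y \in archimedean_solids -> isomorphic X Y -> classified X.
Proof. by move=> PP /isomorphic_relabel_vertices XP; right; left; exists (relabel Y). Qed.

Lemma in_cons_cases (T : eqType) (x y : T) s : x \in y :: s -> x = y \/ x \in s.
Proof. by rewrite in_cons => /orP[/eqP|]; [left|right]. Qed.

Lemma exceptional_classified (T : eqType) (X : seq (seq T)) z P :
  z \in exceptional_types -> P \in z.2 -> isomorphic X P -> classified X.
Proof.
pose good (z : seq nat * nat * seq (seq (seq label))) :=
  forall P, P \in z.2 -> isomorphic X P -> classified X.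
have one (L : seq nat) N (Q : seq (seq label)) : (isomorphic X Q -> classified X) ->
    good (L, N, [:: Q]).
  by move=> H P' /=; rewrite mem_seq1 => /eqP ->.
have arch k (Y : seq (seq label)) : k < size archimedean_solids -> nth [::] archimedean_solids k = relabel Y ->
    isomorphic X Y -> classified X.
  by move=> kN E XY; apply: (archimedean_classified _ XY); rewrite -E; exact: mem_nth.
have plat k (Q : seq (seq nat)) : k < size platonic_solids -> nth [::] platonic_solids k = Q ->
    isomorphic X (plain Q) -> classified X.
  by move=> kN <- XQ; apply: (platonic_classified _ XQ); exact: mem_nth.
move=> zE; suff: good z by exact.
move: zE; rewrite /exceptional_types.
(* The numbers are positions in [platonic_solids] and [archimedean_solids]. *)
move=> /in_cons_cases[->|]; first exact/one/(plat 0).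
move=> /in_cons_cases[->|]; first exact/one/(plat 3).
move=> /in_cons_cases[->|]; first exact/one/(plat 4).
move=> /in_cons_cases[->|]; first exact/one/(arch 0).
move=> /in_cons_cases[->|]; first exact/one/(arch 2).
move=> /in_cons_cases[->|]; first exact/one/(arch 8).
move=> /in_cons_cases[->|]; first exact/one/(arch 3).
move=> /in_cons_cases[->|]; first exact/one/(arch 9).
move=> /in_cons_cases[->|]; first exact/one/(arch 5).
move=> /in_cons_cases[->|]; first exact/one/(arch 11).
move=> /in_cons_cases[->|]; first exact/one/(arch 1).
move=> /in_cons_cases[->|]; first exact/one/(arch 7).
move=> /in_cons_cases[->|].
  move=> {}P /in_cons_cases[->|/in_cons_cases[->|//]]; first exact: (arch 4).
  by move=> /isomorphic_plain; do 4! right.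
move=> /in_cons_cases[->|]; first exact/one/(arch 10).
move=> /in_cons_cases[->|]; first exact/one/(arch 6).
move=> /in_cons_cases[->|//]; exact/one/(arch 12).
Qed.

Section Classification.
Variables (T : eqType) (X : seq (seq T)).
Hypothesis X_map : polyhedral_map X.
Hypothesis X_nonempty : 0 < size X.
Hypothesis X_connected : forall C : T -> bool,
  (forall s u v, s \in X -> edge_of s u v -> C u = C v) ->
  {in vertices X &, forall u v, C u = C v}.
Hypothesis X_cocycle : forall c : T -> T -> bool,
  (forall u v, c u v = c v u) ->
  (forall s, s \in X -> \big[addb/false]_(u <- s) c u (next s u) = false) ->
  exists g : T -> bool, forall s u v, s \in X -> edge_of s u v -> c u v = g u (+) g v.

Let equation L (XL : has_type X L) := type_equation X_map X_nonempty X_connected X_cocycle XL.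

Lemma exceptional_case z : z \in exceptional_types -> has_type X z.1.1 -> classified X.
Proof.
move=> zE XL; have [x] := exists_flag X_map X_nonempty.
have /allP /(_ _ zE) /andP[P0 /eqP NE] := exceptional_vertex_count.
have N_eq : z.1.2 = size (vertices X).
  have := equation XL; move: P0 NE; rewrite sumnE big_map.
  have -> : foldr muln 1 z.1.1 = \prod_(p <- z.1.1) p by rewrite foldrE.
  set P := \prod_(p <- _) p; set S := \sum_(p <- _) _ => P0 NE /= VE.
  have VE' : size (vertices X) * (2 * P + 2 * S - size z.1.1 * P) = 4 * P.
    by rewrite mulnBr VE addKn.
  (* The subtraction is truncated; a zero difference would contradict 4 P > 0. *)
  have D0 : 0 < 2 * P + 2 * S - size z.1.1 * P.
    by rewrite lt0n; apply/eqP => D0; move: NE; rewrite D0 muln0; lia.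
  by apply/eqP; rewrite -(eqn_pmul2r D0) NE VE'.
have zE' : (z.1.1, z.1.2, z.2) \in exceptional_types by move: zE; case: (z) => -[].
have [P Pz XP] := exceptional_sound X_map XL X_connected x N_eq zE'.
exact: exceptional_classified zE Pz XP.
Qed.

Lemma exists_flag_size n l : has_type X (n :: l) -> exists x : flag X, flag_size x = n.
Proof.
move=> XL; have [x] := exists_flag X_map X_nonempty.
exact: exists_corner (flag_corner_system X_map XL x) x _ (mem_head n l).
Qed.

Lemma prism_case n : 3 <= n -> has_type X [:: n; 4; 4] -> isomorphic X (prism n).
Proof.
move=> n3 XL; have [x0 x0n] := exists_flag_size XL.
have D_sys := flag_corner_system X_map XL x0.
pose x i := iter i (flag_step X_map) x0.
have x_mod i : x (i %% n) = x i.
  by rewrite -x0n; apply: (iter_step_modn D_sys); rewrite x0n; exact: leq_trans n3.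
apply: (@isomorphic_prism _ _ X_map n n3 X_connected _ x
  (fun i => flag_step X_map (flag_rotate X_map (x i)))) => //.
(* Euler's relation reduces to 32 V = 64 n. *)
- have := equation XL; rewrite /= !(big_cons, big_nil) !muln1 !addn0.
  have -> : n * (4 * 4) %/ n = 16 by rewrite mulKn//; lia.
  have -> : n * (4 * 4) %/ 4 = 4 * n by rewrite mulnA mulnK// mulnC.
  nia.
- by move=> i; rewrite x_mod.
Qed.

Lemma antiprism_case n : 3 <= n -> has_type X [:: n; 3; 3; 3] -> isomorphic X (antiprism n).
Proof.
move=> n3 XL; have [x0 x0n] := exists_flag_size XL.
have D_sys := flag_corner_system X_map XL x0.
pose x i := iter i (flag_step X_map) x0.
have x_mod i : x (i %% n) = x i.
  by rewrite -x0n; apply: (iter_step_modn D_sys); rewrite x0n; exact: leq_trans n3.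
apply: (@isomorphic_antiprism _ _ X_map n n3 X_connected _ x
  (fun i => flag_step X_map (flag_rotate X_map (x i)))) => //.
(* Euler's relation reduces to 54 V = 108 n. *)
- have := equation XL; rewrite /= !(big_cons, big_nil) !muln1 !addn0.
  have -> : n * (3 * (3 * 3)) %/ n = 27 by rewrite mulKn//; lia.
  have -> : n * (3 * (3 * 3)) %/ 3 = 9 * n by rewrite (mulnC 3) mulnA mulnK// mulnC.
  nia.
- by move=> i; rewrite x_mod.
Qed.

Lemma classification L : has_type X L -> classified X.
Proof.
move=> XL.
have [l Xl [/mapP[z zE lE]|[n n3 [lE|lE]]]] :=
  has_listed_type X_map X_nonempty X_connected X_cocycle XL.
- by apply: exceptional_case zE _; rewrite -lE.
- by right; right; left; exists n => //; apply: prism_case => //; rewrite -lE.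
- by right; right; right; left; exists n => //; apply: antiprism_case => //; rewrite -lE.
Qed.

End Classification.

Theorem theorem1p1 (R : realType) (T : eqType) (X : seq (seq T))
    (X_sphere : map_on_sphere R X) (X_semi : semi_equivelar X) :
  (exists2 P, P \in platonic_solids & isomorphic X P) \/
  (exists2 P, P \in archimedean_solids & isomorphic X P) \/
  (exists2 n : nat, (3 <= n)%N & isomorphic X (prism n)) \/
  (exists2 n : nat, (3 <= n)%N & isomorphic X (antiprism n)) \/
  isomorphic X pseudorhombicuboctahedron.
Proof.
have [ty _ X_type] := X_semi.
have [s [u [v [sX _]]]] := map_nonempty X_sphere.
apply: (@classification _ X (proj1 X_sphere) _ (map_connected X_sphere)
  (map_cocycle X_sphere) (flatten [seq nseq p.2 p.1 | p <- ty])).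
  by move: sX; case: (X).
exact: X_type.
Qed.
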